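(* Let $f$ be a probability density on $[0,\infty)$ and let $$r(\alpha):=\int_0^\infty e^{-\alpha b(t)-\alpha^2t/2}f(t)\,dt .$$ Suppose that: 1. $b:[0,\infty)\to\mathbb R$ is continuous and satisfies $\lim_{t\uparrow\infty}(b(t)+\alpha t)>-\infty$ for all $\alpha>0$; 2. $r$ is completely monotone; 3. if a function $z$ on $[0,\infty)$ is such that $$\int_0^\infty e^{-\alpha b(t)-\alpha^2t/2}z(t)\,dt=0$$ holds for all $\alpha>0$, then $z$ is identically zero. Then there exists a random variable $X$ with moment generating function given by $r(\alpha)$ (that is, $\mathbb E[e^{-\alpha X}]=r(\alpha)$) such that $\tau_X$ has probability density function $f$.
   Context: $W_t$ is a standard Brownian motion started at $0$; $X\ge 0$ is a random variable independent of $W$; $\tau_X=\inf\{t>0: W_t+X\le b(t)\}$. The boundary $b$ satisfies $b(0)=0$ and is (standing assumption) continuously differentiable, which ensures that the conditional law of $\tau_X$ given $X=x$ has a continuous density $f(t|x)$. A function $r:[0,\infty)\to(0,\infty)$ is completely monotone if it has derivatives of all orders and $(-1)^n\frac{d^n}{d\alpha^n}r(\alpha)\ge 0$ for all $\alpha>0$ and all integers $n\ge0$. The moment generating function of a nonnegative random variable $X$ is taken in the form $\alpha\mapsto\mathbb E[e^{-\alpha X}]$. Functions are identified when equal almost everywhere. *)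

(* Defs.v *)
From HB Require Import structures.
From mathcomp Require Import all_boot all_order all_algebra.
From mathcomp Require Import all_classical all_reals all_analysis.
From mathcomp Require Import measurable_realfun.

Set Implicit Arguments.
Unset Strict Implicit.
Unset Printing Implicit Defensive.

Import Order.TTheory GRing.Theory Num.Theory.
Import numFieldNormedType.Exports.

Local Open Scope classical_set_scope.
Local Open Scope ring_scope.

(* A function on the half line [0, +oo[ is represented by a function on R; only
   its values at nonnegative arguments are ever used. *)

Definition continuous_on_halfline (R : realType) (g : R -> R) : Prop :=
  {within `[0, +oo[, continuous g}.

(* The difference quotient at t is taken along s >= 0, s != t, so that at t = 0
   it gives the right derivative. *)
Definition continuously_differentiable_on_halfline (R : realType)
    (g : R -> R) : Prop :=
  exists dg : R -> R, continuous_on_halfline dg /\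
    forall t : R, 0 <= t ->
      (g s - g t) / (s - t) @[s --> within [set s : R | 0 <= s] t^'] --> dg t.

(* Complete monotonicity of r : [0, +oo[ -> ]0, +oo[.  Continuity on the closed
   half line makes r 0 agree with the limit of r at 0+; the derivatives and
   their signs are only required on ]0, +oo[. *)
Definition completely_monotone (R : realType) (r : R -> R) : Prop :=
  [/\ forall a : R, 0 <= a -> 0 < r a,
      continuous_on_halfline r,
      forall (n : nat) (a : R), 0 < a -> derivable (derive1n n r) a 1 &
      forall (n : nat) (a : R), 0 < a -> 0 <= (-1) ^+ n * derive1n n r a].

Definition probability_density (R : realType) (f : R -> R) : Prop :=
  [/\ measurable_fun (`[0, +oo[%classic : set R) f,
      forall t : R, 0 <= t -> 0 <= f t &
      (\int[lebesgue_measure]_(t in `[0%R, +oo[) (f t)%:E = 1)%E].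

Definition hitting_kernel (R : realType) (b : R -> R) (a t : R) : R :=
  expR (- a * b t - a ^+ 2 * t / 2).

Definition hitting_transform (R : realType) (b f : R -> R) (a : R) : R :=
  Rintegral lebesgue_measure `[0, +oo[ (fun t => hitting_kernel b a t * f t).

(* z ranges over the functions for which all the integrals are defined. *)
Definition kernel_complete (R : realType) (b : R -> R) : Prop :=
  forall z : R -> R,
    measurable_fun (`[0, +oo[%classic : set R) z ->
    (forall a : R, 0 < a ->
      lebesgue_measure.-integrable `[0, +oo[
        (fun t : R => (hitting_kernel b a t * z t)%:E)) ->
    (forall a : R, 0 < a ->
      (\int[lebesgue_measure]_(t in `[0%R, +oo[)
         (hitting_kernel b a t * z t)%:E = 0)%E) ->
    {ae lebesgue_measure, forall t : R, 0 <= t -> z t = 0}.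

Section Processes.
Context (R : realType) (d : measure_display) (T : measurableType d).
Implicit Types (P : probability T R) (W : R -> T -> R) (X : T -> R).

Definition increment W (s t : R) : T -> R := fun w => W t w - W s w.

(* The second argument of [normal_prob] is the standard deviation. *)
Definition standard_brownian_motion P W : Prop :=
  [/\ forall t : R, 0 <= t -> measurable_fun setT (W t),
      {ae P, forall w, W 0 w = 0},
      forall w, continuous_on_halfline (fun t => W t w),
      forall (n : nat) (t : nat -> R) (B : nat -> set R),
        0 <= t 0%N -> (forall i, (i < n)%N -> t i < t i.+1) ->
        (forall i, (i < n)%N -> measurable (B i)) ->
        P (\bigcap_(i in `I_n) (increment W (t i) (t i.+1) @^-1` B i)) =
        (\prod_(i < n) P (increment W (t i) (t i.+1) @^-1` B i))%E &
      forall (s t : R) (B : set R), 0 <= s -> s < t -> measurable B ->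
        P (increment W s t @^-1` B) = normal_prob 0 (Num.sqrt (t - s)) B].

Definition sigma_process W : set (set T) :=
  <<s [set A | exists t : R, 0 <= t /\
        exists B : set R, measurable B /\ A = W t @^-1` B] >>.

Definition independent_of_process P X W : Prop :=
  forall (A : set T) (B : set R), sigma_process W A -> measurable B ->
    (P (A `&` X @^-1` B) = P A * P (X @^-1` B))%E.

(* The infimum over the empty set is +oo. *)
Definition hitting_time (b : R -> R) W X : T -> \bar R := fun w =>
  ereal_inf [set t%:E | t in [set t : R | 0 < t /\ W t w + X w <= b t]].

(* f is a density on [0, +oo[; when its total mass is 1, taking A = setT shows
   that tau is almost surely finite. *)
Definition has_density P (tau : T -> \bar R) (f : R -> R) : Prop :=
  measurable_fun setT tau /\
  forall A : set R, measurable A ->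
    P (tau @^-1` (EFin @` A)) =
    (\int[lebesgue_measure]_(t in A `&` `[0%R, +oo[) (f t)%:E)%E.

End Processes.

(* (T', P') extends (T, P) through pr: events and random variables of T are
   pulled back along pr, and keep their joint laws. *)
Definition probability_extension (R : realType) (d d' : measure_display)
    (T : measurableType d) (P : probability T R)
    (T' : measurableType d') (P' : probability T' R) (pr : T' -> T) : Prop :=
  measurable_fun setT pr /\
  forall A : set T, measurable A -> P' (pr @^-1` A) = P A.

(* Main.v *)
(** By Bernstein's theorem the transform r of f is the Laplace transform of a random
variable X >= 0, realized on a second factor of a product space and hence
independent of W; since b grows at least like -Ct, r(a) tends to 0 as a tends to
+oo, so X > 0 almost surely.  For a starting point x > 0, optional stopping of the
martingale exp (- a W_t - a^2 t / 2) at tau_x gives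
E [exp (- a b(tau_x) - a^2 tau_x / 2); tau_x < +oo] = exp (- a x), because the
kernel decays exponentially in t.  Integrating over x, the law of tau_X has the same
transform r as f.  It remains to know that this law has a density z, as completeness
of the kernel applied to z - f then gives z = f.  For this P(t < tau_x <= t + h) is
bounded by C h uniformly for t in compact subsets of ]0, +oo[: such a path avoids the
boundary up to t and comes within about sqrt h of it, and reversing time at t shows
that this has probability of order sqrt h (avoiding a line started at distance
sqrt h) times sqrt h (the bounded density of an independent increment). *)

Require Import Defs.
From HB Require Import structures.
From mathcomp Require Import all_boot all_order all_algebra.
From mathcomp Require Import all_classical all_reals all_analysis.
From mathcomp Require Import measurable_realfun.
From mathcomp Require Import ring lra.

Set Implicit Arguments.
Unset Strict Implicit.
Unset Printing Implicit Defensive.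

Import Order.TTheory GRing.Theory Num.Theory.
Import numFieldNormedType.Exports.

Local Open Scope classical_set_scope.
Local Open Scope ring_scope.

(** Completeness of the kernel speaks of functions only, so the law of the hitting time must be
    absolutely continuous before it can be compared with [f]; its Radon-Nikodym derivative is then
    available. It suffices to show, for each fixed start x > 0, that null sets of times have
    probability 0: this survives integration over x without any uniformity in x. The estimate uses
    Brownian increments both restarted at t and reversed from t. Optional stopping is therefore
    proved for an abstract process with Gaussian exponential moments and increments independent of
    its past, an interface that both satisfy. Bernstein's theorem is derived from Hausdorff's moment
    problem. On the grid of step 1/M, the values of r form a moment sequence for the variable exp (-
    X / M). The M-th powers of the quantile functions of approximate solutions converge to a
    quantile function of exp (- X); an atom of the latter at 0, that is X = +oo, is excluded by
    continuity of r at 0. *)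

Lemma within_continuous_cvg (R : realType) (I : Type) (F : set_system I)
    {FF : Filter F} (A : set R) (g : R -> R) (u : I -> R) (l : R) :
  {within A, continuous g} -> A l -> (forall i, A (u i)) ->
  u i @[i --> F] --> l -> g (u i) @[i --> F] --> g l.
Proof.
move=> /subspace_continuousP cg Al Au ul.
apply: (@cvg_comp _ _ _ u g _ (within A (nbhs l)) _ _ (cg l Al)) => B /= lB.
by apply: (@filterS _ F FF (fun i => A (u i) -> B (u i))) (ul _ lB) => i; apply.
Qed.

(** * Independence and densities *)

Section independence.
Local Open Scope ereal_scope.
Context (R : realType) (d : measure_display) (T : measurableType d)
  (P : probability T R).

(** Both sides are finite measures in [A], the right one being [P] scaled by the number [P B];
    agreement on the pi-system [G] extends to the sigma-algebra that it generates. *)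
Lemma independent_g_sigma_algebra_l (G : set (set T)) (B : set T) :
  measurable B -> G `<=` measurable -> setI_closed G -> G setT ->
  (forall A, G A -> P (A `&` B) = P A * P B) ->
  forall A, <<s G >> A -> P (A `&` B) = P A * P B.
Proof.
move=> mB Gm GI GT GB A GA.
have PB0 : (0 <= fine (P B))%R by rewrite fine_ge0.
rewrite muleC -(fineK (fin_num_measure P _ mB)).
apply: (g_sigma_algebra_measure_unique G Gm (fun=> setT) _ _
  (mrestr P mB) (mscale (NngNum PB0) P)) => //.
- by rewrite bigcup_const.
- move=> C GC; rewrite [LHS](GB _ GC) [LHS]muleC; congr (_ * _).
  by apply/esym/fineK; exact: fin_num_measure.
- by move=> _; rewrite /= /mrestr setTI -ge0_fin_numE// fin_num_measure.
Qed.

Lemma independent_g_sigma_algebra (G H : set (set T)) :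
  G `<=` measurable -> setI_closed G -> G setT ->
  H `<=` measurable -> setI_closed H -> H setT ->
  (forall A B, G A -> H B -> P (A `&` B) = P A * P B) ->
  forall A B, <<s G >> A -> <<s H >> B -> P (A `&` B) = P A * P B.
Proof.
move=> Gm GI GT Hm HI HT GH A B GA HB.
have sHm : <<s H >> `<=` measurable.
  by apply: smallest_sub => //; exact: sigma_algebra_measurable.
apply: (@independent_g_sigma_algebra_l G B) => //; first exact: sHm.
move=> C GC; rewrite setIC muleC.
by apply: (@independent_g_sigma_algebra_l H C) => //;
  [exact: Gm|move=> D HD; rewrite setIC muleC; exact: GH].
Qed.

End independence.

Section law.
Context (R : realType) (d d' : measure_display) (T : measurableType d)
  (T' : measurableType d') (P : probability T R) (f : T -> T').
Hypothesis mf : measurable_fun setT f.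

(* The proof of measurability is an argument so that [law] is canonically a
   probability. *)
Definition law (_ : measurable_fun setT f) : set T' -> \bar R :=
  pushforward P f.

Let law0 : law mf set0 = 0%E.
Proof. by rewrite /law /pushforward preimage_set0 measure0. Qed.

Let law_ge0 A : (0 <= law mf A)%E.
Proof. exact: measure_ge0. Qed.

Let law_additive : semi_sigma_additive (law mf).
Proof. exact: (@measure_semi_sigma_additive _ _ _ (pushforward P f)). Qed.

HB.instance Definition _ := isMeasure.Build _ _ _ (law mf) law0 law_ge0
  law_additive.

Let law_setT : law mf setT = 1%E.
Proof. by rewrite /law /pushforward preimage_setT probability_setT. Qed.

HB.instance Definition _ := Measure_isProbability.Build _ _ _ (law mf) law_setT.

Lemma ge0_integral_law (g : T' -> \bar R) :
  measurable_fun setT g -> (forall y, 0 <= g y)%E ->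
  (\int[law mf]_y g y = \int[P]_x g (f x))%E.
Proof.
move=> mg g0.
transitivity (\int[pushforward P f]_y g y)%E.
  by apply: eq_measure_integral.
by rewrite ge0_integral_pushforward.
Qed.

End law.

Section independent_integral.
Local Open Scope ereal_scope.
Context (R : realType) (d d1 d2 : measure_display) (T : measurableType d)
  (T1 : measurableType d1) (T2 : measurableType d2) (P : probability T R).
Variables (U : T -> T1) (Y : T -> T2).
Hypotheses (mU : measurable_fun setT U) (mY : measurable_fun setT Y).

Lemma measurable_fun_integral_l (g : T1 * T2 -> \bar R) :
  measurable_fun setT g -> (forall z, 0 <= g z) ->
  measurable_fun setT (fun w => \int[P]_w' g (U w', Y w)).
Proof.
move=> mg g0.
have mF : measurable_fun setT (fun y => \int[law P mU]_x g (x, y)).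
  exact: measurable_fun_fubini_tonelli_G.
rewrite (_ : (fun w => _) = (fun y => \int[law P mU]_x g (x, y)) \o Y).
  exact: measurableT_comp.
apply/funext => w /=; apply/esym.
apply: (ge0_integral_law P mU (g := fun x => g (x, Y w))) => //.
exact: measurable_fun_pair1.
Qed.

Hypothesis UY : forall A B, measurable A -> measurable B ->
  P (U @^-1` A `&` Y @^-1` B) = P (U @^-1` A) * P (Y @^-1` B).

(** Freezing lemma: independence makes the joint law of [(U, Y)] the product of the two laws, and
    Tonelli integrates [U] out with [Y] held fixed. *)
Lemma ge0_integral_independent (g : T1 * T2 -> \bar R) :
  measurable_fun setT g -> (forall z, 0 <= g z) ->
  \int[P]_w g (U w, Y w) = \int[P]_w \int[P]_w' g (U w', Y w).
Proof.
move=> mg g0.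
have mUY : measurable_fun setT (fun w => (U w, Y w)).
  exact: measurable_fun_pair.
rewrite -(ge0_integral_law P mUY)//.
transitivity (\int[law P mU \x law P mY]_z g z).
  apply: eq_measure_integral => A mA _; apply/esym.
  by apply: product_measure_unique => // B C mB mC; rewrite -[RHS]UY.
rewrite fubini_tonelli2//.
have mF : measurable_fun setT (fun y => \int[law P mU]_x g (x, y)).
  exact: measurable_fun_fubini_tonelli_G.
rewrite ge0_integral_law//; last by move=> y; apply: integral_ge0.
apply: eq_integral => w _.
apply: (ge0_integral_law P mU (g := fun x => g (x, Y w))) => //.
exact: measurable_fun_pair1.
Qed.

End independent_integral.

Section density.
Local Open Scope ereal_scope.
Context (R : realType) (d : measure_display) (T : measurableType d)
  (nu mu : {measure set T -> \bar R}) (h : T -> R).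
Hypotheses (mh : measurable_fun setT h) (h0 : forall x, (0 <= h x)%R)
  (nuE : forall A, measurable A -> nu A = \int[mu]_(x in A) (h x)%:E).

Import HBNNSimple.

Let hE0 x : 0 <= (h x)%:E. Proof. by rewrite lee_fin. Qed.

Let mhE : measurable_fun setT (fun x => (h x)%:E).
Proof. exact/measurable_EFinP. Qed.

Let integral_density_nnsfun (f : {nnsfun T >-> R}) :
  \int[nu]_x (f x)%:E = \int[mu]_x ((f x)%:E * (h x)%:E).
Proof.
have f0 r x : 0 <= (r * \1_(f @^-1` [set r]) x)%:E.
  by rewrite EFinM; exact: nnfun_muleindic_ge0.
have mf r : measurable_fun setT (fun x => (r * \1_(f @^-1` [set r]) x)%:E).
  exact/measurable_EFinP/measurable_funM.
under [LHS]eq_integral do rewrite fimfunE -fsumEFin//.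
rewrite [LHS]ge0_integral_fsum//.
under [RHS]eq_integral => x _ do rewrite fimfunE -fsumEFin// ge0_mule_fsuml//.
rewrite [RHS]ge0_integral_fsum//; first last.
- by move=> r x _; rewrite mule_ge0.
- by move=> r; apply: emeasurable_funM.
apply: eq_fsbigr => r _.
rewrite integralZl_indic_nnsfun// integral_indic// setIT nuE//.
have [r0|r0] := leP 0%R r; last first.
  rewrite preimage_nnfun0// integral_set0 mule0 integral0_eq// => x _.
  by rewrite indic0 mulr0 mul0e.
under [RHS]eq_integral => x _ do rewrite EFinM -muleA.
rewrite ge0_integralZl//; last 2 first.
- by apply: emeasurable_funM => //; exact/measurable_EFinP/measurable_indic.
- by move=> x _; rewrite mule_ge0//; rewrite ?lee_fin.
congr (_ * _); rewrite [LHS]integral_mkcond; apply: eq_integral => x _.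
rewrite patchE indicE; case: ifPn => _; first by rewrite mul1e.
by rewrite mul0e.
Qed.

Lemma ge0_integral_density (g : T -> R) :
  measurable_fun setT g -> (forall x, 0 <= g x)%R ->
  \int[nu]_x (g x)%:E = \int[mu]_x (g x * h x)%:E.
Proof.
move=> mg g0.
have mgE : measurable_fun setT (fun x => (g x)%:E) by exact/measurable_EFinP.
pose f_ := nnsfun_approx measurableT mgE.
have f_cvg x : (f_ n x)%:E @[n --> \oo] --> (g x)%:E.
  by apply: (cvg_nnsfun_approx measurableT mgE) => // y _; rewrite lee_fin.
have f_nd x : {homo f_ ^~ x : m n / (m <= n)%N >-> (m <= n)%R}.
  by move=> m n mn; exact/lefP/nd_nnsfun_approx.
transitivity (limn (fun n => \int[nu]_x (f_ n x)%:E)).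
  rewrite -monotone_convergence//.
  - by apply: eq_integral => x _; apply/esym/cvg_lim => //; exact: f_cvg.
  - by move=> n; exact/measurable_EFinP/measurable_funP.
  - by move=> n x _; rewrite lee_fin.
  - by move=> x _ m n mn; rewrite lee_fin f_nd.
under eq_fun do rewrite integral_density_nnsfun.
rewrite -monotone_convergence//.
- apply: eq_integral => x _; apply/cvg_lim => //; rewrite EFinM.
  by apply: cvgeM => //; exact: cvg_cst.
- by move=> n; apply: emeasurable_funM => //; exact/measurable_EFinP/measurable_funP.
- by move=> n x _; rewrite mule_ge0//; rewrite ?lee_fin.
- by move=> x _ m n mn; apply: lee_wpmul2r => //; rewrite lee_fin f_nd.
Qed.

End density.

Section normal.
Context (R : realType).

(** Completing the square: the tilt by [expR (a * x)] moves the mean of the normal density to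
    [a * s ^+ 2] and leaves a constant factor. *)
Lemma normal_mgf (s a : R) : s != 0 ->
  (\int[normal_prob 0 s]_x (expR (a * x))%:E = (expR (a ^+ 2 * s ^+ 2 / 2))%:E)%E.
Proof.
move=> s0.
rewrite (@ge0_integral_density _ _ _ _ lebesgue_measure (normal_pdf 0 s))//.
- transitivity (\int[lebesgue_measure]_x
      ((expR (a ^+ 2 * s ^+ 2 / 2))%:E * (normal_pdf (a * s ^+ 2) s x)%:E))%E.
    apply: eq_integral => x _; rewrite -EFinM; congr EFin.
    rewrite !normal_pdfE// mulrCA [RHS]mulrCA; congr (_ * _).
    rewrite /normal_fun -!expRD; congr expR.
    by field; rewrite s0.
  rewrite ge0_integralZl//.
  + by rewrite integral_normal_pdf mule1.
  + apply/measurable_EFinP; exact: measurable_normal_pdf.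
  + by move=> x _; rewrite lee_fin normal_pdf_ge0.
- exact: measurable_normal_pdf.
- by move=> x; exact: normal_pdf_ge0.
- by apply: measurableT_comp => //; exact: measurable_funM.
Qed.

Lemma normal_prob_itv_le (s c u : R) : s != 0 -> 0 <= u ->
  (normal_prob 0 s [set` `[c, (c + u)%R]] <= (normal_peak s * u)%:E)%E.
Proof.
move=> s0 u0.
apply: (@le_trans _ _ (\int[lebesgue_measure]_(x in [set` `[c, (c + u)%R]]) (normal_peak s)%:E)%E).
  apply: ge0_le_integral => //.
  - by move=> x _; rewrite lee_fin normal_pdf_ge0.
  - by apply/measurable_EFinP/measurable_funTS; exact: measurable_normal_pdf.
  - by move=> x _; rewrite lee_fin normal_pdf_ub.
rewrite integral_cst//= lebesgue_measure_itv/= lte_fin.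
case: ifPn => _; last by rewrite mule0 lee_fin mulr_ge0// normal_peak_ge0.
by rewrite -EFinD addrAC subrr add0r -EFinM.
Qed.

End normal.

(** * Independence of past and future increments *)

Section past_future.
Context (R : realType) (d : measure_display) (T : measurableType d)
  (P : probability T R) (W : R -> T -> R).
Implicit Types (Q : set R) (s t : R).

(** Increments are taken from a base time [s]: [0] describes the past of a time [t], and [t] itself
    its future. *)
Definition increment_events s Q : set (set T) :=
  [set A | exists q B, [/\ Q q, measurable B & A = increment W s q @^-1` B]].

Definition increments_sigma s Q : set (set T) := <<s increment_events s Q >>.

Lemma increments_sigma_sub s Q (G : set (set T)) :
  (forall q, Q q ->
    measurable_fun setT (increment W s q : g_sigma_algebraType G -> R)) ->
  increments_sigma s Q `<=` <<s G >>.
Proof.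
move=> QG; apply: smallest_sub; first exact: smallest_sigma_algebra.
move=> _ [q [B [Qq mB ->]]].
by rewrite -[X in <<s G >> X]setTI; exact: (QG q Qq).
Qed.

Lemma measurable_increments_sigma s Q q : Q q ->
  measurable_fun setT
    (increment W s q : g_sigma_algebraType (increment_events s Q) -> R).
Proof.
by move=> Qq _ B mB; rewrite setTI; apply: sub_sigma_algebra; exists q, B.
Qed.

Lemma increments_sigmaS s Q1 Q2 : Q1 `<=` Q2 ->
  increments_sigma s Q1 `<=` increments_sigma s Q2.
Proof.
by move=> Q12; apply: sub_sigma_algebra2 => A [q [B [/Q12 Qq mB ->]]]; exists q, B.
Qed.

Lemma increments_sigmaI s Q A B : increments_sigma s Q A ->
  increments_sigma s Q B -> increments_sigma s Q (A `&` B).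
Proof.
exact: (@measurableI _ (g_sigma_algebraType (increment_events s Q))).
Qed.

Lemma increments_sigmaT s Q : increments_sigma s Q setT.
Proof. exact: (@measurableT _ (g_sigma_algebraType (increment_events s Q))). Qed.

Hypothesis hW : standard_brownian_motion P W.

Let mW t : 0 <= t -> measurable_fun setT (W t).
Proof. by case: hW => + _ _ _ _; exact. Qed.

Lemma measurable_increment s t : 0 <= s -> 0 <= t ->
  measurable_fun setT (increment W s t).
Proof. by move=> s0 t0; apply: measurable_funB; exact: mW. Qed.

Lemma increments_sigma_measurable s Q : 0 <= s -> Q `<=` [set q | 0 <= q] ->
  increments_sigma s Q `<=` measurable.
Proof.
move=> s0 Q0; apply: smallest_sub; first exact: sigma_algebra_measurable.
move=> _ [q [B [/Q0 q0 mB ->]]]; rewrite -[X in measurable X]setTI.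
exact: measurable_increment.
Qed.

Section grid.
Variables (n : nat) (t : nat -> R).
Hypotheses (t0 : 0 <= t 0%N) (t_incr : forall i, (i < n)%N -> t i < t i.+1).

Let xi i := increment W (t i) (t i.+1).

Let mxi i : (i < n)%N -> measurable_fun setT (xi i).
Proof.
move=> ni; have t_ge0 : forall j, (j <= n)%N -> 0 <= t j.
  elim=> // j ih jn; apply: (le_trans (ih (ltnW jn))).
  exact/ltW/t_incr.
by apply: measurable_increment; apply: t_ge0 => //; exact: ltnW.
Qed.

(** Leaving the steps outside [D] free through [setT] keeps the index set [I_n] common to all
    events, so the product formula for increments applies to them and to their intersections. *)
Definition grid_events (D : set nat) : set (set T) :=
  [set A | exists B : nat -> set R, [/\ forall i, measurable (B i),
    forall i, ~ D i -> B i = setT &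
    A = \bigcap_(i in `I_n) (increment W (t i) (t i.+1) @^-1` B i)]].

Let grid_eventsI D : setI_closed (grid_events D).
Proof.
move=> _ _ [B [mB BT ->]] [C [mC CT ->]].
exists (fun i => B i `&` C i); split.
- by move=> i; exact: measurableI.
- by move=> i Di; rewrite BT// CT// setIT.
- by rewrite -bigcapI.
Qed.

Let grid_eventsT D : grid_events D setT.
Proof.
by exists (fun=> setT); split => //; rewrite bigcapT.
Qed.

Let grid_events_measurable D : grid_events D `<=` measurable.
Proof.
move=> _ [B [mB _ ->]]; apply: fin_bigcap_measurable => // i ni.
by rewrite -[X in measurable X]setTI; exact: mxi.
Qed.

(** With disjoint index sets each step carries a constraint from at most one of the two events, so
    the product over the steps splits factor by factor. *)
Lemma grid_events_independent (D1 D2 : set nat) : D1 `&` D2 = set0 ->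
  forall A B, <<s grid_events D1 >> A -> <<s grid_events D2 >> B ->
  (P (A `&` B) = P A * P B)%E.
Proof.
move=> D12; apply: independent_g_sigma_algebra => //.
move=> _ _ [B [mB BT ->]] [C [mC CT ->]].
case: hW => _ _ _ ind _.
rewrite -bigcapI; under eq_bigcapr do rewrite -preimage_setI.
rewrite !ind//; last by move=> i _; exact: measurableI.
rewrite -big_split/=; apply: eq_bigr => i _.
have [iD|iD] := pselect (D1 i).
  rewrite (CT i) ?preimage_setT ?probability_setT ?mule1 ?setIT// => D2i.
  by have : (D1 `&` D2) i by []; rewrite D12.
by rewrite (BT i)// preimage_setT probability_setT mul1e setTI.
Qed.

Lemma measurable_grid_increment (D : set nat) i j : (i <= j)%N -> (j <= n)%N ->
  [set k | (i <= k < j)%N] `<=` D ->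
  measurable_fun setT
    (increment W (t i) (t j) : g_sigma_algebraType (grid_events D) -> R).
Proof.
move=> ij jn ijD.
(* The test inside the sum makes every summand measurable, as measurability of the sum is asked for
   all indices and not only those in the range. *)
have -> : increment W (t i) (t j) = (fun w =>
    \sum_(i <= k < j) (if (i <= k < j)%N then xi k else cst 0) w).
  apply/funext => w; rewrite /increment -(telescope_sumr (fun k => W (t k) w))//.
  by apply: eq_big_nat => k ->.
apply: (@measurable_sum _ (g_sigma_algebraType (grid_events D)) _ _ _ _
  (fun k => if (i <= k < j)%N then xi k else cst 0)).
move=> k; case: ifP => [ikj|_]; last exact: measurable_cst.
have /andP[_ kj] := ikj; have Dk := ijD _ ikj.
move=> _ B mB; rewrite setTI.
have kn : (k < n)%N by exact: leq_trans jn.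
apply: sub_sigma_algebra.
exists (fun l => if l == k then B else setT); split.
- by move=> l; case: ifP.
- by move=> l Dl; case: eqP => // lk; rewrite lk in Dl.
- apply/seteqP; split=> [w Bw l ln|w /(_ k kn)]; last by rewrite eqxx.
  by rewrite /preimage/=; case: eqP => // ->.
Qed.

End grid.

Let merged_grid (l : seq R) := sort <=%R (undup l).

Let merged_grid_ltn l i : (i.+1 < size (merged_grid l))%N ->
  (merged_grid l)`_i < (merged_grid l)`_i.+1.
Proof.
move=> il; have : sorted <%R (merged_grid l).
  by rewrite lt_sorted_uniq_le sort_uniq undup_uniq sort_le_sorted.
by move=> /(lt_sorted_ltn_nth 0) -> //; rewrite ?inE// ltnW.
Qed.

Let merged_grid_index l a b : a \in l -> b \in l -> a <= b ->
  (index a (merged_grid l) <= index b (merged_grid l))%N.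
Proof.
move=> al bl ab; rewrite leqNgt; apply/negP => ba.
have sg : sorted <=%R (merged_grid l) by exact: sort_le_sorted.
have gl x : x \in l -> x \in merged_grid l by rewrite mem_sort mem_undup.
have ba' := sorted_ltn_index le_trans sg b a (gl _ bl) (gl _ al) ba.
by move: ba; rewrite (@le_anti _ _ a b) ?ltnn// ab.
Qed.

(* Both sigma-algebras are generated by events involving finitely many times, and
   these are events about the independent increments along a common grid. *)
Lemma past_future_independent t A B : 0 <= t ->
  increments_sigma 0 `[0, t] A -> increments_sigma t `[t, +oo[ B ->
  (P (A `&` B) = P A * P B)%E.
Proof.
move=> t0.
pose fin_events s Q := [set A | exists l : seq R,
  (forall q, q \in l -> Q q) /\ increments_sigma s [set` l] A].
have finI s Q : setI_closed (fin_events s Q).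
  move=> A1 A2 [l1 [l1Q A1l]] [l2 [l2Q A2l]]; exists (l1 ++ l2); split.
    by move=> q; rewrite mem_cat => /orP[/l1Q|/l2Q].
  apply: increments_sigmaI;
    [apply: increments_sigmaS A1l|apply: increments_sigmaS A2l] => q /= ql.
  - by rewrite mem_cat ql.
  - by rewrite mem_cat ql orbT.
have finT s Q : fin_events s Q setT.
  by exists [::]; split => //; exact: increments_sigmaT.
have fin_gen s Q C : increments_sigma s Q C -> <<s fin_events s Q >> C.
  apply: sub_sigma_algebra2 => _ [q [B' [Qq mB' ->]]]; exists [:: q]; split.
    by move=> r; rewrite inE => /eqP ->.
  by apply: sub_sigma_algebra; exists q, B'; rewrite /= inE eqxx.
have fin_meas s Q : 0 <= s -> Q `<=` [set q | 0 <= q] ->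
    fin_events s Q `<=` measurable.
  move=> s0 Q0 C [l [lQ Cl]].
  by apply: increments_sigma_measurable Cl => // q /= /lQ /Q0.
have past0 : [set` `[0, t]] `<=` [set q : R | 0 <= q].
  by move=> q /=; rewrite in_itv/= => /andP[].
have future0 : [set` `[t, +oo[] `<=` [set q : R | 0 <= q].
  by move=> q /=; rewrite in_itv/= andbT; exact: le_trans.
move=> /fin_gen At /fin_gen Bt; move: A B At Bt.
apply: independent_g_sigma_algebra => //; [exact: fin_meas|exact: fin_meas|].
move=> A B [l1 [l1Q Al1]] [l2 [l2Q Bl2]].
(* [0] and [t] are put on the grid so that every increment starting from them is a sum of grid
   steps; the index [k] of [t] separates past steps from future ones. *)
pose l := [:: 0, t & l1 ++ l2]; pose g := merged_grid l.
pose k := index t g; pose n := (size g).-1; pose tt i := g`_i.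
have gl : g =i l by move=> x; rewrite mem_sort mem_undup.
have l0 x : x \in l -> 0 <= x.
  rewrite !inE mem_cat => /or4P[/eqP->|/eqP->|/l1Q/past0|/l2Q/future0] //.
have sg : size g = n.+1.
  rewrite prednK// lt0n size_eq0; apply/eqP => g0.
  by have := gl 0; rewrite g0 !inE eqxx.
have tt0 : 0 <= tt 0%N by apply: l0; rewrite -gl mem_nth// sg.
have tt_incr i : (i < n)%N -> tt i < tt i.+1.
  by move=> ni; apply: merged_grid_ltn; rewrite -/g sg.
have idx x : x \in l -> (index x g <= n)%N.
  by move=> xl; rewrite -ltnS -sg index_mem gl.
have ttE x : x \in l -> tt (index x g) = x by move=> xl; rewrite /tt nth_index ?gl.
have l_0 : 0 \in l by rewrite !inE eqxx.
have l_t : t \in l by rewrite !inE eqxx orbT.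
have l_1 q : q \in l1 -> q \in l by move=> ql; rewrite !inE mem_cat ql !orbT.
have l_2 q : q \in l2 -> q \in l by move=> ql; rewrite !inE mem_cat ql !orbT.
apply: (@grid_events_independent n tt tt0 tt_incr
  [set i | (i < k)%N] [set i | (k <= i)%N]).
- by apply/seteqP; split => // i [/= ik]; rewrite leqNgt ik.
- apply: increments_sigma_sub Al1 => q /= ql1.
  rewrite -(ttE _ l_0) -(ttE q (l_1 _ ql1)).
  apply: measurable_grid_increment => //.
  + by apply: merged_grid_index => //; [exact: l_1|exact/l0/l_1].
  + exact/idx/l_1.
  + move=> i /= /andP[_ iq]; apply: (leq_trans iq).
    apply: merged_grid_index => //; first exact: l_1.
    by have := l1Q _ ql1; rewrite /= in_itv/= => /andP[].
- apply: increments_sigma_sub Bl2 => q /= ql2.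
  rewrite -{1}(ttE _ l_t) -(ttE q (l_2 _ ql2)).
  apply: measurable_grid_increment => //.
  + apply: merged_grid_index => //; first exact: l_2.
    by have := l2Q _ ql2; rewrite /= in_itv/= andbT.
  + exact/idx/l_2.
  + by move=> i /= /andP[].
Qed.

End past_future.

(** * Optional stopping for exponential martingales *)

Section optional_stopping.
Context (R : realType) (d : measure_display) (T : measurableType d)
  (P : probability T R).
Implicit Types (V : R -> T -> R) (a s t H : R).

(* Brownian motion on [0, H] as far as exponential martingales can tell. *)
Definition exponential_brownian V H : Prop :=
  [/\ forall w, V 0 w = 0,
      forall t, 0 <= t <= H -> measurable_fun setT (V t),
      forall w, {within `[0, H], continuous (V ^~ w)},
      forall a s t, 0 <= s -> s < t -> t <= H ->
        (\int[P]_w (expR (a * increment V s t w))%:E =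
         (expR (a ^+ 2 * (t - s) / 2))%:E)%E &
      forall s t A B, 0 <= s -> s < t -> t <= H ->
        increments_sigma V 0 `[0, s] A -> measurable B ->
        (P (A `&` increment V s t @^-1` B) =
         P A * P (increment V s t @^-1` B))%E].

(** The events [s < sigma] with [s < H] are what the rounding of [sigma] to a grid of [[0, H]] has
    to decide at each grid point. *)
Definition stopping_time V H (sigma : T -> R) : Prop :=
  (forall w, 0 <= sigma w <= H) /\
  (forall s, 0 <= s < H -> increments_sigma V 0 `[0, s] [set w | s < sigma w]).

Definition exp_martingale V a t : T -> R :=
  fun w => expR (- a * V t w - a ^+ 2 * t / 2).

Section theory.
Variables (V : R -> T -> R) (H : R).
Hypotheses (H0 : 0 < H) (hV : exponential_brownian V H).

Local Notation F s := (g_sigma_algebraType (increment_events V 0 `[0, s]%classic)).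

Lemma exponential_brownian_adapted s : 0 <= s ->
  measurable_fun setT (V s : F s -> R).
Proof.
move=> s0; have -> : V s = increment V 0 s.
  by apply/funext => w; case: hV => V0 _ _ _ _; rewrite /increment V0 subr0.
by apply: measurable_increments_sigma; rewrite /= in_itv/= s0 lexx.
Qed.

Lemma exponential_brownian_sub s : s <= H ->
  increments_sigma V 0 `[0, s] `<=` measurable.
Proof.
move=> sH; apply: smallest_sub; first exact: sigma_algebra_measurable.
move=> _ [q [B [qs0 mB ->]]].
have /andP[q0 qs] : 0 <= q <= s by move: qs0; rewrite /= in_itv.
case: hV => V0 mV _ _ _; rewrite -[X in measurable X]setTI.
have mVq : measurable_fun setT (V q) by apply: mV; rewrite q0 (le_trans qs).
have mV0 : measurable_fun setT (V 0) by apply: mV; rewrite lexx ltW.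
exact: (measurable_funB mVq mV0).
Qed.

Let sub_measurable_fun s (Y : T -> R) : s <= H ->
  measurable_fun setT (Y : F s -> R) -> measurable_fun setT Y.
Proof.
move=> sH mY _ B mB; apply: (exponential_brownian_sub sH); exact: mY.
Qed.

(** Martingale property tested against a nonnegative variable of the past: the factor gained between
    [s] and [t] is independent of [Y] and has mean 1. *)
Lemma exp_martingale_step a s t (Y : T -> R) : 0 <= s -> s < t -> t <= H ->
  measurable_fun setT (Y : F s -> R) -> (forall w, 0 <= Y w) ->
  (\int[P]_w (Y w * expR (- a * increment V s t w - a ^+ 2 * (t - s) / 2))%:E =
   \int[P]_w (Y w)%:E)%E.
Proof.
move=> s0 st tH mY Y0; case: (hV) => V0 mV cV mgf ind.
have sH : s <= H by exact/ltW/(lt_le_trans st).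
have mU : measurable_fun setT (increment V s t).
  by apply: measurable_funB; apply: mV; rewrite ?s0 ?tH ?(ltW (le_lt_trans s0 st)).
(* The absolute value makes [g] nonnegative on all pairs, as Tonelli asks; it is invisible on the
   values of [Y]. *)
pose g (z : R * R) := (`|z.2| * expR (- a * z.1 - a ^+ 2 * (t - s) / 2))%:E.
have mg : measurable_fun setT g.
  apply/measurable_EFinP; apply: measurable_funM.
    by apply: measurableT_comp => //; exact: measurable_snd.
  apply: measurableT_comp => //; apply: measurable_funB => //.
  by apply: measurable_funM => //; exact: measurable_fst.
transitivity (\int[P]_w g (increment V s t w, Y w))%E.
  by apply: eq_integral => w _; rewrite /g/= ger0_norm.
rewrite ge0_integral_independent//; last 3 first.
- exact: sub_measurable_fun mY.
- move=> A B mA mB; rewrite setIC muleC; apply: ind => //.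
  by rewrite -[X in increments_sigma _ _ _ X]setTI; exact: mY.
- by move=> z; rewrite lee_fin mulr_ge0// expR_ge0.
apply: eq_integral => w _; rewrite /g/= ger0_norm//.
under eq_integral do rewrite expRD mulrCA EFinM.
rewrite ge0_integralZr//.
- rewrite mgf// sqrrN -EFinM mulrCA -expRD.
  by rewrite addrN expR0 mulr1.
- apply/measurable_EFinP; apply: measurableT_comp => //.
  exact: measurable_funM.
- by rewrite lee_fin mulr_ge0 ?expR_ge0.
Qed.

Section stopped.
Variable sigma : T -> R.
Hypothesis hsigma : stopping_time V H sigma.

Section grid.
Variable N : nat.
Let t i := H * i%:R / N.+1%:R.

(* sigma rounded up to the grid and stopped after i steps *)
Fixpoint rounded_time i (w : T) : R :=
  if i is j.+1 then if t j < sigma w then t i else rounded_time j w else 0.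

Let t_ge0 i : 0 <= t i.
Proof. by rewrite /t mulr_ge0 ?invr_ge0// mulr_ge0// ltW. Qed.

Let tS i : t i.+1 = t i + H / N.+1%:R.
Proof. by rewrite /t -addn1 natrD mulrDr mulr1 mulrDl. Qed.

Let t_ltS i : t i < t i.+1.
Proof. by rewrite tS ltrDl divr_gt0. Qed.

Let t_le i : (i <= N.+1)%N -> t i <= H.
Proof.
by move=> iN; rewrite /t -mulrA ler_piMr ?(ltW H0)// ler_pdivrMr// mul1r ler_nat.
Qed.

Lemma rounded_time_eq i w : t i < sigma w -> rounded_time i w = t i.
Proof.
case: i => [|i] /=; first by rewrite /t mulr0 mul0r.
by move=> /(lt_trans (t_ltS i)) ->.
Qed.

(** At the last index [t i] is [H], the minimum is [sigma w], and the last two bounds place the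
    rounded time within one mesh above [sigma w]. *)
Let rounded_time_bounds i w : (i <= N.+1)%N ->
  [/\ 0 <= rounded_time i w, rounded_time i w <= t i,
      Num.min (sigma w) (t i) <= rounded_time i w &
      rounded_time i w <= sigma w + H / N.+1%:R].
Proof.
have [/(_ w)/andP[sw0 swH] _] := hsigma.
elim: i => [_|i ih iN] /=.
  by split=> //; rewrite ?ge_min ?addr_ge0 ?divr_ge0 ?(ltW H0)// /t mulr0 mul0r lexx orbT.
have [r0 rt mr rs] := ih (ltnW iN).
case: ifPn => [ts|]; first by split=> //; rewrite ?ge_min ?lexx ?orbT// tS lerD2r ltW.
rewrite -leNgt => st; split => //; first exact/(le_trans rt)/ltW.
by apply: le_trans mr; rewrite le_min !ge_min lexx st.
Qed.

Lemma rounded_time_itv w : 0 <= rounded_time N.+1 w <= H.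
Proof.
have [-> rt _ _] := rounded_time_bounds w (leqnn N.+1).
by rewrite (le_trans rt)// t_le.
Qed.

Lemma rounded_time_dist w :
  sigma w <= rounded_time N.+1 w <= sigma w + H / N.+1%:R.
Proof.
have [_ _ + ->] := rounded_time_bounds w (leqnn N.+1); rewrite andbT.
have [/(_ w)/andP[sw0 swH] _] := hsigma.
by rewrite min_l// /t mulfK.
Qed.

Let stoppedM a i : T -> R := fun w => exp_martingale V a (rounded_time i w) w.

(** Discrete optional stopping by induction. On [A], where the clock still runs, the step multiplies
    the running part [Y] by the factor [D], which does not change the mean by [exp_martingale_step];
    off [A] the part [Z] is already frozen. *)
Lemma exp_martingale_stopped a i : (i <= N.+1)%N ->
  measurable_fun setT (stoppedM a i) /\ (\int[P]_w (stoppedM a i w)%:E = 1)%E.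
Proof.
elim: i => [_|i ih iN].
  have -> : stoppedM a 0 = cst 1.
    apply/funext => w; case: hV => V0 _ _ _ _; rewrite /stoppedM/=.
    by rewrite /exp_martingale V0 !mulr0 mul0r subr0 expR0.
  by split => //; rewrite /= integral_cst//= mul1e; exact: probability_setT.
have [mM IM] := ih (ltnW iN).
pose A := [set w | t i < sigma w].
have tiH : t i < H by apply: lt_le_trans (t_ltS i) _; exact: t_le.
have FA : increments_sigma V 0 `[0, t i] A.
  by case: hsigma => _; apply; rewrite t_ge0.
have mA : measurable A by apply: exponential_brownian_sub FA; exact: ltW.
pose Y w := \1_A w * exp_martingale V a (t i) w.
have mY : measurable_fun setT (Y : F (t i) -> R).
  apply: measurable_funM; first exact: measurable_indic.
  apply: measurableT_comp => //; apply: measurable_funB => //.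
  by apply: measurable_funM => //; exact: exponential_brownian_adapted.
have Y0 w : 0 <= Y w by rewrite mulr_ge0// expR_ge0.
pose Z w := \1_(~` A) w * stoppedM a i w.
have mZ : measurable_fun setT Z.
  by apply: measurable_funM => //; apply: measurable_indic; exact: measurableC.
have Z0 w : 0 <= Z w by rewrite mulr_ge0// expR_ge0.
pose D w := expR (- a * increment V (t i) (t i.+1) w - a ^+ 2 * (t i.+1 - t i) / 2).
have iA w : \1_A w = (t i < sigma w)%R%:R :> R.
  by rewrite indicE; congr ((_ : bool)%:R); apply/idP/idP; rewrite inE.
have iAC w : \1_(~` A) w = (~~ (t i < sigma w)%R)%:R :> R.
  by rewrite indicE in_setC; congr ((~~ _ : bool)%:R); apply/idP/idP; rewrite inE.
have MS w : stoppedM a i.+1 w = Y w * D w + Z w.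
  rewrite /stoppedM /Y /Z /D iA iAC /=.
  case: ifP => ts; rewrite ?mul0r ?mul1r ?addr0 ?add0r//.
  rewrite /exp_martingale -expRD /increment; congr expR.
  by field.
have ME w : stoppedM a i w = Y w + Z w.
  rewrite /Y /Z iA iAC; have [ts|ts] := boolP (t i < sigma w); rewrite ?mul0r ?mul1r ?addr0 ?add0r//.
  by rewrite /stoppedM rounded_time_eq.
have mD : measurable_fun setT D.
  case: hV => _ mV _ _ _.
  apply: measurableT_comp => //; apply: measurable_funB => //.
  apply: measurable_funM => //; apply: measurable_funB; apply: mV.
    by rewrite t_ge0 t_le.
  by rewrite t_ge0 ltW.
have mYT : measurable_fun setT Y by apply: sub_measurable_fun mY; exact: ltW.
split.
  rewrite (_ : stoppedM a i.+1 = fun w => Y w * D w + Z w); last exact/funext.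
  by apply: measurable_funD => //; exact: measurable_funM.
rewrite -IM; under eq_integral do rewrite MS EFinD.
under [RHS]eq_integral do rewrite ME EFinD.
have mE (f : T -> R) : measurable_fun setT f -> measurable_fun setT (EFin \o f).
  by move=> ?; exact/measurable_EFinP.
rewrite (ge0_integralD P measurableT _ _ _ (mE _ mZ)); first last.
- by move=> w _; rewrite lee_fin.
- exact/mE/measurable_funM.
- by move=> w _; rewrite lee_fin mulr_ge0// expR_ge0.
rewrite (ge0_integralD P measurableT _ (mE _ mYT) _ (mE _ mZ)); first last.
- by move=> w _; rewrite lee_fin.
- by move=> w _; rewrite lee_fin.
by rewrite exp_martingale_step// t_le.
Qed.

End grid.

Let stopped_martingale a N w :=
  exp_martingale V a (rounded_time N N.+1 w) w.

Let stopped_martingale_cvg a w :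
  stopped_martingale a N w @[N --> \oo] --> exp_martingale V a (sigma w) w.
Proof.
have [/(_ w) sigmaH _] := hsigma.
have rho_cvg : rounded_time N N.+1 w @[N --> \oo] --> sigma w.
  apply: (@squeeze_cvgr _ _ _ _ (cst (sigma w)) (fun N => sigma w + H * N.+1%:R^-1)).
  - by apply: nearW => N; exact: rounded_time_dist.
  - exact: cvg_cst.
  - rewrite -[X in _ --> X]addr0; apply: cvgD; first exact: cvg_cst.
    rewrite -[X in _ --> X](mulr0 H); apply: cvgM; first exact: cvg_cst.
    exact: cvg_harmonic.
have V_cvg : V (rounded_time N N.+1 w) w @[N --> \oo] --> V (sigma w) w.
  case: hV => _ _ /(_ w) cV _ _.
  apply: (within_continuous_cvg cV) => //.
  by move=> N; rewrite /= in_itv/= rounded_time_itv.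
apply: continuous_cvg; first exact: continuous_expR.
by apply: cvgB; apply: cvgM => //; try exact: cvg_cst; apply: cvgM => //; exact: cvg_cst.
Qed.

Let measurable_stopped_martingale a N : measurable_fun setT (stopped_martingale a N).
Proof. by have [] := exp_martingale_stopped a (leqnn N.+1). Qed.

Let measurable_exp_martingale_sigma a :
  measurable_fun setT (fun w => exp_martingale V a (sigma w) w).
Proof.
apply: (measurable_fun_cvg (measurable_stopped_martingale a)) => w _.
exact: stopped_martingale_cvg.
Qed.

Let mE (f : T -> R) : measurable_fun setT f -> measurable_fun setT (EFin \o f).
Proof. by move=> ?; exact/measurable_EFinP. Qed.

(* M(a)^2 <= expR (a^2 H) M(2a), and M(2a) has mean 1; this gives the uniform
   integrability needed to let the mesh of the grid tend to 0. *)
Let stopped_martingale_sqr_le a N :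
  (\int[P]_w (stopped_martingale a N w ^+ 2)%:E <= (expR (a ^+ 2 * H))%:E)%E.
Proof.
have [_ E2] := exp_martingale_stopped (2 * a) (leqnn N.+1).
have mS2 := measurable_stopped_martingale (2 * a) N.
apply: (@le_trans _ _ (\int[P]_w ((expR (a ^+ 2 * H))%:E *
    (stopped_martingale (2 * a) N w)%:E))%E); last first.
  rewrite ge0_integralZl ?E2 ?mule1//; first exact: mE.
  by move=> w _; rewrite lee_fin expR_ge0.
apply: ge0_le_integral => //.
- by move=> w _; rewrite lee_fin sqr_ge0.
- by apply: mE; apply: measurable_funX.
- by apply: emeasurable_funM => //; exact: mE.
- move=> w _; rewrite -EFinM lee_fin /stopped_martingale /exp_martingale.
  rewrite expr2 -!expRD ler_expR.
  have /andP[r0 rH] := rounded_time_itv N w.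
  by have := ler_wpM2l (sqr_ge0 a) rH; lra.
Qed.

(** Truncation at [K] provides a constant dominating function, so the mesh may tend to 0. *)
Let min_cvg a (K : R) : 0 < K ->
  (\int[P]_w (Num.min (stopped_martingale a N w) K)%:E @[N --> \oo] -->
   \int[P]_w (Num.min (exp_martingale V a (sigma w) w) K)%:E)%E.
Proof.
move=> K0; apply: (@dominated_cvg _ _ _ _ _ _ _ _ (cst K%:E)) => //.
- by move=> N; apply: mE; exact: measurable_minr.
- move=> w _; apply: cvg_EFin; first by apply: nearW.
  suff : Num.min (stopped_martingale a N w) K @[N --> \oo] -->
      Num.min (exp_martingale V a (sigma w) w) K by [].
  apply: (@continuous_cvg _ _ _ _ _ _ (fun x : R => Num.min x K)).
    by apply: (@continuous_min _ _ id (cst K)) => //; exact: cvg_cst.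
  exact: stopped_martingale_cvg.
- exact: finite_measure_integrable_cst.
- move=> N w _; rewrite abse_EFin lee_fin ger0_norm ?ge_min ?lexx ?orbT//.
  by rewrite le_min expR_ge0 ltW.
Qed.

(** From [y <= Num.min y K + y ^+ 2 / K], truncation loses at most the second moment over [K]. That
    moment is bounded uniformly in the mesh, so the bound survives the limit. *)
Let min_bounds a (K : R) : 0 < K ->
  (1 - (expR (a ^+ 2 * H) / K)%:E <=
   \int[P]_w (Num.min (exp_martingale V a (sigma w) w) K)%:E <= 1)%E.
Proof.
move=> K0.
have mS := measurable_stopped_martingale a.
have E1 N : (\int[P]_w (stopped_martingale a N w)%:E = 1)%E.
  by have [] := exp_martingale_stopped a (leqnn N.+1).
have mmin N : measurable_fun setT
    (fun w => (Num.min (stopped_martingale a N w) K)%:E).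
  by apply: mE; exact: measurable_minr.
have min_ge0 N w : (0 <= (Num.min (stopped_martingale a N w) K)%:E)%E.
  by rewrite lee_fin le_min expR_ge0 ltW.
apply/andP; split; last first.
  rewrite -(cvg_lim _ (@min_cvg a K K0))//.
  apply: lime_le; [exact: cvgP (@min_cvg a K K0)|apply: nearW => N].
  rewrite -(E1 N).
  apply: ge0_le_integral => //; first exact/mE/mS.
  by move=> w _; rewrite lee_fin ge_min lexx.
rewrite -(cvg_lim _ (@min_cvg a K K0))//.
apply: lime_ge; [exact: cvgP (@min_cvg a K K0)|apply: nearW => N].
rewrite leeBlDr//.
rewrite -(E1 N).
apply: (@le_trans _ _ (\int[P]_w ((Num.min (stopped_martingale a N w) K)%:E +
    (K^-1 * stopped_martingale a N w ^+ 2)%:E))%E).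
  apply: ge0_le_integral => //.
  - by move=> w _; rewrite lee_fin expR_ge0.
  - exact/mE/mS.
  - apply: emeasurable_funD => //; apply: mE; apply: measurable_funM => //.
    exact: measurable_funX.
  - move=> w _; rewrite -EFinD lee_fin; set y := stopped_martingale a N w.
    have y0 : 0 < y by exact: expR_gt0.
    have [yK|Ky] := leP y K; first by rewrite lerDl mulr_ge0 ?invr_ge0 ?sqr_ge0 ?ltW.
    apply: ler_wpDl; first exact: ltW.
    by rewrite ler_pdivlMl// expr2 ler_pM2r// ltW.
have Ky2 w : (0 <= (K^-1 * stopped_martingale a N w ^+ 2)%:E)%E.
  by rewrite lee_fin mulr_ge0 ?sqr_ge0// invr_ge0 ltW.
have my2 : measurable_fun setT (fun w => (stopped_martingale a N w ^+ 2)%:E).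
  by apply: mE; exact: measurable_funX.
rewrite ge0_integralD//; last first.
  by apply: mE; apply: measurable_funM => //; exact: measurable_funX.
rewrite leeD2l//.
under eq_integral do rewrite EFinM.
rewrite ge0_integralZl//; last 2 first.
- by move=> w _; rewrite lee_fin sqr_ge0.
- by rewrite lee_fin invr_ge0 ltW.
by rewrite mulrC EFinM lee_wpmul2l// lee_fin invr_ge0 ltW.
Qed.

(** The truncation level [n.+1] tends to infinity: the truncated integrals converge monotonically,
    and [min_bounds] squeezes them to 1. *)
Lemma optional_stopping a :
  measurable_fun setT (fun w => exp_martingale V a (sigma w) w) /\
  (\int[P]_w (exp_martingale V a (sigma w) w)%:E = 1)%E.
Proof.
split => //.
pose m n w := (Num.min (exp_martingale V a (sigma w) w) n.+1%:R)%:E.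
have m_lim w : limn (m ^~ w) = (exp_martingale V a (sigma w) w)%:E.
  apply/cvg_lim => //; apply: cvg_near_cst.
  near=> n; rewrite /m min_l//.
  near: n; exists (Num.truncn (exp_martingale V a (sigma w) w)) => // n /= kn.
  apply/ltW/(lt_le_trans (truncnS_gt _)); rewrite ler_nat.
  by rewrite ltnS.
have m_cvg : (\int[P]_w m n w @[n --> \oo] -->
    \int[P]_w (exp_martingale V a (sigma w) w)%:E)%E.
  under eq_integral do rewrite -m_lim.
  apply: cvg_monotone_convergence => //.
  - by move=> n; apply: mE; exact: measurable_minr.
  - by move=> n w _; rewrite lee_fin le_min expR_ge0 ler0n.
  - move=> w _ k l kl; rewrite lee_fin le_min !ge_min lexx/=.
    by rewrite ler_nat ltnS kl orbT.
apply: (cvg_unique _ m_cvg) => //.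
apply: (@squeeze_cvge _ _ _ _
  (fun n => (1 - (expR (a ^+ 2 * H) / n.+1%:R)%:E)%E) _ (cst 1%E)).
- by apply: nearW => n; exact: min_bounds.
- rewrite -[X in _ --> X]sube0; apply: cvgeB => //; first exact: cvg_cst.
  apply: cvg_EFin; first exact: nearW.
  rewrite -[X in _ --> X](mulr0 (expR (a ^+ 2 * H))); apply: cvgM; first exact: cvg_cst.
  exact: cvg_harmonic.
- exact: cvg_cst.
Unshelve. all: by end_near. Qed.

End stopped.
End theory.
End optional_stopping.

(** * Brownian increments restarted at a time and reversed from it *)

Lemma within_continuous_compose (R : realType) (A B : set R) (g phi : R -> R) :
  {within B, continuous g} -> continuous phi -> (forall x, A x -> B (phi x)) ->
  {within A, continuous (g \o phi)}.
Proof.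
move=> /subspace_continuousP cg cphi AB; apply/subspace_continuousP => x Ax.
apply: (@cvg_comp _ _ _ phi g _ (within B (nbhs (phi x)))); last exact: cg (AB x Ax).
move=> C /= BC; rewrite /within/=.
apply: (@filterS _ (nbhs x) _ (fun y => B (phi y) -> C (phi y))); last exact: cphi x _ BC.
by move=> y BCy Ay; apply: BCy; exact: AB.
Qed.

Section brownian_motions.
Context (R : realType) (d : measure_display) (T : measurableType d)
  (P : probability T R) (W : R -> T -> R).
Hypothesis hW : standard_brownian_motion P W.

Lemma increment_mgf (a s t : R) : 0 <= s -> s < t ->
  (\int[P]_w (expR (a * increment W s t w))%:E =
   (expR (a ^+ 2 * (t - s) / 2))%:E)%E.
Proof.
move=> s0 st; have t0 : 0 <= t by exact/ltW/(le_lt_trans s0).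
have mi : measurable_fun setT (increment W s t : T -> measurableTypeR R).
  by move=> mT B mB; exact: (measurable_increment hW s0 t0 mT mB).
rewrite -(ge0_integral_law P mi (g := fun x => (expR (a * x))%:E)); last 2 first.
- by apply/measurable_EFinP; apply: measurableT_comp => //; exact: measurable_funM.
- by move=> y; rewrite lee_fin expR_ge0.
rewrite -[in RHS](@sqr_sqrtr _ (t - s)) ?subr_ge0 ?ltW//.
rewrite -(@normal_mgf R (Num.sqrt (t - s)) a); last first.
  by rewrite gt_eqF// sqrtr_gt0 subr_gt0.
apply: eq_measure_integral => A mA _; case: hW => _ _ _ _ normal_incr.
exact: normal_incr.
Qed.

Lemma past_increment (t p q : R) : 0 <= t -> 0 <= p <= t -> 0 <= q <= t ->
  measurable_fun setT
    (increment W p q : g_sigma_algebraType (increment_events W 0 `[0, t]) -> R).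
Proof.
move=> t0 pt qt.
have -> : increment W p q = (fun w => increment W 0 q w - increment W 0 p w).
  by apply/funext => w; rewrite /increment; ring.
by apply: measurable_funB; apply: measurable_increments_sigma; rewrite /= in_itv.
Qed.

Lemma future_increment (t p q : R) : t <= p -> t <= q ->
  measurable_fun setT
    (increment W p q : g_sigma_algebraType (increment_events W t `[t, +oo[) -> R).
Proof.
move=> tp tq.
have -> : increment W p q = (fun w => increment W t q w - increment W t p w).
  by apply/funext => w; rewrite /increment; ring.
apply: measurable_funB; apply: measurable_increments_sigma;
  by rewrite /= in_itv/= andbT.
Qed.

Let continuous_path w : {within `[0, +oo[, continuous (W ^~ w)}.
Proof. by case: hW => _ _ cW _ _; exact: cW. Qed.

Lemma shifted_exponential_brownian (t H : R) : 0 <= t ->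
  exponential_brownian P (fun s => increment W t (t + s)) H.
Proof.
move=> t0; split.
- by move=> w; rewrite /increment addr0 subrr.
- by move=> s /andP[s0 _]; apply: (measurable_increment hW); rewrite ?addr_ge0.
- move=> w; rewrite /increment.
  have /subspace_continuousP cW : {within `[0, H], continuous (fun x : R => W (t + x) w)}.
    apply: (@within_continuous_compose R `[0, H]%classic _ (W ^~ w) (fun x => t + x) (@continuous_path w)) => x.
      by apply: cvgD; [exact: cvg_cst|exact: cvg_id].
    by rewrite /= !in_itv/= andbT => /andP[x0 _]; rewrite addr_ge0.
  apply/subspace_continuousP => x xH.
  by apply: cvgB; [exact: cW|exact: cvg_cst].
- move=> a p q p0 pq qH.
  have -> : q - p = (t + q) - (t + p) by ring.
  rewrite -increment_mgf ?addr_ge0 ?ltrD2l//.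
  by apply: eq_integral => w _; rewrite /increment; congr (expR (_ * _))%:E; ring.
- move=> p q A B p0 pq qH pA mB.
  have qp : increment (fun s => increment W t (t + s)) p q =
            increment W (t + p) (t + q).
    by apply/funext => w; rewrite /increment; ring.
  rewrite qp; apply: (past_future_independent hW (t := t + p)).
  + by rewrite addr_ge0.
  + apply: increments_sigma_sub pA => s; rewrite /= in_itv/= => /andP[s0 sp].
    have -> : increment (fun s => increment W t (t + s)) 0 s = increment W t (t + s).
      by apply/funext => w; rewrite /increment addr0; ring.
    by apply: past_increment; rewrite ?addr_ge0// ?t0 ?lerDl ?lerD2l.
  + rewrite -[X in increments_sigma _ _ _ X]setTI; apply: future_increment => //.
    by rewrite lerD2l ltW.
Qed.

(** Reversal exchanges past and future: what the reversed process has done up to [p] lies in the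
    future of [W] after [t - p], and its later increments lie in the past of [W] before [t - p]. *)
Lemma reversed_exponential_brownian (t : R) : 0 <= t ->
  exponential_brownian P (fun s => increment W t (t - s)) t.
Proof.
move=> t0; split.
- by move=> w; rewrite /increment subr0 subrr.
- by move=> s /andP[s0 st]; apply: (measurable_increment hW); rewrite ?subr_ge0.
- move=> w; rewrite /increment.
  have /subspace_continuousP cW : {within `[0, t], continuous (fun x : R => W (t - x) w)}.
    apply: (@within_continuous_compose R `[0, t]%classic _ (W ^~ w) (fun x => t - x) (@continuous_path w)) => x.
      by apply: cvgB; [exact: cvg_cst|exact: cvg_id].
    by rewrite /= !in_itv/= andbT => /andP[_ xt]; rewrite subr_ge0.
  apply/subspace_continuousP => x xH.
  by apply: cvgB; [exact: cW|exact: cvg_cst].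
- move=> a p q p0 pq qH.
  have -> : q - p = (t - p) - (t - q) by ring.
  have tq0 : 0 <= t - q by rewrite subr_ge0.
  have tpq : t - q < t - p by rewrite ltrD2l ltrN2.
  (* A reversed increment is the opposite of an increment of [W], whence the moment at [- a]. *)
  rewrite -sqrrN -(increment_mgf (- a) tq0 tpq).
  by apply: eq_integral => w _; rewrite /increment; congr (expR _)%:E; ring.
- move=> p q A B p0 pq qt pA mB.
  have qp : increment (fun s => increment W t (t - s)) p q =
            increment W (t - p) (t - q).
    by apply/funext => w; rewrite /increment; ring.
  have pt : p <= t by exact/ltW/(lt_le_trans pq).
  rewrite qp setIC muleC; apply: (past_future_independent hW (t := t - p)).
  + by rewrite subr_ge0.
  + rewrite -[X in increments_sigma _ _ _ X]setTI; apply: past_increment => //.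
    * by rewrite subr_ge0.
    * by rewrite subr_ge0 lexx andbT.
    * by rewrite subr_ge0 qt lerD2l lerN2 ltW.
  + apply: increments_sigma_sub pA => s; rewrite /= in_itv/= => /andP[s0 sp].
    have -> : increment (fun s => increment W t (t - s)) 0 s = increment W t (t - s).
      by apply/funext => w; rewrite /increment subr0; ring.
    by apply: future_increment; rewrite ?gerBl// lerD2l lerN2.
Qed.

End brownian_motions.

(** * First hitting times of continuous paths *)

Section hitting_paths.
Context (R : realType).
Implicit Types (g : R -> R) (a c H : R).

Lemma within_continuous_near a c g q e : {within `[a, c], continuous g} ->
  a <= q <= c -> 0 < e ->
  exists2 del : R, 0 < del &
    forall y : R, a <= y <= c -> `|q - y| < del -> `|g q - g y| < e.
Proof.
move=> /subspace_continuousP cg qac e0.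
have /cg/cvgrPdist_lt/(_ _ e0) : `[a, c]%classic q by rewrite /= in_itv.
rewrite /within/= => /nbhs_ballP[del /= del0 delP]; exists del => // y yac qy.
by apply: (delP y); rewrite ?in_itv.
Qed.

Definition hits a c g : Prop := exists2 q, a <= q <= c & g q <= 0.

(** A countable form of hitting, made for measurability. Towards the rationals it is continuity at
    the hit; backwards, a continuous function on a compact interval with infimum at most 0 attains a
    value at most 0. *)
Lemma hitsP a c g : a < c -> {within `[a, c], continuous g} ->
  hits a c g <-> forall m : nat, exists r : rat,
    a <= ratr r <= c /\ g (ratr r) < m.+1%:R^-1.
Proof.
move=> ac cg; split=> [[q qac gq] m|].
  have m0 : 0 < m.+1%:R^-1 :> R by rewrite invr_gt0.
  have [del del0 delP] := within_continuous_near cg qac m0.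
  have /andP[aq qc] := qac.
  have : Num.max a (q - del) < Num.min c (q + del).
    rewrite gt_max !lt_min ac/=; apply/and3P; split.
    - by lra.
    - by lra.
    - by lra.
  move=> /rat_in_itvoo[r]; rewrite in_itv/= gt_max lt_min.
  move=> /andP[/andP[ar qr] /andP[rc rq]].
  exists r; split; first by rewrite !ltW.
  have : `|g q - g (ratr r)| < m.+1%:R^-1.
    by apply: delP; rewrite ?ltW// ltr_distlC; apply/andP; split; lra.
  by rewrite ltr_distlC => /andP[_ h]; apply: (lt_le_trans h); rewrite gerDr.
move=> h; have [x] := EVT_min (ltW ac) cg; rewrite in_itv/= => xac xmin.
exists x => //; rewrite leNgt; apply/negP => gx0.
have [m mg] : exists m : nat, m.+1%:R^-1 < g x.
  exists (Num.truncn (g x)^-1); rewrite -[ltRHS]invrK ltf_pV2 ?posrE ?invr_gt0//.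
  exact: truncnS_gt.
have [r [rac gr]] := h m.
have := xmin (ratr r); rewrite in_itv/= rac => /(_ isT) gxr.
by have := lt_trans gr mg; rewrite ltNge gxr.
Qed.

(** [S] is arbitrary so that the lemma also yields membership in the past: the sigma-algebra
    generated by past increments is then taken on the same carrier. *)
Lemma measurable_hits (d : measure_display) (S : measurableType d)
    (gap : R -> S -> R) a c : a <= c ->
  (forall q, a <= q <= c -> measurable_fun setT (gap q)) ->
  (forall w, {within `[a, c], continuous (gap ^~ w)}) ->
  measurable [set w | hits a c (gap ^~ w)].
Proof.
(* A degenerate interval may contain no rational and is treated apart. *)
move=> + mg cg; rewrite le_eqVlt => /predU1P[ac|ac].
  rewrite (_ : [set w | _] = gap a @^-1` `]-oo, 0]).
    by rewrite -[X in measurable X]setTI; apply: mg => //; rewrite lexx ac lexx.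
  apply/seteqP; split => w /=; rewrite in_itv/=.
    by move=> [q]; rewrite -ac => /le_anti ->.
  by move=> ga; exists a; rewrite // ac lexx.
rewrite (_ : [set w | _] = \bigcap_(m : nat) \bigcup_(r : rat)
    ([set _ | a <= (ratr r : R) <= c] `&` gap (ratr r) @^-1` `]-oo, m.+1%:R^-1[)).
  apply: bigcapT_measurable => m; apply: bigcupT_measurable_rat => r.
  have [rac|nrac] := boolP (a <= (ratr r : R) <= c).
    rewrite (_ : [set _ | _] = setT) ?setTI; last by apply/seteqP; split.
    by rewrite -[X in measurable X]setTI; apply: mg.
  by rewrite (_ : [set _ | _] = set0) ?set0I//; apply/seteqP; split.
apply/seteqP; split => w /=.
  move=> /(hitsP ac (cg w)) h m _; have [r [rac gr]] := h m.
  by exists r => //; split => //=; rewrite in_itv.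
move=> h; apply/(hitsP ac (cg w)) => m; have [r _ [rac]] := h m I.
by rewrite /= in_itv/= => gr; exists r.
Qed.

(* The value is H when g stays positive on [0, H]. *)
Definition first_hit H g : R :=
  inf [set s | 0 <= s <= H /\ (g s <= 0 \/ s = H)].

Section first_hit.
Variables (H : R) (g : R -> R).
Hypotheses (H0 : 0 <= H) (cg : {within `[0, H], continuous g}).

Let E := [set s | 0 <= s <= H /\ (g s <= 0 \/ s = H)].

Let EH : E H.
Proof. by split; [rewrite H0 lexx|right]. Qed.

Let E_inf : has_inf E.
Proof. by split; [exists H|exists 0 => s [/andP[]]]. Qed.

Lemma first_hit_le s : 0 <= s <= H -> g s <= 0 -> first_hit H g <= s.
Proof. by move=> sH gs; apply: ge_inf; [case: E_inf|split => //; left]. Qed.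

Lemma first_hit_itv : 0 <= first_hit H g <= H.
Proof.
apply/andP; split; last by apply: ge_inf => //; case: E_inf.
by apply: lb_le_inf => [|s [/andP[]]]; first by exists H.
Qed.

Lemma first_hit_attained : g (first_hit H g) <= 0 \/ first_hit H g = H.
Proof.
have /andP[s0 sH] := first_hit_itv.
have [sE|sH'] := eqVneq (first_hit H g) H; first by right.
left; rewrite leNgt; apply/negP => gs.
have [del del0 delP] := within_continuous_near cg first_hit_itv gs.
pose e := Num.min del (H - first_hit H g).
have e0 : 0 < e by rewrite lt_min del0 subr_gt0 lt_neqAle sH'.
have [s [sH2 [gs0|sE]] se] := inf_adherent e0 E_inf; last first.
  by move: se; rewrite sE -/(first_hit H g) /e -ltrBlDl lt_min ltxx andbF.
have ls : first_hit H g <= s by exact: first_hit_le.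
have : `|g (first_hit H g) - g s| < g (first_hit H g).
  apply: delP => //; rewrite distrC ger0_norm ?subr_ge0// ltrBlDl.
  by apply: (lt_le_trans se); rewrite lerD2l ge_min lexx.
by rewrite ltr_distlC => /andP[? ?]; lra.
Qed.

Lemma first_hit_hits : hits 0 H g -> g (first_hit H g) <= 0.
Proof.
move=> [s sH gs]; case: first_hit_attained => // sE.
have := first_hit_le sH gs; rewrite sE => Hs.
by rewrite (@le_anti _ _ H s)// Hs; case/andP: sH.
Qed.

Lemma first_hit_not_hits : ~ hits 0 H g -> first_hit H g = H.
Proof.
move=> nh; case: first_hit_attained => // gs; exfalso; apply: nh.
by exists (first_hit H g) => //; exact: first_hit_itv.
Qed.

Lemma lt_first_hit s : 0 <= s < H -> s < first_hit H g <-> ~ hits 0 s g.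
Proof.
move=> /andP[s0 sH]; split=> [sl [q /andP[q0 qs] gq]|nh].
  have := @first_hit_le q; rewrite q0 (le_trans qs (ltW sH)) => /(_ isT gq).
  by rewrite leNgt (le_lt_trans qs sl).
rewrite ltNge; apply/negP => ls.
case: first_hit_attained => [gs|sE]; last by move: ls; rewrite sE leNgt sH.
by apply: nh; exists (first_hit H g) => //; rewrite ls; case/andP: first_hit_itv => ->.
Qed.

(** There is no undershoot: a value strictly below 0 at the first hit would by continuity be
    preceded by another one. With [first_hit_hits] this gives equality with the boundary at a
    crossing. *)
Lemma first_hit_ge0 : 0 <= g 0 -> 0 <= g (first_hit H g).
Proof.
move=> g0; rewrite leNgt; apply/negP => gs.
have ngs : 0 < - g (first_hit H g) by rewrite oppr_gt0.
have [del del0 delP] := within_continuous_near cg first_hit_itv ngs.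
have /andP[s0 sH] := first_hit_itv.
move: s0; rewrite le_eqVlt => /predU1P[s0|s0].
  by move: gs; rewrite -s0 ltNge g0.
pose s := Num.max 0 (first_hit H g - del / 2).
have ss : s < first_hit H g by rewrite gt_max s0/= ltrBlDr ltrDl divr_gt0.
have s_itv : 0 <= s <= H by rewrite le_max lexx/= (le_trans (ltW ss)).
have : `|g (first_hit H g) - g s| < - g (first_hit H g).
  apply: delP => //; rewrite ger0_norm ?subr_ge0 ?(ltW ss)//.
  have : first_hit H g - del / 2 <= s by rewrite le_max lexx orbT.
  by move=> ?; lra.
rewrite ltr_distlC => /andP[_ gs2].
have gs0 : g s <= 0 by lra.
by have := first_hit_le s_itv gs0; rewrite leNgt ss.
Qed.

End first_hit.
End hitting_paths.

(** * Crossing of a curved boundary *)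

Section boundary_crossing.
Context (R : realType) (d : measure_display) (T : measurableType d)
  (P : probability T R) (V : R -> T -> R) (H : R).
Hypotheses (H0 : 0 < H) (hV : exponential_brownian P V H).
Variables (beta : R -> R) (x : R).
Hypothesis cbeta : {within `[0, H], continuous beta}.

Let gap s w := V s w + x - beta s.

Let cgap w c : c <= H -> {within `[0, c], continuous (gap ^~ w)}.
Proof.
move=> cH; apply: (@continuous_subspaceW _ _ _ `[0, H]%classic).
  by move=> y /=; rewrite !in_itv/= => /andP[-> /le_trans ->].
case: hV => _ _ /(_ w)/subspace_continuousP cV _ _.
move/subspace_continuousP : cbeta => cb.
apply/subspace_continuousP => y yH; apply: cvgB; last exact: cb.
by apply: cvgD; [exact: cV|exact: cvg_cst].
Qed.

Definition crossing_time w := first_hit H (gap ^~ w).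

Definition crosses c : set T := [set w | hits 0 c (gap ^~ w)].

Lemma crosses_past c : 0 <= c <= H -> increments_sigma V 0 `[0, c] (crosses c).
Proof.
move=> /andP[c0 cH].
apply: (@measurable_hits R _ (g_sigma_algebraType (increment_events V 0 `[0, c]))).
- exact: c0.
- move=> q /andP[q0 qc]; apply: measurable_funB => //.
  apply: measurable_funD => //.
  case: hV => V0 _ _ _ _.
  rewrite (_ : V q = increment V 0 q); last first.
    by apply/funext => w; rewrite /increment V0 subr0.
  by apply: measurable_increments_sigma; rewrite /= in_itv/= q0.
- by move=> w; exact: cgap.
Qed.

Lemma measurable_crosses : measurable (crosses H).
Proof.
apply: (exponential_brownian_sub H0 hV (lexx H)).
by apply: crosses_past; rewrite ltW//=.
Qed.

Lemma crossing_time_stopping : stopping_time V H crossing_time.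
Proof.
split=> [w|s /andP[s0 sH]].
  by apply: first_hit_itv => //; exact: ltW.
rewrite (_ : [set w | _] = ~` crosses s).
  apply: (@measurableC _ (g_sigma_algebraType (increment_events V 0 `[0, s]))).
  by apply: crosses_past; rewrite s0 ltW.
by apply/seteqP; split => w /= /(lt_first_hit (ltW H0) (@cgap w H (lexx H)));
  apply; rewrite s0.
Qed.

Let M a w := exp_martingale V a (crossing_time w) w.

Let mM a : measurable_fun setT (M a).
Proof. by have [] := optional_stopping H0 hV crossing_time_stopping a. Qed.

Let EM a : (\int[P]_w (M a w)%:E = 1)%E.
Proof. by have [] := optional_stopping H0 hV crossing_time_stopping a. Qed.

Let EcM c a : 0 <= c -> (\int[P]_w (c * M a w)%:E = c%:E)%E.
Proof.
move=> c0; under eq_integral do rewrite EFinM.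
rewrite ge0_integralZl ?EM ?mule1//; first exact/measurable_EFinP.
by move=> w _; rewrite lee_fin expR_ge0.
Qed.

Let V_crossing_le w : crosses H w ->
  V (crossing_time w) w <= beta (crossing_time w) - x.
Proof.
by move=> /(first_hit_hits (ltW H0) (@cgap w H (lexx H))); rewrite /gap; lra.
Qed.

Let V_crossing_ge w : beta 0 <= x ->
  beta (crossing_time w) - x <= V (crossing_time w) w.
Proof.
move=> b0; have := @first_hit_ge0 _ _ _ (ltW H0) (@cgap w H (lexx H)).
rewrite /gap; case: hV => -> _ _ _ _; rewrite add0r subr_ge0 => /(_ b0).
by rewrite -/(gap^~ w) -/(crossing_time w); lra.
Qed.

Let not_crossing w : ~ crosses H w -> crossing_time w = H.
Proof. exact: (first_hit_not_hits (ltW H0) (@cgap w H (lexx H))). Qed.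

(** Markov's inequality for the stopped martingale, whose mean is 1: at a crossing [V] is at most
    [L * s - x], so there the martingale is at least the inverse of the claimed bound. *)
Lemma crosses_prob_le a L : 0 <= a -> 0 <= L ->
  (forall s, 0 <= s <= H -> beta s <= L * s) ->
  (P (crosses H) <= (expR (- a * x + a * L * H + a ^+ 2 * H / 2))%:E)%E.
Proof.
move=> a0 L0 bL; set C := expR _.
have mC := measurable_crosses.
have : (\int[P]_w ((\1_(crosses H) w)%:E) <= \int[P]_w (C * M a w)%:E)%E.
  apply: ge0_le_integral => //.
  - by apply/measurable_EFinP; exact: measurable_indic.
  - by apply/measurable_EFinP; exact: measurable_funM.
  - move=> w _; rewrite lee_fin indicE.
    have [|_] := boolP (w \in crosses H); last by rewrite mulr_ge0 ?expR_ge0.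
    rewrite inE => /V_crossing_le Vle.
    have /andP[s0 sH] : 0 <= crossing_time w <= H.
      by apply: first_hit_itv => //; exact: ltW.
    rewrite /M /exp_martingale -expRD -[leLHS]expR0 ler_expR.
    have bs := bL _ (introT andP (conj s0 sH)).
    have h1 : a * V (crossing_time w) w <= a * (L * crossing_time w - x).
      by apply: ler_wpM2l => //; lra.
    have h2 : a * L * crossing_time w <= a * L * H.
      by apply: ler_wpM2l => //; exact: mulr_ge0.
    have h3 : a ^+ 2 * crossing_time w <= a ^+ 2 * H.
      by apply: ler_wpM2l => //; exact: sqr_ge0.
    by lra.
rewrite integral_indic// setIT => /le_trans; apply.
by rewrite EcM// expR_ge0.
Qed.

(** The choice [a = 2 * L + 1] turns [a * L - a ^+ 2 / 2] into [- a / 2]. Then [expR (- a * x)]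
    times the stopped martingale is at most 1 on crossing paths and at most [e] on the others.
    Taking means gives [1 - a * x <= expR (- a * x) <= 1 - (1 - e) * p], with [p] the probability of
    survival. *)
Lemma survival_prob_le L : 0 <= L -> 0 <= x -> (forall s, beta s = - L * s) ->
  (P (~` crosses H) * (1 - expR (- (2 * L + 1) / 2 * H))%:E <=
   ((2 * L + 1) * x)%:E)%E.
Proof.
move=> L0 x0 bL; pose a := 2 * L + 1; pose e := expR (- a / 2 * H).
have a0 : 0 < a by rewrite /a; lra.
have mC := measurable_crosses; have mNC := measurableC mC.
have : (\int[P]_w (expR (- a * x) * M a w)%:E <=
        \int[P]_w ((\1_(crosses H) w)%:E + (e * \1_(~` crosses H) w)%:E))%E.
  apply: ge0_le_integral => //.
  - by move=> w _; rewrite lee_fin mulr_ge0 ?expR_ge0.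
  - by apply/measurable_EFinP; exact: measurable_funM.
  - apply: emeasurable_funD; apply/measurable_EFinP; first exact: measurable_indic.
    by apply: measurable_funM => //; exact: measurable_indic.
  - move=> w _; rewrite -EFinD lee_fin !indicE in_setC.
    have b0x : beta 0 <= x by rewrite bL mulr0.
    have Vge := V_crossing_ge w b0x.
    have /andP[s0 sH] : 0 <= crossing_time w <= H.
      by apply: first_hit_itv => //; exact: ltW.
    rewrite bL in Vge.
    have h1 : a * (- L * crossing_time w - x) <= a * V (crossing_time w) w.
      by rewrite ler_pM2l.
    have h2 : expR (- a * x) * M a w <= expR (- a / 2 * crossing_time w).
      rewrite /M /exp_martingale -expRD ler_expR.
      suff : a * L * crossing_time w = a ^+ 2 * crossing_time w / 2 - a / 2 * crossing_time w.
        by lra.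
      by rewrite /a; field.
    have [_|/negP wC] := boolP (w \in crosses H); rewrite /= ?mulr0 ?mulr1 ?addr0 ?add0r.
      apply: (le_trans h2); rewrite -[leRHS]expR0 ler_expR !mulNr oppr_le0.
      by rewrite mulr_ge0// divr_ge0// ltW.
    have nC : ~ crosses H w by move=> C; apply: wC; rewrite inE.
    by apply: (le_trans h2); rewrite not_crossing.
have -> : (\int[P]_w ((\1_(crosses H) w)%:E + (e * \1_(~` crosses H) w)%:E) =
    \int[P]_w (\1_(crosses H) w)%:E + \int[P]_w (e * \1_(~` crosses H) w)%:E)%E.
  apply: ge0_integralD => //.
  - by apply/measurable_EFinP; exact: measurable_indic.
  - by move=> w _; rewrite lee_fin mulr_ge0// expR_ge0.
  - by apply/measurable_EFinP; apply: measurable_funM => //; exact: measurable_indic.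
have -> : (\int[P]_w (e * \1_(~` crosses H) w)%:E =
    e%:E * \int[P]_w (\1_(~` crosses H) w)%:E)%E.
  under eq_integral do rewrite EFinM.
  apply: ge0_integralZl => //.
  - by apply/measurable_EFinP; exact: measurable_indic.
  - by rewrite lee_fin expR_ge0.
rewrite EcM ?expR_ge0//.
have IE A : measurable A -> (\int[P]_w (\1_A w)%:E = P A)%E.
  by move=> mA; rewrite integral_indic// setIT.
rewrite !IE//; have := probability_setC P mC.
have : P (crosses H) \is a fin_num by exact: fin_num_measure.
have : P (~` crosses H) \is a fin_num by exact: fin_num_measure.
move: (P (crosses H)) (P (~` crosses H)) => [p| |] [q| |] // _ _ [->].
rewrite -!EFinM -EFinD !lee_fin -/a -/e => h.
have h2 := expR_ge1Dx (- a * x).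
by move: (expR (- a * x)) h h2 => E h h2; lra.
Qed.

(* Optional stopping at the crossing time, where V equals beta - x; the error
   is the contribution of the paths that have not crossed before H. *)
Lemma crossing_laplace a : 0 < a -> beta 0 <= x ->
  let k t := expR (- a * beta t - a ^+ 2 * t / 2) in
  let I := (\int[P]_w (\1_(crosses H) w * k (crossing_time w))%:E)%E in
  measurable_fun setT (fun w => \1_(crosses H) w * k (crossing_time w)) /\
  (I <= (expR (- a * x))%:E <= I + (k H)%:E)%E.
Proof.
move=> a0 b0x k I.
have mC := measurable_crosses; have mNC := measurableC mC.
have mkE w : \1_(crosses H) w * k (crossing_time w) =
    expR (- a * x) * (\1_(crosses H) w * M a w).
  rewrite indicE; have [|_] := boolP (w \in crosses H); last by rewrite !mul0r mulr0.
  rewrite inE => wC; rewrite !mul1r /M /exp_martingale -expRD /k.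
  have -> : V (crossing_time w) w = beta (crossing_time w) - x.
    by apply/eqP; rewrite eq_le V_crossing_le// V_crossing_ge.
  by congr expR; ring.
have mk : measurable_fun setT (fun w => \1_(crosses H) w * k (crossing_time w)).
  under eq_fun do rewrite mkE.
  by apply: measurable_funM => //; apply: measurable_funM.
have k0 w : 0 <= \1_(crosses H) w * k (crossing_time w).
  by rewrite mulr_ge0// expR_ge0.
split=> //.
have <- : (\int[P]_w (expR (- a * x) * M a w)%:E = (expR (- a * x))%:E)%E.
  by rewrite EcM// expR_ge0.
have mEM : measurable_fun setT (fun w => (expR (- a * x) * M a w)%:E).
  by apply/measurable_EFinP; exact: measurable_funM.
have mkE' : measurable_fun setT
    (fun w => (\1_(crosses H) w * k (crossing_time w))%:E) by exact/measurable_EFinP.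
apply/andP; split.
  apply: ge0_le_integral => //.
  - by move=> w _; rewrite lee_fin.
  - by move=> w _; rewrite lee_fin mkE ler_pM2l ?expR_gt0// ler_piMl ?expR_ge0//.
have -> : (I + (k H)%:E =
    \int[P]_w ((\1_(crosses H) w * k (crossing_time w))%:E + (k H)%:E))%E.
  transitivity (I + \int[P]_w cst (k H)%:E w)%E.
    by rewrite integral_cst//= [P _]probability_setT mule1.
  apply/esym; apply: ge0_integralD => //.
  - by move=> w _; rewrite lee_fin.
  - by move=> w _; rewrite lee_fin expR_ge0.
apply: ge0_le_integral => //.
- by move=> w _; rewrite lee_fin mulr_ge0 ?expR_ge0.
- by apply: emeasurable_funD.
- move=> w _; rewrite -EFinD lee_fin mkE.
  have [wC|/negP wC] := boolP (w \in crosses H).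
    by rewrite indicE wC mul1r lerDl expR_ge0.
  have nC : ~ crosses H w by move=> C; apply: wC; rewrite inE.
  rewrite indicE (negbTE (introN idP wC)) mul0r mulr0 add0r /M.
  have := @V_crossing_ge w b0x; rewrite not_crossing// => Vge.
  rewrite /exp_martingale -expRD /k ler_expR.
  by have : a * (beta H - x) <= a * V H w by [rewrite ler_pM2l]; lra.
Qed.

End boundary_crossing.

(** * Probability of a first crossing within a short time interval *)

Lemma small_ball_independent (R : realType) (d : measure_display)
    (T : measurableType d) (P : probability T R) (G : set (set T))
    (U Y : T -> R) (S : set T) (c e p : R) :
  <<s G >> `<=` measurable ->
  measurable_fun setT U ->
  measurable_fun setT (Y : g_sigma_algebraType G -> R) -> <<s G >> S ->
  (forall A B, measurable A -> <<s G >> B ->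
    P (U @^-1` A `&` B) = P (U @^-1` A) * P B)%E ->
  0 <= p ->
  (forall c', (P (U @^-1` [set` `[c', (c' + e)%R]]) <= p%:E)%E) ->
  (P (S `&` [set w | (c <= U w + Y w <= c + e)%R]) <= p%:E * P S)%E.
Proof.
move=> Gm mU mYG GS ind p0 ball; have mS := Gm _ GS.
(* Pairing [Y] with the indicator of [S] lets one independence statement handle both. *)
pose Z w : R * R := (Y w, \1_S w).
have mSG : measurable_fun setT (\1_S : g_sigma_algebraType G -> R).
  exact: (@measurable_indic _ (g_sigma_algebraType G) R setT S GS).
have mZG : measurable_fun setT (Z : g_sigma_algebraType G -> R * R).
  exact: (@measurable_fun_pair _ _ _ (g_sigma_algebraType G) _ _ _ _ mYG mSG).
have mZ : measurable_fun setT Z.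
  by move=> _ B mB; apply: Gm; exact: mZG.
pose D := [set z : R * (R * R) | c <= z.1 + z.2.1 <= c + e].
have mD : measurable D.
  rewrite (_ : D = (fun z : R * (R * R) => z.1 + z.2.1) @^-1` [set` `[c, c + e]]); last first.
    by apply/seteqP; split => z; rewrite /D /= in_itv.
  rewrite -[X in measurable X]setTI.
  have mf : measurable_fun setT (fun z : R * (R * R) => z.1 + z.2.1).
    apply: measurable_funD; first exact: measurable_fst.
    by apply: measurableT_comp; [exact: measurable_fst|exact: measurable_snd].
  exact: mf.
pose g (z : R * (R * R)) := (\1_D z * `|z.2.2|)%:E.
have mg : measurable_fun setT g.
  apply/measurable_EFinP; apply: measurable_funM; first exact: measurable_indic.
  apply: measurableT_comp => //.
  by apply: measurableT_comp; [exact: measurable_snd|exact: measurable_snd].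
have g0 z : (0 <= g z)%E by rewrite lee_fin mulr_ge0.
have UZ A B : measurable A -> measurable B ->
    P (U @^-1` A `&` Z @^-1` B) = (P (U @^-1` A) * P (Z @^-1` B))%E.
  move=> mA mB; apply: ind => //.
  by rewrite -[X in <<s G >> X]setTI; exact: mZG.
have mSD : measurable (S `&` [set w | c <= U w + Y w <= c + e]).
  apply: measurableI => //.
  rewrite (_ : [set w | _] = (fun w => (U w, Z w)) @^-1` D); last by [].
  rewrite -[X in measurable X]setTI.
  have mUZ : measurable_fun setT (fun w => (U w, Z w)) by exact: measurable_fun_pair.
  exact: mUZ.
have -> : P (S `&` [set w | (c <= U w + Y w <= c + e)%R]) = (\int[P]_w g (U w, Z w))%E.
  rewrite -[X in P X]setIT -integral_indic//.
  apply: eq_integral => w _; rewrite /g /Z/=; congr EFin.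
  by rewrite indicI ger0_norm// mulrC; congr (_ * _).
rewrite (ge0_integral_independent mU mZ UZ mg g0).
have -> : (p%:E * P S = \int[P]_w (p * \1_S w)%:E)%E.
  under eq_integral do rewrite EFinM.
  rewrite ge0_integralZl//; last by apply/measurable_EFinP; exact: measurable_indic.
  by rewrite integral_indic// setIT.
apply: ge0_le_integral => //.
- by move=> w _; exact: integral_ge0.
- exact: (measurable_fun_integral_l P mU mZ mg g0).
- by apply/measurable_EFinP; apply: measurable_funM => //; exact: measurable_indic.
- move=> w _; rewrite /g /Z/= ger0_norm//.
  have [wS|wS] := boolP (w \in S); last first.
    rewrite indicE (negbTE wS) mulr0 integral0_eq// => w' _.
    by rewrite mulr0.
  (* With [Y w] frozen, the event confines [U] to an interval of length [e] starting at
     [c - Y w]. *)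
  rewrite indicE wS mulr1; apply: le_trans (ball (c - Y w)).
  rewrite -[X in (_ <= P X)%E]setIT -integral_indic//; last first.
    by rewrite -[X in measurable X]setTI; exact: mU.
  rewrite le_eqVlt; apply/orP; left; apply/eqP; apply: eq_integral => w' _; rewrite mulr1 !indicE.
  congr (((_ : bool)%:R)%:E); apply/idP/idP; rewrite !inE /D /= in_itv/=.
    by move=> /andP[? ?]; apply/andP; split; lra.
  by move=> /andP[? ?]; apply/andP; split; lra.
Qed.

Lemma geometric_sum_le (R : realFieldType) (q : R) n : 0 <= q < 1 ->
  \sum_(0 <= k < n) q ^+ k <= (1 - q)^-1.
Proof.
move=> /andP[q0 q1]; rewrite big_mkord -[leRHS]mulr1 ler_pdivlMl ?subr_gt0//.
rewrite -[X in X * _]opprB mulNr -subrX1 opprB lerBlDr lerDl.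
exact: exprn_ge0.
Qed.

Lemma exponential_brownianS (R : realType) (d : measure_display)
    (T : measurableType d) (P : probability T R) (V : R -> T -> R) (H H' : R) :
  H' <= H -> exponential_brownian P V H -> exponential_brownian P V H'.
Proof.
move=> HH [V0 mV cV mgf ind]; split => //.
- by move=> t /andP[t0 tH]; apply: mV; rewrite t0 (le_trans tH).
- move=> w; apply: (@continuous_subspaceW _ _ _ `[0, H]%classic) => //.
  by move=> y /=; rewrite !in_itv/= => /andP[-> /le_trans ->].
- by move=> a s t s0 st tH; apply: mgf => //; exact: le_trans HH.
- by move=> s t A B s0 st tH; apply: ind => //; exact: le_trans HH.
Qed.

Lemma normal_peak_le (R : realType) (s s' : R) : 0 < s -> s <= s' ->
  normal_peak s' <= normal_peak s.
Proof.
move=> s0 ss'; rewrite /normal_peak lef_pV2 ?posrE ?sqrtr_gt0; last 2 first.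
- by rewrite mulrn_wgt0// mulr_gt0 ?pi_gt0// exprn_gt0// (lt_le_trans s0).
- by rewrite mulrn_wgt0// mulr_gt0 ?pi_gt0// exprn_gt0.
rewrite ler_wsqrtr// ler_wMn2r// ler_wpM2r ?pi_ge0//.
by rewrite ler_sqr ?nnegrE ?(ltW s0) ?(le_trans (ltW s0)).
Qed.

Section crossing_density.
Context (R : realType) (d : measure_display) (T : measurableType d)
  (P : probability T R) (W : R -> T -> R).
Hypothesis hW : standard_brownian_motion P W.

Let continuous_linear (A : set R) (L : R) : {within A, continuous (fun s => L * s)}.
Proof.
apply: continuous_subspaceT => s.
by apply: cvgM; [exact: cvg_cst|exact: cvg_id].
Qed.

(** Reversal is run for a time [t / 2] only, so [S] depends on the second half of the path; the
    increment over the first half stays independent of it and contributes its bounded density. *)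
Lemma survive_near_prob_le (t L u c e : R) : 0 < t -> 0 <= L -> 0 <= u -> 0 <= e ->
  let S := ~` crosses (fun s => increment W t (t - s)) (fun s => - L * s) u (t / 2) in
  let A := S `&` [set w | c <= increment W 0 (t / 2) w + increment W (t / 2) t w
                          <= c + e] in
  increments_sigma W 0 `[0, t] A /\
  (P A * (1 - expR (- (2 * L + 1) / 2 * (t / 2)))%:E <=
   (normal_peak (Num.sqrt (t / 2)) * e * ((2 * L + 1) * u))%:E)%E.
Proof.
move=> t0 L0 u0 e0 S A.
have t20 : 0 < t / 2 by rewrite divr_gt0.
have t2t : t / 2 <= t by lra.
have hV : exponential_brownian P (fun s => increment W t (t - s)) (t / 2).
  by apply: exponential_brownianS (reversed_exponential_brownian hW (ltW t0)).
have SV : increments_sigma (fun s => increment W t (t - s)) 0 `[0, t / 2] S.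
  apply: (@measurableC _ (g_sigma_algebraType
    (increment_events (fun s => increment W t (t - s)) 0 `[0, t / 2]))).
  by apply: (crosses_past hV) => //; rewrite (ltW t20) lexx.
have VE s : increment (fun s => increment W t (t - s)) 0 s = increment W t (t - s).
  by apply/funext => w; rewrite /increment subr0; ring.
have Sfuture : increments_sigma W (t / 2) `[t / 2, +oo[ S.
  apply: increments_sigma_sub SV => s; rewrite /= in_itv/= => /andP[s0 st].
  by rewrite VE; apply: future_increment => //; lra.
have Spast : increments_sigma W 0 `[0, t] S.
  apply: increments_sigma_sub SV => s; rewrite /= in_itv/= => /andP[s0 st].
  by rewrite VE; apply: past_increment; [exact: ltW|rewrite lexx ltW|lra].
have Gm : increments_sigma W (t / 2) `[t / 2, +oo[ `<=` measurable.
  apply: (increments_sigma_measurable hW); first exact: ltW.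
  by move=> q; rewrite /= in_itv/= andbT; apply: le_trans; exact: ltW.
split.
  apply: increments_sigmaI => //.
  have mUY : measurable_fun setT ((fun w =>
      increment W 0 (t / 2) w + increment W (t / 2) t w)
      : g_sigma_algebraType (increment_events W 0 `[0, t]) -> R).
    by apply: measurable_funD; apply: past_increment; lra.
  rewrite (_ : [set w | _] = (fun w => increment W 0 (t / 2) w +
    increment W (t / 2) t w) @^-1` [set` `[c, c + e]]); last first.
    by apply/seteqP; split => w; rewrite /= in_itv.
  by rewrite -[X in increments_sigma _ _ _ X]setTI; exact: mUY.
have PA : (P A <= (normal_peak (Num.sqrt (t / 2)) * e)%:E * P S)%E.
  apply: (@small_ball_independent _ _ _ _ _ (increment W 0 (t / 2))
    (increment W (t / 2) t) _ _ _ _ Gm) => //.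
  - by apply: (measurable_increment hW) => //; exact: ltW.
  - exact: future_increment.
  - move=> B C mB HC; apply: (past_future_independent hW (t := t / 2)) => //.
      exact: ltW.
    rewrite -[X in increments_sigma _ _ _ X]setTI.
    by apply: past_increment => //; lra.
  - by rewrite mulr_ge0// normal_peak_ge0.
  - move=> c'; case: hW => _ _ _ _ -> //.
    by rewrite subr0; apply: normal_prob_itv_le; rewrite ?gt_eqF ?sqrtr_gt0.
have PS := survival_prob_le t20 hV (@continuous_linear _ _) L0 u0 (fun=> erefl).
apply: (@le_trans _ _ ((normal_peak (Num.sqrt (t / 2)) * e)%:E * P S *
    (1 - expR (- (2 * L + 1) / 2 * (t / 2)))%:E)%E).
  apply: lee_wpmul2r => //.
  rewrite lee_fin subr_ge0 -[leRHS]expR0 ler_expR !mulNr oppr_le0.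
  by rewrite mulr_ge0 ?(ltW t20)//; lra.
rewrite -muleA [leRHS]EFinM lee_wpmul2l//.
by rewrite lee_fin mulr_ge0// normal_peak_ge0.
Qed.

Lemma cross_soon_prob_le (t L y h a : R) : 0 <= t -> 0 <= L -> 0 < h -> 0 <= a ->
  let F := crosses (fun s => increment W t (t + s)) (fun s => L * s) y h in
  increments_sigma W t `[t, +oo[ F /\
  (P F <= (expR (- a * y + a * L * h + a ^+ 2 * h / 2))%:E)%E.
Proof.
move=> t0 L0 h0 a0 F; have hV := shifted_exponential_brownian hW h t0.
split; last by apply: (crosses_prob_le h0 hV) => //.
have FV : increments_sigma (fun s => increment W t (t + s)) 0 `[0, h] F.
  by apply: (crosses_past hV) => //; rewrite (ltW h0) lexx.
apply: increments_sigma_sub FV => s; rewrite /= in_itv/= => /andP[s0 sh].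
have -> : increment (fun s => increment W t (t + s)) 0 s = increment W t (t + s).
  by apply/funext => w; rewrite /increment addr0; ring.
by apply: future_increment => //; rewrite lerDl.
Qed.

Variables (b : R -> R) (x : R).
Hypothesis cb : continuous_on_halfline b.

Definition brownian_gap q w := increment W 0 q w + x - b q.

(* On the event, let k be such that the gap at time t lies between k * sqrt h
   and (k + 1) * sqrt h.  Run backwards from t, the path starts within
   (k + 1) * sqrt h of the boundary and avoids it for a time t / 2; run forward,
   it comes down by about k * sqrt h within a time h. *)
Lemma crossing_interval_prob_le (del L : R) : 0 < del -> 0 <= L ->
  exists2 C : R, 0 <= C & forall t h : R, del <= t -> 0 < h -> h <= 1 ->
    (forall s s', 0 <= s -> s <= s' -> s' <= t + h -> b s' - b s <= L * (s' - s)) ->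
    forall E : set T, measurable E ->
    (forall w, E w -> ~ hits 0 t (brownian_gap ^~ w) /\
                      hits t (t + h) (brownian_gap ^~ w)) ->
    (P E <= (C * h)%:E)%E.
Proof.
move=> del0 L0.
(* For [t >= del], the survival and density factors are controlled by their values [c0] and [p0] at
   [del]. *)
pose c0 := 1 - expR (- (2 * L + 1) / 2 * (del / 2)).
have c00 : 0 < c0.
  rewrite subr_gt0 -[ltRHS]expR0 ltr_expR !mulNr oppr_lt0.
  by rewrite mulr_gt0 ?divr_gt0//; lra.
pose p0 := normal_peak (Num.sqrt (del / 2)).
have p00 : 0 <= p0 by exact: normal_peak_ge0.
pose q := expR (- 1) : R.
have q01 : 0 <= q < 1.
  by rewrite expR_ge0 -[ltRHS]expR0 ltr_expR oppr_lt0 ltr01.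
(* [expR (2 * L + 2)] is the part of the forward estimate that does not depend on the level [k],
   bounded by means of [eta <= 1]. *)
pose C1 := p0 * (2 * L + 1) / c0 * expR (2 * L + 2).
have C10 : 0 <= C1.
  by rewrite mulr_ge0 ?expR_ge0// divr_ge0 ?(ltW c00)// mulr_ge0//; lra.
exists (C1 * (1 - q)^-1).
  by rewrite mulr_ge0// invr_ge0 subr_ge0 ltW//; case/andP: q01.
move=> t h delt h0 h1 bL E mE HE.
have t0 : 0 < t by exact: lt_le_trans delt.
pose eta := Num.sqrt h.
have eta0 : 0 < eta by rewrite sqrtr_gt0.
have eta2 : eta * eta = h by rewrite -expr2 sqr_sqrtr// ltW.
have eta1 : eta <= 1 by rewrite -[leRHS]sqrtr1 ler_wsqrtr.
pose u k := (k%:R + 1) * eta.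
pose c k := k%:R * eta - x + b t.
pose S k := ~` crosses (fun s => increment W t (t - s)) (fun s => - L * s) (u k) (t / 2).
pose A k := S k `&` [set w | c k <= increment W 0 (t / 2) w +
  increment W (t / 2) t w <= c k + eta].
pose F k := crosses (fun s => increment W t (t + s)) (fun s => L * s) (k%:R * eta) h.
have u0 k : 0 <= u k by rewrite mulr_ge0// ?ltW// addr_ge0.
have HA k := survive_near_prob_le (c k) t0 L0 (u0 k) (ltW eta0).
(* With [a = 2 / eta] the three terms of the exponent become [- 2 k], [2 * L * eta] and [2]. *)
have HF k := cross_soon_prob_le (k%:R * eta) (ltW t0) L0 h0
  (divr_ge0 (ler0n R 2) (ltW eta0)).
have mA k : measurable (A k).
  case: (HA k) => + _; apply: (increments_sigma_measurable hW) => // r.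
  by rewrite /= in_itv/= => /andP[].
have mF k : measurable (F k).
  case: (HF k) => + _; apply: (increments_sigma_measurable hW); first exact: ltW.
  by move=> r; rewrite /= in_itv/= andbT; apply: le_trans; exact: ltW.
have PAF k : (P (A k `&` F k) <= (C1 * h * q ^+ k)%:E)%E.
  have [Apast PA] := HA k; have [Ffuture PF] := HF k.
  rewrite (past_future_independent hW (ltW t0) Apast Ffuture).
  have PA' : (P (A k) <= (p0 * eta * ((2 * L + 1) * u k) / c0)%:E)%E.
    move: PA; rewrite -/(S k) -/(A k).
    have [p pE] : exists p : R, P (A k) = p%:E.
      by exists (fine (P (A k))); rewrite fineK//; exact: fin_num_measure.
    have pge0 : 0 <= p by rewrite -lee_fin -pE.
    rewrite pE -EFinM !lee_fin ler_pdivlMr// => pA.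
    apply: (@le_trans _ _ (p * (1 - expR (- (2 * L + 1) / 2 * (t / 2))))).
      apply: ler_wpM2l => //; rewrite /c0 lerD2l lerN2 ler_expR.
      have : (2 * L + 1) * del <= (2 * L + 1) * t by rewrite ler_wpM2l//; lra.
      by move=> ?; lra.
    apply: (le_trans pA); apply: ler_wpM2r; first by rewrite mulr_ge0//; lra.
    apply: ler_wpM2r; first exact: ltW.
    apply: normal_peak_le; first by rewrite sqrtr_gt0 divr_gt0.
    by rewrite ler_wsqrtr// ler_pM2r.
  apply: (le_trans (lee_pmul _ _ PA' PF)) => //.
  rewrite -EFinM lee_fin.
  have expE : expR (- (2 / eta) * (k%:R * eta) + 2 / eta * L * h + (2 / eta) ^+ 2 * h / 2) <=
      expR (2 * L + 2) * expR (- (2 * k%:R)).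
    rewrite -expRD ler_expR.
    have -> : - (2 / eta) * (k%:R * eta) + 2 / eta * L * h + (2 / eta) ^+ 2 * h / 2 =
        2 * L * eta + 2 - 2 * k%:R.
      by rewrite -eta2; field; rewrite gt_eqF.
    have : 2 * L * eta <= 2 * L * 1 by rewrite ler_wpM2l//; lra.
    by move=> ?; lra.
  apply: (le_trans (ler_wpM2l _ expE)).
    rewrite mulr_ge0// ?invr_ge0 ?(ltW c00)// mulr_ge0// ?mulr_ge0 ?(ltW eta0)//.
    by lra.
  (* The factor [k + 1] coming from the width [u k] is absorbed by one of two factors [q ^+ k], as
     [1 + k <= expR k]; the other one makes the sum over the levels converge. *)
  have kq : (k%:R + 1) * expR (- (2 * k%:R)) <= q ^+ k.
    have -> : expR (- (2 * k%:R)) = q ^+ k * q ^+ k :> R.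
      by rewrite /q -expRM_natl -expRD; congr expR; ring.
    rewrite mulrA ler_piMl ?exprn_ge0 ?expR_ge0//.
    rewrite /q -expRM_natl mulrN1 expRN ler_pdivrMr ?expR_gt0// mul1r addrC.
    exact: expR_ge1Dx.
  have -> : p0 * eta * ((2 * L + 1) * u k) / c0 * (expR (2 * L + 2) * expR (- (2 * k%:R)))
      = C1 * h * ((k%:R + 1) * expR (- (2 * k%:R))).
    by rewrite /C1 /u -eta2; ring.
  by apply: ler_wpM2l => //; rewrite mulr_ge0// ltW.
have cover : E `<=` \bigcup_k (A k `&` F k).
  move=> w /HE[nohit [s /andP[ts sth] gs]].
  have gap_gt0 r : 0 <= r <= t -> 0 < brownian_gap r w.
    by move=> rt; rewrite ltNge; apply/negP => gr; apply: nohit; exists r.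
  have gt0 : 0 < brownian_gap t w by apply: gap_gt0; rewrite lexx ltW.
  pose k := Num.truncn (brownian_gap t w / eta).
  have /andP[kg gk] : (k%:R <= brownian_gap t w / eta < k.+1%:R).
    by apply: truncn_itv; rewrite divr_ge0 ?ltW.
  rewrite ler_pdivlMr// in kg; rewrite ltr_pdivrMr// -natr1 in gk.
  have gapE r : brownian_gap r w = increment W t r w + brownian_gap t w + b t - b r.
    by rewrite /brownian_gap /increment; ring.
  exists k => //; split; last first.
    exists (s - t); first by rewrite subr_ge0 ts lerBlDl.
    have := bL t s (ltW t0) ts sth.
    move: gs; rewrite gapE (_ : t + (s - t) = s); last by ring.
    by move: kg; move: (k%:R * eta) (L * (s - t)) => z1 z2 *; lra.
  split.
    (* The one-sided Lipschitz bound on [b] replaces the boundary, seen backwards from [t], by a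
       line of slope [- L]. *)
    move=> [r /andP[r0 rt]].
    have trt : 0 <= t - r <= t by lra.
    have := gap_gt0 _ trt; rewrite gapE.
    have : b t - b (t - r) <= L * (t - (t - r)).
      by apply: bL; lra.
    rewrite (_ : t - (t - r) = r); last by ring.
    rewrite /u; move: gk; rewrite mulNr.
    by move: ((k%:R + 1) * eta) (L * r) => z1 z2 *; lra.
  rewrite /= /c; move: kg gk; rewrite mulrDl mul1r /brownian_gap /increment.
  by move: (k%:R * eta) => z *; apply/andP; split; lra.
have mAF k : measurable (A k `&` F k) by exact: measurableI.
apply: (le_trans (@measure_sigma_subadditive _ _ _ P E (fun k => A k `&` F k)
  mAF mE cover)).
apply: (@le_trans _ _ (\sum_(0 <= k <oo) (C1 * h * q ^+ k)%:E)%E).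
  by apply: lee_nneseries => [k _ _|k _]; [exact: measure_ge0|exact: PAF].
apply: lime_le.
  apply: is_cvg_nneseries => k _ _.
  by rewrite lee_fin mulr_ge0 ?exprn_ge0 ?expR_ge0// mulr_ge0// ltW.
apply: nearW => n; rewrite sumEFin lee_fin -mulr_sumr.
rewrite -mulrA [leRHS]mulrAC -[leRHS]mulrA ler_wpM2l//.
by rewrite ler_wpM2l ?(ltW h0)// geometric_sum_le.
Qed.

End crossing_density.

(* A null set is covered by half-open intervals of small total length. *)
Lemma interval_bound_null (R : realType)
    (nu : {measure set (measurableTypeR R) -> \bar R}) (C : R) : 0 <= C ->
  (forall a b : R, a <= b -> (nu [set` `]a, b]] <= (C * (b - a))%:E)%E) ->
  forall N : set (measurableTypeR R), measurable N ->
  lebesgue_measure N = 0%E -> nu N = 0%E.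
Proof.
move=> C0 nuC N mN N0; apply/eqP; rewrite eq_le measure_ge0 andbT.
apply/lee_addgt0Pr => e e0; rewrite add0e.
(* [C + 1] because [C] may vanish. *)
have e'0 : 0 < e / (C + 1) by rewrite divr_gt0// ltr_wpDl.
have : (lebesgue_measure N < (e / (C + 1))%:E)%E by rewrite N0 lte_fin.
move=> /ereal_inf_lt[_ [F [Fm NF] <-] Fe].
have nuF k : (nu (F k) <= C%:E * wlength idfun (F k))%E.
  have [[a b] _ <-] := Fm k.
  have [ab|ba] := leP a b; last first.
    rewrite (_ : [set` _] = set0); last first.
      by apply: set_itv_ge; rewrite bnd_simp -leNgt ltW.
    by rewrite measure0 mule_ge0 ?lee_fin ?wlength_ge0.
  by rewrite wlength_itv_bnd// -EFinM nuC.
have mF k : measurable (F k : set (measurableTypeR R)).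
  exact: sub_sigma_algebra.
apply: (le_trans (measure_sigma_subadditive _ mF mN NF)).
apply: (@le_trans _ _ (\sum_(0 <= k <oo) (C%:E * wlength idfun (F k)))%E).
  by apply: lee_nneseries => k _.
rewrite nneseriesZl//.
apply: (@le_trans _ _ (C%:E * (e / (C + 1))%:E)%E).
  by apply: lee_wpmul2l => //; exact: ltW.
rewrite -EFinM lee_fin mulrA ler_pdivrMr ?ltr_wpDl//.
by rewrite mulrC ler_pM2l// lerDl.
Qed.

(** * Hitting times from a fixed starting point *)

Section hitting_time_paths.
Context (R : realType) (g : R -> R).
Hypothesis cg : {within `[0, +oo[, continuous g}.

Let path_hitting_time : \bar R :=
  ereal_inf [set t%:E | t in [set t : R | 0 < t /\ g t <= 0]].

Lemma within_continuous_halfline a c : 0 <= a -> {within `[a, c], continuous g}.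
Proof.
move=> a0; apply: continuous_subspaceW cg => y /=.
by rewrite !in_itv/= andbT => /andP[+ _]; exact: le_trans.
Qed.

(** Positivity at [0] reconciles the two infima: [first_hit] also looks at time 0, the hitting time
    only at positive times. *)
Lemma hitting_time_first_hit H : 0 <= H -> 0 < g 0 -> hits 0 H g ->
  path_hitting_time = (first_hit H g)%:E.
Proof.
move=> H0 g0 hitH; have cgH := @within_continuous_halfline 0 H (lexx 0).
have gs := first_hit_hits H0 cgH hitH.
have /andP[s0 sH] := first_hit_itv g H0.
apply/eqP; rewrite eq_le; apply/andP; split.
  apply: ereal_inf_lbound; exists (first_hit H g) => //; split => //.
  rewrite lt_neqAle s0 andbT; apply/eqP => s_eq.
  by move: gs; rewrite -s_eq leNgt g0.
apply: le_ereal_inf_tmp => _ [t [t0 gt] <-]; rewrite lee_fin.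
have [tH|Ht] := leP t H; first by apply: first_hit_le => //; rewrite (ltW t0).
by rewrite (le_trans sH)// ltW.
Qed.

Lemma hitting_time_le H : 0 <= H -> 0 < g 0 ->
  (path_hitting_time <= H%:E)%E <-> hits 0 H g.
Proof.
move=> H0 g0; split=> [tauH|hitH]; last first.
  rewrite (hitting_time_first_hit H0)// lee_fin.
  by case/andP: (first_hit_itv g H0).
(* An infimum at most [H] only yields hits before later times, such as [H + 1]; the first hit on
   [[0, H + 1]] is attained and equals the infimum. *)
have : (path_hitting_time < (H + 1)%:E)%E.
  by apply: (le_lt_trans tauH); rewrite lte_fin ltrDl.
move=> /ereal_inf_lt[_ [t [t0 gt] <-]]; rewrite lte_fin => tH.
have hit1 : hits 0 (H + 1) g by exists t => //; rewrite !ltW.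
have H10 : 0 <= H + 1 by rewrite addr_ge0.
move: tauH; rewrite (hitting_time_first_hit H10)// lee_fin => sH.
exists (first_hit (H + 1) g).
  by case/andP: (first_hit_itv g H10) => -> _.
exact: (first_hit_hits H10 (@within_continuous_halfline 0 _ (lexx 0))).
Qed.

(** The compact intervals from [1 / (n + 1)] to [c - 1 / (n + 1)] exhaust []0, c[], and hitting
    within a compact interval is a measurable event. They stay away from time 0, where a path may
    already be on the boundary. *)
Lemma hitting_time_lt (c : R) :
  (path_hitting_time < c%:E)%E <->
  exists n : nat, n.+1%:R^-1 <= c - n.+1%:R^-1 /\
    hits n.+1%:R^-1 (c - n.+1%:R^-1) g.
Proof.
split=> [/ereal_inf_lt[_ [t [t0 gt] <-]]|[n [nc [t /andP[nt tc] gt]]]].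
  rewrite lte_fin => tc.
  pose e := Num.min t (c - t); have e0 : 0 < e by rewrite lt_min t0 subr_gt0.
  pose n := Num.truncn e^-1; have ne : n.+1%:R^-1 <= e.
    by rewrite -[leRHS]invrK lef_pV2 ?posrE ?invr_gt0// ltW// truncnS_gt.
  move: ne; rewrite le_min => /andP[nt ntc].
  exists n; have tcn : t <= c - n.+1%:R^-1 by rewrite lerBrDl -lerBrDr.
  by split; [exact: le_trans tcn|exists t => //; rewrite nt].
have n0 : 0 < n.+1%:R^-1 :> R by rewrite invr_gt0.
apply: (@le_lt_trans _ _ t%:E).
  by apply: ereal_inf_lbound; exists t => //; split => //; exact: lt_le_trans nt.
by rewrite lte_fin (le_lt_trans tc)// ltrBlDr ltrDl.
Qed.

End hitting_time_paths.

Lemma measurable_hitting_time (R : realType) (d : measure_display)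
    (S : measurableType d) (gap : R -> S -> R) :
  (forall q, 0 <= q -> measurable_fun setT (gap q)) ->
  (forall w, {within `[0, +oo[, continuous (gap ^~ w)}) ->
  measurable_fun setT (fun w =>
    ereal_inf [set t%:E | t in [set t : R | 0 < t /\ gap t w <= 0]]).
Proof.
move=> mg cg; apply: (@measurability _ _ _ _ _ _ (@ErealGenInftyO.G R)).
  exact: ErealGenInftyO.measurableE.
move=> _ [_ [c ->] <-]; rewrite setTI.
rewrite (_ : _ @^-1` _ = \bigcup_(n : nat)
    ([set _ | (n.+1%:R^-1 : R) <= c - n.+1%:R^-1] `&`
     [set w | hits n.+1%:R^-1 (c - n.+1%:R^-1) (gap ^~ w)])).
  apply: bigcupT_measurable => n.
  have [nc|nc] := boolP ((n.+1%:R^-1 : R) <= c - n.+1%:R^-1); last first.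
    by rewrite (_ : [set _ | _] = set0) ?set0I//; apply/seteqP; split.
  rewrite (_ : [set _ | _] = setT) ?setTI; last by apply/seteqP; split.
  have n0 : 0 < n.+1%:R^-1 :> R by rewrite invr_gt0.
  apply: measurable_hits => // [q /andP[nq _]|w].
    by apply: mg; exact/ltW/(lt_le_trans n0).
  by apply: (within_continuous_halfline (cg w)); exact: ltW.
apply/seteqP; split => w /=; rewrite in_itv/=.
  by move=> /hitting_time_lt[n [nc hn]]; exists n.
by move=> [n _ [nc hn]]; apply/hitting_time_lt; exists n.
Qed.

Section deterministic_start.
Context (R : realType) (d : measure_display) (T : measurableType d)
  (P : probability T R) (W : R -> T -> R).
Hypothesis hW : standard_brownian_motion P W.
Variables (b : R -> R) (x : R).
Hypotheses (cb : continuous_on_halfline b) (b0x : b 0 < x).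

Let gap := brownian_gap W b x.

Let cgap w : {within `[0, +oo[, continuous (gap ^~ w)}.
Proof.
case: hW => _ _ /(_ w)/subspace_continuousP cW _ _.
move/subspace_continuousP : cb => cb'.
apply/subspace_continuousP => q q0; apply: cvgB; last exact: cb'.
apply: cvgD; last exact: cvg_cst.
by apply: cvgB; [exact: cW|exact: cvg_cst].
Qed.

Let gap0 w : 0 < gap 0 w.
Proof. by rewrite /gap /brownian_gap /increment subrr add0r subr_gt0. Qed.

Let mgap q : 0 <= q -> measurable_fun setT (gap q).
Proof.
move=> q0; apply: measurable_funB => //; apply: measurable_funD => //.
exact: (measurable_increment hW).
Qed.

(* [W 0] vanishes only almost surely; with [W t - W 0] every path starts strictly
   above the boundary. *)
Definition increment_hitting_time w : \bar R :=
  ereal_inf [set t%:E | t in [set t : R | 0 < t /\ brownian_gap W b x t w <= 0]].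

Let tau := increment_hitting_time.

Lemma measurable_increment_hitting_time : measurable_fun setT tau.
Proof. exact: measurable_hitting_time mgap cgap. Qed.

Let mtau_le (c : R) : measurable [set w | (tau w <= c%:E)%E].
Proof.
rewrite (_ : [set w | _] = tau @^-1` `]-oo, c%:E]); last first.
  by apply/seteqP; split => w; rewrite /= in_itv.
rewrite -[X in measurable X]setTI; apply: measurable_increment_hitting_time => //.
exact: emeasurable_itv.
Qed.

Let mtau_gt (c : R) : measurable [set w | (c%:E < tau w)%E].
Proof.
rewrite (_ : [set w | _] = ~` [set w | (tau w <= c%:E)%E]).
  exact: measurableC.
by apply/seteqP; split => w /=; rewrite ltNge => /negP.
Qed.

Lemma increment_hitting_time_interval (del M L : R) : 0 < del -> 0 <= L ->
  (forall s s', 0 <= s -> s <= s' -> s' <= M -> b s' - b s <= L * (s' - s)) ->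
  exists2 C : R, 0 <= C & forall a c : R, a <= c ->
    (P [set w | [/\ del%:E < tau w, tau w <= M%:E, a%:E < tau w & tau w <= c%:E]%E]
     <= (C * (c - a))%:E)%E.
Proof.
move=> del0 L0 bL.
have [C C0 hC] := crossing_interval_prob_le hW b x del0 L0.
(* The maximum with [1] covers lengths [h] above 1, for which the probability is simply bounded by
   1. *)
exists (Num.max C 1); first by rewrite le_max C0.
move=> a c ac.
pose E := [set w | [/\ del%:E < tau w, tau w <= M%:E, a%:E < tau w & tau w <= c%:E]%E].
rewrite -/E.
have mE : measurable E.
  rewrite (_ : E = [set w | (del%:E < tau w)%E] `&` [set w | (tau w <= M%:E)%E] `&`
    [set w | (a%:E < tau w)%E] `&` [set w | (tau w <= c%:E)%E]).
    by do !apply: measurableI.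
  by apply/seteqP; split => w /= => [[]|[[[]]]].
pose t := Num.max del a; pose h := Num.min M c - t.
have ca_ge0 : 0 <= c - a by rewrite subr_ge0.
have hca : h <= c - a.
  by rewrite /h lerB// ?ge_min ?lexx ?orbT// le_max lexx orbT.
have Et w : E w -> ((t%:E < tau w)%E /\ (tau w <= (t + h)%:E)%E).
  move=> [h1 h2 h3 h4]; rewrite /h addrCA subrr addr0; split.
    by rewrite /t; case: (leP del a).
  by case: (leP M c).
have [h0|h0] := leP h 0.
  suff -> : E = set0.
    by rewrite measure0 lee_fin mulr_ge0// le_max C0.
  apply/seteqP; split => // w /Et[tw /(lt_le_trans tw)].
  by rewrite lte_fin ltrDl ltNge h0.
have [h1|h1] := leP h 1; last first.
  apply: (le_trans (probability_le1 P mE)); rewrite lee_fin.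
  apply: (le_trans (ltW h1)); apply: (le_trans hca).
  by rewrite ler_peMl// le_max lexx orbT.
have t0 : 0 < t by rewrite lt_max del0.
apply: (@le_trans _ _ (C * h)%:E).
  apply: (hC t h) => //.
  - by rewrite le_max lexx.
  - move=> s s' s0 ss' s'th; apply: bL => //; apply: (le_trans s'th).
    by rewrite /h addrCA subrr addr0 ge_min lexx.
  - move=> w /Et[tw wth].
    have nt : ~ hits 0 t (gap ^~ w).
      move=> /(hitting_time_le (@cgap w) (ltW t0) (gap0 w)).
      by rewrite leNgt tw.
    split => //.
    have th0 : 0 <= t + h by rewrite addr_ge0// ltW.
    have [q /andP[q0 qth] gq] := (hitting_time_le (@cgap w) th0 (gap0 w)).1 wth.
    exists q => //; rewrite qth andbT leNgt; apply/negP => qt; apply: nt.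
    by exists q => //; rewrite q0 ltW.
rewrite lee_fin; apply: ler_pM => //; first exact: ltW.
by rewrite le_max lexx.
Qed.

(** The constant of the interval bound depends on the window of times, so the law is cut into its
    restrictions to the events [D n]. These cover all finite hitting times, since a path starting
    strictly above the boundary hits it at a positive time. *)
Lemma increment_hitting_time_dominated (N : set R) :
  (forall M : R, exists2 L, 0 <= L &
    forall s s', 0 <= s -> s <= s' -> s' <= M -> b s' - b s <= L * (s' - s)) ->
  measurable N -> lebesgue_measure N = 0%E -> P (tau @^-1` (EFin @` N)) = 0%E.
Proof.
move=> bLip mN N0.
pose D n := [set w | (n.+1%:R^-1%:E < tau w)%E] `&` [set w | (tau w <= n%:R%:E)%E].
have mD n : measurable (D n) by exact: measurableI.
(* [fine] sends [+oo] to [0]; the events [D n] exclude this case. *)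
have mf : measurable_fun setT (fine \o tau : T -> measurableTypeR R).
  move=> mT B mB.
  have mf' : measurable_fun setT (fine \o tau).
    by apply: measurableT_comp => //; exact: measurable_increment_hitting_time.
  exact: mf'.
have nuN n : P ((fine \o tau) @^-1` N `&` D n) = 0%E.
  have [L L0 bL] := bLip n%:R.
  have n0 : 0 < n.+1%:R^-1 :> R by rewrite invr_gt0.
  have [C C0 hC] := increment_hitting_time_interval n0 L0 bL.
  suff : pushforward (mrestr P (mD n)) (fine \o tau : T -> measurableTypeR R) N = 0%E.
    by [].
  apply: (interval_bound_null C0) => //.
  move=> a c ac; apply: le_trans (hC a c ac).
  apply: le_measure; rewrite ?inE.
  - apply: measurableI => //; rewrite -[X in measurable X]setTI; apply: mf => //.
  - rewrite (_ : [set w | _] = [set w | (n.+1%:R^-1%:E < tau w)%E] `&`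
      [set w | (tau w <= n%:R%:E)%E] `&` [set w | (a%:E < tau w)%E] `&`
      [set w | (tau w <= c%:E)%E]).
      by do !apply: measurableI.
    by apply/seteqP; split => w /= => [[]|[[[]]]].
  - move=> w [/= + [h1 h2]]; rewrite in_itv/= => /andP[h3 h4].
    have {}h1 : (n.+1%:R^-1%:E < tau w)%E by [].
    have {}h2 : (tau w <= n%:R%:E)%E by [].
    by move: h1 h2 h3 h4; rewrite /=; case: (tau w) => [r| |].
apply/eqP; rewrite eq_le measure_ge0 andbT.
have mDn n : measurable ((fine \o tau) @^-1` N `&` D n).
  by apply: measurableI => //; rewrite -[X in measurable X]setTI; exact: mf.
have mtauN : measurable (tau @^-1` (EFin @` N)).
  rewrite -[X in measurable X]setTI; apply: measurable_increment_hitting_time => //.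
  exact: measurable_image_EFin.
apply: (@le_trans _ _ (\sum_(0 <= n <oo) P ((fine \o tau) @^-1` N `&` D n))%E).
  apply: measure_sigma_subadditive => //.
  move=> w [r Nr tauE].
  have r0 : 0 < r.
    rewrite ltNge; apply/negP => r0.
    have : (tau w <= 0%:E)%E by rewrite -tauE lee_fin.
    move=> /(hitting_time_le (@cgap w) (lexx 0) (gap0 w))[q /le_anti <-].
    by rewrite leNgt gap0.
  pose n := maxn (Num.truncn r^-1) (Num.truncn r).+1.
  exists n => //; split; first by rewrite /= -tauE.
  split; rewrite /= -tauE ?lte_fin ?lee_fin.
    rewrite -[ltRHS]invrK ltf_pV2 ?posrE ?invr_gt0//.
    by apply: (lt_le_trans (truncnS_gt _)); rewrite ler_nat ltnS leq_maxl.
  by apply/ltW/(lt_le_trans (truncnS_gt _)); rewrite ler_nat leq_maxr.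
by rewrite eseries0.
Qed.

(** The value 0 at infinity restricts expectations to the paths that reach the boundary. *)
Definition ereal_kernel (a : R) (t : \bar R) : \bar R :=
  if t is r%:E then (hitting_kernel b a r)%:E else 0%E.

(** The horizon [n.+1] of [crossing_laplace] tends to infinity: the main terms increase to the left
    side, and the error is the kernel at the horizon. *)
Lemma increment_hitting_time_laplace (a : R) : 0 < a ->
  hitting_kernel b a n.+1%:R @[n --> \oo] --> 0 ->
  (\int[P]_w ereal_kernel a (tau w) = (expR (- a * x))%:E)%E.
Proof.
move=> a0 k_cvg.
have hV : forall H, exponential_brownian P (increment W 0) H.
  move=> H; have := shifted_exponential_brownian hW H (lexx 0).
  by rewrite (_ : (fun s => _) = increment W 0)//; apply/funext => s; rewrite add0r.
have n0 n : 0 < n.+1%:R :> R by [].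
have cbn n : {within `[0, n.+1%:R], continuous b}.
  exact: (within_continuous_halfline cb (lexx 0)).
have b0x' : b 0 <= x by exact: ltW.
pose I n w := (\1_(crosses (increment W 0) b x n.+1%:R) w *
  hitting_kernel b a (crossing_time (increment W 0) n.+1%:R b x w))%:E.
have I_E n w : I n w = if (tau w <= n.+1%:R%:E)%E then ereal_kernel a (tau w) else 0%E.
  rewrite /I; have n0' := ltW (n0 n).
  case: ifPn => [/(hitting_time_le (@cgap w) n0' (gap0 w)) hw|nw].
    rewrite indicE mem_set// mul1r /tau /increment_hitting_time.
    by rewrite (hitting_time_first_hit (@cgap w) n0' (gap0 w) hw).
  rewrite indicE memNset ?mul0r//= => hw; apply: (negP nw).
  exact/(hitting_time_le (@cgap w) n0' (gap0 w)).
have mI n : measurable_fun setT (I n).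
  by apply/measurable_EFinP; case: (crossing_laplace (n0 n) (hV _) (cbn n) a0 b0x').
have k0 t : (0 <= ereal_kernel a t)%E by case: t => //= r; rewrite lee_fin expR_ge0.
have I0 n w : (0 <= I n w)%E by rewrite I_E; case: ifP.
have I_nd w : {homo I ^~ w : m n / (m <= n)%N >-> (m <= n)%E}.
  move=> m n mn; rewrite !I_E; case: ifPn => [hm|_]; last by case: ifP.
  by rewrite (le_trans hm)// lee_fin ler_nat ltnS.
have I_lim w : limn (I ^~ w) = ereal_kernel a (tau w).
  apply/cvg_lim => //; apply: cvg_near_cst.
  case E : (tau w) => [r| |].
  - near=> n; rewrite I_E E ifT// lee_fin.
    apply/ltW/(lt_le_trans (truncnS_gt _)); rewrite ler_nat ltnS.
    by near: n; exists (Num.truncn r).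
  - by apply: nearW => n; rewrite I_E E /= ?if_same.
  - by apply: nearW => n; rewrite I_E E /= ?if_same.
have I_cvg : (\int[P]_w I n w @[n --> \oo] --> \int[P]_w ereal_kernel a (tau w))%E.
  under eq_integral do rewrite -I_lim.
  exact: cvg_monotone_convergence.
apply: (cvg_unique _ I_cvg) => //.
apply: (@squeeze_cvge _ _ _ _
  (fun n => (expR (- a * x))%:E - (hitting_kernel b a n.+1%:R)%:E)%E _
  (cst (expR (- a * x))%:E)).
- apply: nearW => n.
  have [_ /andP[h1 h2]] := crossing_laplace (n0 n) (hV _) (cbn n) a0 b0x'.
  by rewrite h1 leeBlDr// h2.
- rewrite -[X in _ --> X]sube0; apply: cvgeB => //; first exact: cvg_cst.
  by apply: cvg_EFin => //; exact: nearW.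
- exact: cvg_cst.
Unshelve. all: by end_near. Qed.

End deterministic_start.

(** * Bounds on the boundary and on the kernel *)

Lemma measurable_hitting_kernel (R : realType) (b : R -> R) :
  continuous_on_halfline b -> forall a : R,
  measurable_fun (`[0, +oo[%classic : set R) (hitting_kernel b a).
Proof.
move=> cb a; have mb : measurable_fun (`[0, +oo[%classic : set R) b.
  exact: subspace_continuous_measurable_fun.
apply: measurableT_comp => //.
apply: measurable_funB; first exact: measurable_funM.
by apply: measurable_funM => //; exact: measurable_funM.
Qed.

Lemma probability_density_integrable (R : realType) (f : R -> R) :
  probability_density f ->
  (@lebesgue_measure R).-integrable `[0, +oo[ (fun t => (f t)%:E).
Proof.
move=> [mf f0 f1]; apply/integrableP; split; first exact/measurable_EFinP.
suff -> : (\int[lebesgue_measure]_(t in `[0%R, +oo[) `|(f t)%:E| =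
    \int[lebesgue_measure]_(t in `[0%R, +oo[) (f t)%:E)%E.
  by rewrite f1 ltry.
apply: eq_integral => t.
by rewrite inE /= in_itv/= andbT => t0; rewrite ger0_norm ?f0.
Qed.

Section boundary.
Context (R : realType) (b : R -> R).
Hypotheses (hb0 : b 0 = 0) (hbC1 : continuously_differentiable_on_halfline b)
  (cb : continuous_on_halfline b).
Hypothesis hb_lim : forall a : R, 0 < a -> exists l : \bar R,
  ((b t + a * t)%:E @[t --> +oo%R] --> l) /\ (-oo < l)%E.

Lemma continuously_differentiable_is_derive : exists2 db : R -> R,
  continuous_on_halfline db & forall t : R, 0 < t -> is_derive t 1 b (db t).
Proof.
case: hbC1 => db [cdb dbE]; exists db => // t t0.
have bcvg : h^-1 *: ((b \o shift t) (h *: (1 : R)) - b t) @[h --> 0^'] --> db t.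
  apply/cvgrPdist_lt => e e0.
  have /cvgrPdist_lt/(_ _ e0) := dbE t (ltW t0).
  rewrite /within/= => /nbhs_ballP[del /= del0 delP].
  (* Within distance [t] of [t], the point [h + t] stays on the half line. *)
  apply/nbhs_ballP; exists (Num.min del t); first by rewrite /= lt_min del0.
  move=> h /=; rewrite /ball/= sub0r normrN lt_min => /andP[hdel ht] h0.
  have ht0 : 0 <= h + t by move: ht; rewrite ltr_norml => /andP[? _]; lra.
  have := delP (h + t); rewrite /ball/= opprD addrCA subrr addr0 normrN.
  have htt : h + t != t by rewrite -subr_eq0 addrK.
  move=> /(_ hdel htt ht0).
  by rewrite /= addrK /shift/= scaler1 /GRing.scale/= mulrC.
by apply: DeriveDef; [apply/cvg_ex; exists (db t)|exact/cvg_lim].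
Qed.

Lemma boundary_lipschitz (M : R) : exists2 L : R, 0 <= L &
  forall s s' : R, 0 <= s -> s <= s' -> s' <= M -> `|b s' - b s| <= L * (s' - s).
Proof.
have [db cdb dbE] := continuously_differentiable_is_derive.
have [M0|M0] := ltP M 0.
  exists 0 => // s s' s0 ss' s'M.
  by have := le_trans s0 (le_trans ss' s'M); rewrite leNgt M0.
have cn : {within `[0, M], continuous (fun t => `|db t|)}.
  have /subspace_continuousP c := within_continuous_halfline cdb (lexx 0) (c := M).
  by apply/subspace_continuousP => y yM; apply: cvg_norm; exact: c.
have [c _ cmax] := EVT_max M0 cn.
exists `|db c| => // s s' s0 ss' s'M.
have [y||y ys ->] := @MVT_segment R b db s s' ss'.
- by rewrite in_itv/= => /andP[sy _]; apply: dbE; exact: le_lt_trans sy.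
- exact: (within_continuous_halfline cb).
rewrite normrM [X in _ * X]ger0_norm ?subr_ge0//.
apply: ler_wpM2r; first by rewrite subr_ge0.
apply: cmax; move: ys; rewrite !in_itv/= => /andP[sy ys'].
by rewrite (le_trans s0 sy) (le_trans ys').
Qed.

(** The limit at infinity bounds the function from below after some time, compactness before it. *)
Lemma boundary_lower_affine (a : R) : 0 < a -> exists2 K : R, 0 <= K &
  forall t : R, 0 <= t -> - K <= b t + a * t.
Proof.
move=> a0; have [l [bl lNy]] := hb_lim a0.
have [m ml] : exists m : R, (m%:E < l)%E.
  case: l bl lNy => [r| |] // _ _; last by exists 0; rewrite ltry.
  by exists (r - 1); rewrite lte_fin ltrBlDr ltrDl.
have := bl _ (open_ereal_gt' ml); rewrite /= => -[N [_ NP]].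
pose N' := Num.max N 0 + 1.
have N'0 : 0 <= N' by rewrite addr_ge0// le_max lexx orbT.
have cg : {within `[0, N'], continuous (fun t => b t + a * t)}.
  have /subspace_continuousP c := within_continuous_halfline cb (lexx 0) (c := N').
  apply/subspace_continuousP => y yM; apply: cvgD; first exact: c.
  apply: cvgM; first exact: cvg_cst.
  exact: cvg_within.
have [c _ cmin] := EVT_min N'0 cg.
exists (Num.max `|m| `|b c + a * c|); first by rewrite le_max normr_ge0.
move=> t t0; rewrite lerNl.
have [tN|Nt] := leP t N'.
  rewrite (@le_trans _ _ `|b c + a * c|) ?le_max ?lexx ?orbT//.
  rewrite (@le_trans _ _ (- (b c + a * c)))//; last by rewrite -normrN ler_norm.
  by rewrite lerN2 cmin// in_itv/= t0.
rewrite (@le_trans _ _ `|m|) ?le_max ?lexx//.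
rewrite (@le_trans _ _ (- m))//; last by rewrite -normrN ler_norm.
rewrite lerN2; apply: ltW; rewrite -lte_fin; apply: NP.
by apply: lt_trans Nt; rewrite /N' ltr_pwDr// le_max lexx.
Qed.

(** A constant term would be multiplied by [a] in the kernel and spoil its limit as [a] grows. Up to
    time 1 it is avoided by [b 0 = 0] and a Lipschitz bound; later it is absorbed through
    [K <= K * t]. *)
Lemma boundary_lower_linear : exists2 C : R, 0 <= C &
  forall t : R, 0 <= t -> - C * t <= b t.
Proof.
have [L L0 bL] := boundary_lipschitz 1.
have [K K0 bK] := boundary_lower_affine ltr01.
exists (L + K + 1); first by rewrite !addr_ge0.
move=> t t0; have [t1|t1] := leP t 1.
  have := bL 0 t (lexx 0) t0 t1; rewrite hb0 !subr0 => bt.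
  have : - b t <= L * t by apply: le_trans bt; rewrite -normrN ler_norm.
  have : 0 <= K * t by exact: mulr_ge0.
  by move=> *; lra.
have := bK t t0; rewrite mul1r => bt.
have : K <= K * t by rewrite ler_peMr// ltW.
have : 0 <= L * t by exact: mulr_ge0.
by move=> *; lra.
Qed.

Lemma hitting_kernel_le (a : R) : 0 < a -> exists2 K : R, 0 <= K &
  forall t : R, 0 <= t -> hitting_kernel b a t <= expR (K - a ^+ 2 / 4 * t).
Proof.
(* A slope [a / 4] costs half of the decay rate [a ^+ 2 / 2] and leaves [a ^+ 2 / 4]. *)
move=> a0; have a40 : 0 < a / 4 by rewrite divr_gt0.
have [K K0 bK] := boundary_lower_affine a40.
exists (a * K); first by rewrite mulr_ge0// ltW.
move=> t t0; rewrite ler_expR.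
have : a * - K <= a * (b t + a / 4 * t) by rewrite ler_pM2l// bK.
by move=> ?; lra.
Qed.

Lemma hitting_kernel_cvg0 (a : R) : 0 < a ->
  hitting_kernel b a n.+1%:R @[n --> \oo] --> 0.
Proof.
move=> a0; have [K K0 kK] := hitting_kernel_le a0.
pose q : R := expR (- (a ^+ 2 / 4)).
have q1 : `|q| < 1.
  rewrite ger0_norm ?expR_ge0// -[ltRHS]expR0 ltr_expR oppr_lt0.
  by rewrite divr_gt0// exprn_gt0.
apply: (@squeeze_cvgr _ _ _ _ (cst 0) (fun n => expR K * q ^+ n.+1)).
- apply: nearW => n; rewrite expR_ge0/=; apply: le_trans (kK _ (ler0n _ _)) _.
  by rewrite /q -expRM_natl -expRD mulrN (mulrC n.+1%:R).
- exact: cvg_cst.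
- rewrite -[X in _ --> X](mulr0 (expR K)); apply: cvgM; first exact: cvg_cst.
  by rewrite (cvg_shiftS (fun n => q ^+ n)); exact: cvg_expr.
Qed.

Variable f : R -> R.
Hypothesis hf : probability_density f.

Lemma hitting_transform_cvg0 : hitting_transform b f n%:R @[n --> \oo] --> 0.
Proof.
have [C C0 bC] := boundary_lower_linear.
have [mf f0 f1] := hf.
pose D : set R := `[0, +oo[%classic.
have mk a : measurable_fun D (fun t => hitting_kernel b a t * f t).
  by apply: measurable_funM => //; exact: measurable_hitting_kernel.
(* The shift by [N > 2 * C] gives [a n * (a n - 2 * C) >= n * n >= n], so the kernel is at most
   [expR (- (t / 2)) ^+ n]. *)
pose N := (Num.truncn (2 * C)).+1; pose a n : R := (n + N)%:R.
have aC n : n%:R <= a n - 2 * C.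
  by rewrite /a natrD lerBrDr lerD2l ltW// truncnS_gt.
have kE n t : 0 <= t -> hitting_kernel b (a n) t <= expR (- (t / 2)) ^+ n.
  move=> t0; rewrite -expRM_natl ler_expR.
  have an : n%:R <= a n by rewrite ler_nat leq_addr.
  have a0 : 0 <= a n by exact: le_trans an.
  have h1 : a n * (- C * t) <= a n * b t by rewrite ler_wpM2l// bC.
  have h2 : n%:R * (n%:R * t) <= a n * ((a n - 2 * C) * t).
    by apply: ler_pM => //; rewrite ?mulr_ge0// ler_wpM2r.
  have h3 : n%:R * t <= n%:R * (n%:R * t).
    case: n {an a0 h1 h2} => [|n]; first by rewrite !mul0r.
    by rewrite ler_wpM2l// ler_peMl// ler1n.
  lra.
(* At [t = 0] the kernel is 1 for every [a]; this point is discarded. *)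
have D0 : (@lebesgue_measure R).-negligible [set 0 : R].
  by apply/negligibleP => //; exact: lebesgue_measure_set1.
have fD := probability_density_integrable hf.
have := @dominated_convergence _ _ _ lebesgue_measure D (measurable_itv _)
  (fun n t => (hitting_kernel b (a n) t * f t)%:E) (cst 0%E) (fun t => (f t)%:E)
  (fun n => (measurable_EFinP _ _).2 (mk (a n))) (measurable_cst _).
move=> /(_ _ fD _) [].
- apply: negligibleS D0 => t /= nt; apply: contrapT => /eqP tn0; apply: nt.
  rewrite /D /= in_itv/= andbT => t0.
  have t_gt0 : 0 < t by rewrite lt_neqAle eq_sym tn0.
  apply: cvg_EFin; first exact: nearW.
  apply: (@squeeze_cvgr _ _ _ _ (cst 0) (fun n => expR (- (t / 2)) ^+ n * f t)).
  + apply: nearW => n; rewrite /= mulr_ge0 ?expR_ge0 ?f0//=.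
    by rewrite ler_wpM2r ?f0// kE.
  + exact: cvg_cst.
  + rewrite -[X in _ --> X](mul0r (f t)); apply: cvgM; last exact: cvg_cst.
    apply: cvg_expr; rewrite ger0_norm ?expR_ge0// -[ltRHS]expR0 ltr_expR oppr_lt0.
    by rewrite divr_gt0.
- apply: aeW => t n; rewrite /D /= in_itv/= andbT => t0.
  rewrite lee_fin ger0_norm; last by rewrite mulr_ge0 ?expR_ge0 ?f0.
  rewrite ler_piMl ?f0//; apply: le_trans (kE n t t0) _.
  rewrite exprn_ile1 ?expR_ge0// -[leRHS]expR0 ler_expR oppr_le0.
  by rewrite divr_ge0.
move=> _ _; rewrite integral0 => /fine_cvg h.
rewrite -(@cvg_shiftn N _ (fun n : nat => hitting_transform b f n%:R)); exact: h.
Qed.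

End boundary.

(** * Bernstein's theorem *)

Section finite_differences.
Context (R : realType).
Implicit Types (h x : R) (r : R -> R) (G : nat -> R -> R) (w : nat -> nat -> R).

Definition decrement h r x : R := r x - r (x + h).

(** [G n] stands for the n-th derivative with its alternating sign absorbed, a form stable under
    [decrement], which allows iteration. *)
Definition alternating_derivatives G : Prop := forall n x, 0 < x ->
  is_derive x 1 (G n) (- G n.+1 x) /\ 0 <= G n x.

(** By the mean value theorem the decrement of [G n] is [h] times a value of [G n.+1]. *)
Lemma alternating_derivatives_decrement h G : 0 < h ->
  alternating_derivatives G -> alternating_derivatives (fun n => decrement h (G n)).
Proof.
move=> h0 HG n x x0; have xh0 : 0 < x + h by rewrite addr_gt0.
split.
  have [d1 _] := HG n x x0; have [d2 _] := HG n _ xh0.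
  have d3 : is_derive x 1 (fun y => y + h) 1.
    by apply: is_derive_eq; rewrite addr0.
  have d4 : is_derive x 1 (G n \o (fun y => y + h)) (- G n.+1 (x + h)).
    by rewrite -[X in is_derive _ _ _ X]mulr1; exact: is_derive1_comp.
  suff -> : - decrement h (G n.+1) x = - G n.+1 x - - G n.+1 (x + h).
    exact: is_deriveB d1 d4.
  by rewrite /decrement opprD.
rewrite subr_ge0.
have dG y : y \in `]x, (x + h)[ -> is_derive y 1 (G n) (- G n.+1 y).
  rewrite in_itv/= => /andP[xy _].
  by have [] := HG n y (lt_trans x0 xy).
have cG : {within `[x, (x + h)], continuous (G n)}.
  apply: derivable_within_continuous => y.
  rewrite in_itv/= => /andP[xy _].
  by have [[]] := HG n y (lt_le_trans x0 xy).
have [|c] := @MVT R (G n) (fun y => - G n.+1 y) x (x + h) _ dG cG.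
  by rewrite ltrDl.
rewrite in_itv/= => /andP[xc _] /eqP; rewrite subr_eq => /eqP ->.
rewrite addrC gerDl addrAC subrr add0r mulNr oppr_le0 mulr_ge0 ?(ltW h0)//.
by have [] := HG n.+1 c (lt_trans x0 xc).
Qed.

Lemma iter_decrement_ge0 h G l x : 0 < h -> 0 < x -> alternating_derivatives G ->
  0 <= iter l (decrement h) (G 0%N) x.
Proof.
move=> h0 x0; elim: l G => [|l IH] G HG; first by have [] := HG 0%N x x0.
by rewrite iterSr; exact: (IH _ (alternating_derivatives_decrement h0 HG)).
Qed.

Lemma completely_monotone_alternating r : completely_monotone r ->
  alternating_derivatives (fun n x => (-1) ^+ n * derive1n n r x).
Proof.
move=> [_ _ dr sr] n x x0; split; last exact: sr.
have -> : - ((-1) ^+ n.+1 * derive1n n.+1 r x) = (-1) ^+ n *: derive1 (derive1n n r) x.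
  by rewrite derive1nS exprS mulN1r mulNr opprK.
have d1 : is_derive x 1 (derive1n n r) (derive1 (derive1n n r) x).
  by rewrite derive1E; apply/derivableP; exact: dr.
exact: is_deriveZ.
Qed.

(** The derivatives give the sign at positive points; continuity of [r] carries it to [x = 0] along
    [x + 1 / (n + 1)]. *)
Lemma completely_monotone_decrement_ge0 h r l x : 0 < h -> 0 <= x ->
  completely_monotone r -> 0 <= iter l (decrement h) r x.
Proof.
move=> h0 x0 hr.
have pos y : 0 < y -> 0 <= iter l (decrement h) r y.
  move=> y0; have := iter_decrement_ge0 l h0 y0 (completely_monotone_alternating hr).
  by under [X in iter _ _ X]funext do rewrite expr0 mul1r derive1n0.
have cvgr y : 0 <= y -> (fun n => iter l (decrement h) r (y + n.+1%:R^-1)) @ \oo -->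
    iter l (decrement h) r y.
  elim: l {pos} y => [|l IH] y y0 /=.
    case: hr => _ cr _ _.
    apply: (within_continuous_cvg cr).
    - by rewrite /= in_itv/= andbT.
    - by move=> n; rewrite /= in_itv/= andbT addr_ge0.
    - rewrite -[X in _ --> X]addr0; apply: cvgD; [exact: cvg_cst|exact: cvg_harmonic].
  apply: cvgB; first exact: IH.
  under eq_fun do rewrite addrAC.
  by apply: IH; rewrite addr_ge0 ?(ltW h0).
apply: (cvgr_to_ge (cvgr x x0)).
by apply: nearW => n; apply: pos; rewrite ltr_wpDl.
Qed.

End finite_differences.

(* Hausdorff's moment problem for the sequence [w j 0]: the weights at k / n have
   exact falling factorial moments, hence approximate moments. *)
Section finite_moments.
Context (R : realType) (w : nat -> nat -> R).
Hypothesis w_ge0 : forall k l, 0 <= w k l.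
Hypothesis w_rec : forall k l, w k l = w k.+1 l + w k l.+1.
Hypothesis w00 : w 0 0 = 1.

(** [w k l] plays the role of the integral of [y ^ k (1 - y) ^ l], and the identity that of
    inserting the expansion of [1 = (y + (1 - y)) ^ N]; the induction is Pascal's rule. *)
Lemma binomial_decomposition N k l :
  w k l = \sum_(i < N.+1) 'C(N, i)%:R * w (k + i) (l + (N - i)).
Proof.
elim: N k l => [|N IH] k l.
  by rewrite big_ord_recl big_ord0 !addn0 mul1r addr0.
have e1 : w k.+1 l = \sum_(i < N) 'C(N, i)%:R * w (k.+1 + i) (l + (N - i)) + w (k + N.+1) l.
  by rewrite (IH k.+1 l) big_ord_recr/= binn mul1r subnn addn0 addSnnS.
have e2 : w k l.+1 = w k (l + N.+1) +
    \sum_(i < N) 'C(N, i.+1)%:R * w (k + i.+1) (l.+1 + (N - i.+1)).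
  rewrite (IH k l.+1) big_ord_recl/= bin0 mul1r addn0 subn0 addSnnS.
  by congr (_ + _); apply: eq_bigr => i _; rewrite /bump/= add1n.
have -> : \sum_(i < N.+2) 'C(N.+1, i)%:R * w (k + i) (l + (N.+1 - i)) =
    w k (l + N.+1) + (\sum_(i < N) 'C(N, i.+1)%:R * w (k + i.+1) (l.+1 + (N - i.+1)) +
    \sum_(i < N) 'C(N, i)%:R * w (k.+1 + i) (l + (N - i)) + w (k + N.+1) l).
  rewrite big_ord_recl big_ord_recr/= bin0 mul1r addn0 subn0.
  rewrite /bump/= add1n binn mul1r subnn addn0.
  rewrite -big_split/=; congr (_ + (_ + _)); apply: eq_bigr => i _.
  rewrite add1n binS natrD mulrDl subSS addnS addSn; congr (_ * w _ _ + _).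
  by rewrite -addnS subnSK.
by rewrite w_rec e1 e2; ring.
Qed.

Definition finite_weight n k : R := 'C(n, k)%:R * w k (n - k).

Lemma finite_weight_ge0 n k : 0 <= finite_weight n k.
Proof. by rewrite mulr_ge0. Qed.

Lemma sum_finite_weight n : \sum_(k < n.+1) finite_weight n k = 1.
Proof. by rewrite -w00 (binomial_decomposition n 0 0). Qed.

(** As ['C(n, k) * k ^_ j] equals [n ^_ j * 'C(n - j, k - j)], the sum is the binomial decomposition
    of [w j 0] in [n - j] steps; the terms with [k < j] vanish. *)
Lemma falling_moment n j : (j <= n)%N ->
  \sum_(k < n.+1) finite_weight n k * (k ^_ j)%:R = (n ^_ j)%:R * w j 0.
Proof.
move=> jn; rewrite (binomial_decomposition (n - j) j 0) big_distrr/=.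
rewrite -(big_mkord xpredT (fun k => finite_weight n k * (k ^_ j)%:R)).
rewrite (big_cat_nat _ _ (n := j))//=; last exact: leqW.
rewrite big_nat big1 ?add0r; last first.
  by move=> i /andP[_ ij]; rewrite ffact_small// mulr0.
rewrite -{1}[j]add0n big_addn/= big_mkord subSn//.
apply: eq_bigr => i _; have ij : (i + j <= n)%N.
  by rewrite addnC -leq_subRL// -ltnS.
have -> : (n ^_ j)%:R * ('C(n - j, i)%:R * w (j + i) (0 + (n - j - i))) =
   (n ^_ j * 'C(n - j, i))%:R * w (i + j) (n - (i + j)) :> R.
  by rewrite natrM mulrA add0n -subnDA [(i + j)%N]addnC.
rewrite /finite_weight mulrAC -natrM; congr (_%:R * _).
apply/eqP; rewrite -(eqn_pmul2r (fact_gt0 i)) -(eqn_pmul2r (fact_gt0 (n - (i + j)))).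
have e1 : ((i + j) ^_ j * i`! = (i + j)`!)%N.
  by rewrite -(@ffact_fact (i + j) j) ?leq_addl// addnK.
have e2 : ('C(n - j, i) * i`! * (n - (i + j))`! = (n - j)`!)%N.
  rewrite bin_ffact [(i + j)%N]addnC subnDA ffact_fact//.
  by rewrite leq_subRL// addnC.
by rewrite -!mulnA (mulnA (_ ^_ j)) e1 bin_fact// (mulnA 'C(_, _)) e2 ffact_fact.
Qed.

(** The quotient of falling factorials is the product of the ratios [(k - i) / (n - i)] for [i < j].
    Each is close to [k / n] and all lie between 0 and 1, so the errors add up. *)
Lemma power_falling_gap n k j J : (k <= n)%N -> (j <= J)%N -> (J < n)%N ->
  `|(k%:R / n%:R) ^+ j - (k ^_ j)%:R / (n ^_ j)%:R| <= j%:R * (J%:R / (n - J)%:R) :> R.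
Proof.
move=> kn + Jn; have n0 : (0 < n)%N by exact: leq_ltn_trans Jn.
have nJ0 : (0 < (n - J)%:R :> R) by rewrite ltr0n subn_gt0.
elim: j => [|j IH] jJ; first by rewrite expr0 !ffactn0 divr1 subrr normr0 mul0r.
set e := J%:R / (n - J)%:R; have e0 : 0 <= e by rewrite divr_ge0.
set x := k%:R / n%:R; set y := (k ^_ j)%:R / (n ^_ j)%:R : R.
have x0 : 0 <= x by rewrite divr_ge0.
have x1 : x <= 1 by rewrite ler_pdivrMr ?ltr0n// mul1r ler_nat.
have {}IH : `|x ^+ j - y| <= j%:R * e by apply: IH; exact: ltnW.
have jn : (j < n)%N := leq_trans jJ (ltnW Jn).
have nj0 : 0 < (n - j)%:R :> R by rewrite ltr0n subn_gt0.
have y0 : 0 <= y by rewrite divr_ge0.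
have y1 : y <= 1.
  rewrite ler_pdivrMr ?ltr0n ?ffact_gt0 ?(ltnW jn)// mul1r ler_nat.
  elim: j {jJ jn nj0 y y0 IH} => // j IH; rewrite !ffactnSr.
  by rewrite leq_mul// leq_sub2r.
set v := (k - j)%:R / (n - j)%:R : R.
have -> : (k ^_ j.+1)%:R / (n ^_ j.+1)%:R = y * v.
  by rewrite !ffactnSr !natrM invfM mulrACA.
have v0 : 0 <= v by rewrite divr_ge0.
(* For [k < j] the subtraction in [v] is truncated, but then [y] is 0. *)
have [kj|jk] := ltnP k j.
  have -> : y = 0 by rewrite /y ffact_small// mul0r.
  rewrite mul0r subr0 ger0_norm ?exprn_ge0// exprS.
  apply: (@le_trans _ _ (x ^+ j)); first by rewrite ler_piMl// exprn_ge0.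
  move: IH; rewrite {1}/y ffact_small// mul0r subr0 ger0_norm ?exprn_ge0// => IH.
  by apply: le_trans IH _; rewrite ler_wpM2r// ler_nat.
have xv : `|x - v| <= e.
  have n0R : 0 < n%:R :> R by rewrite ltr0n.
  have -> : x - v = j%:R * (n - k)%:R / n%:R / (n - j)%:R.
    rewrite /x /v !natrB// ?(ltnW jn)//.
    field; move: nj0; rewrite natrB ?(ltnW jn)// => nj0.
    by rewrite !gt_eqF.
  rewrite ger0_norm ?divr_ge0 ?mulr_ge0// /e.
  apply: ler_pM; rewrite ?invr_ge0// ?divr_ge0 ?mulr_ge0//.
    rewrite ler_pdivrMr//; apply: ler_pM => //; rewrite ler_nat ?(ltnW jJ)//.
    exact: leq_subr.
  by rewrite lef_pV2 ?posrE// ler_nat leq_sub2l// ltnW.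
have -> : x ^+ j.+1 - y * v = (x ^+ j - y) * x + y * (x - v) by rewrite exprSr; ring.
have -> : j.+1%:R * e = j%:R * e + e by rewrite -natr1 mulrDl mul1r.
rewrite (le_trans (ler_normD _ _))// lerD//.
  by rewrite normrM (ger0_norm x0) (le_trans _ IH)// ler_piMr.
by rewrite normrM (ger0_norm y0) (le_trans _ xv)// ler_piMl.
Qed.

Lemma finite_moment_gap n j J : (j <= J)%N -> (J < n)%N ->
  `|\sum_(k < n.+1) finite_weight n k * (k%:R / n%:R) ^+ j - w j 0|
    <= j%:R * (J%:R / (n - J)%:R).
Proof.
move=> jJ Jn; have jn : (j <= n)%N by rewrite (leq_trans jJ)// ltnW.
have nj0 : (n ^_ j)%:R != 0 :> R by rewrite pnatr_eq0 -lt0n ffact_gt0.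
have -> : w j 0 = \sum_(k < n.+1) finite_weight n k * ((k ^_ j)%:R / (n ^_ j)%:R).
  under eq_bigr do rewrite mulrA.
  by rewrite -mulr_suml falling_moment// mulrAC divff// mul1r.
rewrite -sumrB (le_trans (ler_norm_sum _ _ _))//.
rewrite -[leRHS]mul1r -[X in _ <= X * _](sum_finite_weight n) mulr_suml ler_sum// => k _.
rewrite -mulrBr normrM ger0_norm ?finite_weight_ge0// ler_wpM2l ?finite_weight_ge0//.
by apply: power_falling_gap => //; rewrite -ltnS.
Qed.

End finite_moments.

Section quantile.
Context (R : realType).
Local Notation mu := (@lebesgue_measure R).
Implicit Types (u : R) (p : nat -> R).

(** Generalized inverse of the distribution function of the weights [p], written as a count of
    partial sums so that monotonicity in [u] is immediate. *)
Definition quantile_index n p u : nat :=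
  (\sum_(k < n) ((\sum_(i < k.+1) p i)%R <= u)%R)%N.

Lemma quantile_index_le n p : {homo quantile_index n p : u v / u <= v >-> (u <= v)%N}.
Proof.
move=> u v uv; apply: leq_sum => k _.
by case: (leP _ u) => //= pu; rewrite (le_trans pu uv).
Qed.

Lemma quantile_index_bound n p u : (quantile_index n p u <= n)%N.
Proof.
apply: (@leq_trans (\sum_(k < n) 1%N)%N); last by rewrite sum1_card card_ord.
by apply: leq_sum => k _; exact: leq_b1.
Qed.

Lemma quantile_indexE n p k u : (forall i, 0 <= p i) -> (k <= n)%N ->
  \sum_(i < k) p i <= u -> u < \sum_(i < k.+1) p i -> quantile_index n p u = k.
Proof.
move=> p0 kn ku uk.
have mono i j : (i <= j)%N -> \sum_(l < i) p l <= \sum_(l < j) p l.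
  move=> ij; rewrite -(subnKC ij) big_split_ord/= lerDl sumr_ge0//.
rewrite /quantile_index -(big_mkord xpredT (fun i => nat_of_bool ((\sum_(l < i.+1) p l)%R <= u)%R)).
rewrite (big_cat_nat _ _ (n := k))//= [X in (_ + X)%N]big1_seq ?addn0; last first.
  move=> i; rewrite mem_index_iota => /andP[_ /andP[ki _]].
  by rewrite leNgt (lt_le_trans uk)// mono.
rewrite big_mkord (eq_bigr (fun=> 1%N)) ?sum1_card ?card_ord// => i _.
by rewrite (le_trans _ ku)// mono.
Qed.

(** The index is [k] on an interval of length [p k], and these intervals tile [[0, 1[]. *)
Lemma integral_quantile n p (G : nat -> R) : (forall i, 0 <= p i) ->
  (forall i, 0 <= G i) -> \sum_(k < n.+1) p k = 1 ->
  (\int[mu]_(u in `[0%R, 1%R[) (G (quantile_index n p u))%:E =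
    (\sum_(k < n.+1) p k * G k)%:E)%E.
Proof.
move=> p0 G0 p1.
have mG (D : set R) : measurable D ->
    measurable_fun D (fun u => (G (quantile_index n p u))%:E).
  move=> mD; apply/measurable_EFinP; apply: (measurable_funS measurableT) => //.
  apply: (@measurableT_comp _ _ _ _ _ _ G) => //.
  (* The index is cast to [R], where monotone functions are measurable; a set of naturals becomes a
     countable, hence Borel, set. *)
  have mK : measurable_fun setT ((fun k : nat => k%:R : R) \o quantile_index n p).
    apply: nondecreasing_measurable => // u v uv /=.
    by rewrite ler_nat quantile_index_le.
  move=> _ B _; rewrite setTI.
  have -> : quantile_index n p @^-1` B =
      ((fun k : nat => k%:R : R) \o quantile_index n p) @^-1` [set k%:R | k in B].
    apply/seteqP; split => u /=; first by move=> Bu; exists (quantile_index n p u).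
    by move=> [k Bk /eqP]; rewrite eqr_nat => /eqP <-.
  rewrite -[X in measurable X]setTI; apply: mK => //.
  apply: (@countable_measurable _ (measurableTypeR R)); [by move=> r; exact: measurable_set1|].
  by apply: (sub_countable (card_image_le _ _)); exact: countableP.
pose S (k : nat) : R := \sum_(i < k) p i.
have SS k : S k.+1 = S k + p k by rewrite /S big_ord_recr.
have step N : (N <= n.+1)%N ->
  (\int[mu]_(u in [set` `[0%R, S N[]) (G (quantile_index n p u))%:E =
    (\sum_(k < N) p k * G k)%:E)%E.
  elim: N => [_|N IH Nn]; first by rewrite /S !big_ord0 set_itvco0 integral_set0.
  have s0 : 0 <= S N by rewrite /S sumr_ge0.
  have s1 : S N <= S N.+1 by rewrite SS lerDl.
  have -> : [set` `[0%R, S N.+1[] =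
      [set` `[0%R, S N[] `|` [set` `[S N, S N.+1[].
    by rewrite -itv_bndbnd_setU// bnd_simp.
  rewrite ge0_integral_setU//=; first last.
  - apply/disj_set2P; rewrite -subset0 => u [] /=; rewrite !in_itv/=.
    by move=> /andP[_ a1] /andP[a2 _]; move: (le_lt_trans a2 a1); rewrite ltxx.
  - by move=> u _; rewrite lee_fin.
  - by apply: mG; apply: measurableU.
  rewrite IH ?(ltnW Nn)// big_ord_recr/= EFinD; congr (_ + _)%E.
  rewrite (eq_integral (cst (G N)%:E)); last first.
    move=> u; rewrite inE /= in_itv/= => /andP[u1 u2].
    by rewrite (quantile_indexE p0 _ u1 u2).
  rewrite integral_cst//= lebesgue_measure_itv/= lte_fin.
  case: ltP => [_|]; last first.
    by rewrite SS gerDl => pN; rewrite (@le_anti _ _ (p N) 0) ?pN ?p0// mul0r mule0.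
  by rewrite -EFinB -EFinM SS addrAC subrr add0r mulrC.
by rewrite -[1%R in LHS]p1 -/(S n.+1) step.
Qed.

(* The error bound does not depend on g, so pointwise limits of monotone functions
   along an ultrafilter pass to the integral, where dominated convergence is not
   available. *)
Lemma quantile_riemann_sum (g : R -> R) N : (0 < N)%N -> {homo g : u v / u <= v} ->
  (forall u, 0 <= g u <= 1) ->
  `|fine (\int[mu]_(u in `[0%R, 1%R[) (g u)%:E)%E - N%:R^-1 * \sum_(i < N) g (i%:R / N%:R)|
    <= N%:R^-1.
Proof.
move=> N0 gm g01; have NR0 : 0 < N%:R :> R by rewrite ltr0n.
have mg (D : set R) : measurable D -> measurable_fun D (fun u => (g u)%:E).
  move=> mD; apply/measurable_EFinP; apply: (measurable_funS measurableT) => //.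
  exact: nondecreasing_measurable.
have g0 u : 0 <= g u by have /andP[] := g01 u.
pose q (k : nat) : R := k%:R / N%:R.
have qS k : q k.+1 = q k + N%:R^-1 by rewrite /q -natr1 mulrDl mul1r.
pose I a c := (\int[mu]_(u in [set` `[a, c[]) (g u)%:E)%E.
have Ile k : ((N%:R^-1 * g (q k))%:E <= I (q k) (q k.+1) <=
    (N%:R^-1 * g (q k.+1))%:E)%E.
  have len : mu [set` `[q k, q k.+1[] = (N%:R^-1)%:E.
    rewrite lebesgue_measure_itv/= lte_fin qS ltrDl invr_gt0 NR0.
    by rewrite -EFinB addrAC subrr add0r.
  have cstE c : (\int[mu]_(u in [set` `[q k, q k.+1[]) c%:E =
      (N%:R^-1 * c)%:E)%E by rewrite integral_cst// [X in (_ * X)%E]len -EFinM mulrC.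
  rewrite -!cstE; apply/andP; split; apply: ge0_le_integral => //.
  - by move=> u _; rewrite lee_fin.
  - exact: mg.
  - by move=> u; rewrite /= in_itv/= => /andP[ku _]; rewrite lee_fin gm.
  - by move=> u _; rewrite lee_fin.
  - exact: mg.
  - by move=> u; rewrite /= in_itv/= => /andP[_ uk]; rewrite lee_fin gm// ltW.
(* Lower and upper Riemann sums differ by the mesh times the telescoped increment [g (q k) - g 0],
   which is at most 1. *)
have Isum k : ((N%:R^-1 * \sum_(i < k) g (q i))%:E <= I 0%R (q k) <=
    (N%:R^-1 * (\sum_(i < k) g (q i) + (g (q k) - g 0)))%:E)%E.
  elim: k => [|k /andP[IH1 IH2]].
    by rewrite /I /q mul0r big_ord0 set_itvco0 integral_set0 subrr addr0 mulr0 !lexx.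
  have -> : I 0%R (q k.+1) = (I 0%R (q k) + I (q k) (q k.+1))%E.
    rewrite /I; have -> : [set` `[0%R, q k.+1[] =
      [set` `[0%R, q k[] `|` [set` `[q k, q k.+1[] :> set R.
      rewrite -itv_bndbnd_setU// bnd_simp ?divr_ge0//.
      by rewrite qS lerDl invr_ge0.
    rewrite ge0_integral_setU//=; first last.
    - apply/disj_set2P; rewrite -subset0 => u [] /=; rewrite !in_itv/=.
      by move=> /andP[_ a1] /andP[a2 _]; move: (le_lt_trans a2 a1); rewrite ltxx.
    - by move=> u _; rewrite lee_fin.
    - by apply: mg; apply: measurableU.
  have /andP[J1 J2] := Ile k.
  apply/andP; split.
    by rewrite big_ord_recr/= mulrDr EFinD leeD.
  apply: le_trans (leeD IH2 J2) _.
  by rewrite -EFinD lee_fin -mulrDr big_ord_recr/= ler_wpM2l ?invr_ge0//; lra.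
have qN : q N = 1 by rewrite /q divff// gt_eqF.
have := Isum N; rewrite qN => /andP[].
rewrite -/(I 0%R 1%R); have : (0 <= I 0%R 1%R)%E by apply: integral_ge0 => u _; rewrite lee_fin.
case: (I 0%R 1%R) => [v| |]//= _; rewrite !lee_fin => h1 h2.
have -> : \sum_(i < N) g (i%:R / N%:R) = \sum_(i < N) g (q i) by [].
rewrite ger0_norm ?subr_ge0// lerBlDl (le_trans h2)// mulrDr lerD2l.
rewrite -[leRHS]mulr1 ler_wpM2l ?invr_ge0// lerBlDl.
by have /andP[_ h] := g01 1; rewrite (le_trans h)// lerDr.
Qed.

End quantile.

Section bernstein.
Context (R : realType) (r : R -> R).
Local Notation mu := (@lebesgue_measure R).
Hypotheses (hr : completely_monotone r) (r0 : r 0 = 1).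

Lemma approximating_quantile m : exists phi : R -> R,
  [/\ {homo phi : u v / u <= v}, forall u, 0 <= phi u <= 1 &
    forall j, (j <= m.+1 * m.+1)%N ->
      `|fine (\int[mu]_(u in `[0%R, 1%R[) (phi u `^ (j%:R / m.+1%:R))%:E)%E -
        r (j%:R / m.+1%:R)| <= m.+1%:R^-1].
Proof.
set M := m.+1; pose h : R := M%:R^-1; have h0 : 0 < h by rewrite invr_gt0 ltr0n.
pose J := (M * M)%N; pose n := (J + J * J * M)%N.
have J0 : (0 < J)%N by rewrite muln_gt0.
have Jn : (J < n)%N by rewrite /n -[X in (X < _)%N]addn0 ltn_add2l !muln_gt0.
have n0 : 0 < n%:R :> R by rewrite ltr0n; exact: leq_ltn_trans Jn.
pose w k l := iter l (decrement h) r (k%:R * h).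
have w0 k l : 0 <= w k l.
  by apply: completely_monotone_decrement_ge0 => //; rewrite mulr_ge0// ltW.
have wrec k l : w k l = w k.+1 l + w k l.+1.
  by rewrite /w /= /decrement -natr1 mulrDl mul1r addrC subrK.
have w00 : w 0 0 = 1 by rewrite /w /= mul0r.
pose K := quantile_index n (finite_weight w n).
have Kn u : 0 <= (K u)%:R / n%:R :> R by rewrite divr_ge0.
(* The points [k / n] model values of exp (- X / M), the variable whose j-th moment is [r (j / M)];
   the power [M] converts them into values of exp (- X). *)
exists (fun u => ((K u)%:R / n%:R) ^+ M); split.
- move=> u v uv; apply: lerXn2r; rewrite ?nnegrE ?Kn//.
  by rewrite ler_pM2r ?invr_gt0// ler_nat quantile_index_le.
- move=> u; rewrite exprn_ge0//= exprn_ile1//.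
  by rewrite ler_pdivrMr// mul1r ler_nat quantile_index_bound.
- move=> j jJ.
  have -> : (\int[mu]_(u in `[0%R, 1%R[) ((((K u)%:R / n%:R) ^+ M) `^ (j%:R / M%:R))%:E =
      (\sum_(k < n.+1) finite_weight w n k * (k%:R / n%:R) ^+ j)%:E)%E.
    rewrite -(integral_quantile (G := fun k => (k%:R / n%:R) ^+ j)); last first.
    + exact: sum_finite_weight.
    + by move=> k; rewrite exprn_ge0// divr_ge0.
    + by move=> k; exact: finite_weight_ge0.
    apply: eq_integral => u _.
    rewrite -powR_mulrn// -powRrM mulrCA divff ?mulr1 ?powR_mulrn//.
    by rewrite pnatr_eq0.
  have -> : r (j%:R / M%:R) = w j 0 by [].
  rewrite /= (le_trans (finite_moment_gap w0 wrec w00 jJ Jn))//.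
  rewrite /n addnC addnK mulrA -natrM ler_pdivrMr ?ltr0n ?muln_gt0 ?J0//.
  rewrite ler_pdivlMl ?ltr0n// -natrM ler_nat [X in (_ <= X)%N]mulnC leq_mul2l/=.
  by rewrite leq_mul2r jJ orbT.
Qed.

Lemma powR_halfline_continuous (a : R) : 0 < a -> {within `[0, +oo[, continuous (@powR R ^~ a)}.
Proof.
move=> a0; apply/continuous_within_itvcyP; split; last first.
  by rewrite powR0 ?gt_eqF//; exact: powR_cvg0.
move=> x; rewrite in_itv/= andbT => x0; apply: differentiable_continuous.
by apply/derivable1_diffP; apply: derivable_powR; rewrite in_itv/= x0.
Qed.

Lemma ge0_ger_powR (y a c : R) : 0 <= y <= 1 -> 0 <= a -> a <= c -> y `^ c <= y `^ a.
Proof.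
move=> /andP[]; rewrite le_eqVlt => /predU1P[<- _ a0 ac|y0 y1 _ ac]; last first.
  by apply: ger_powR => //; rewrite y0.
have [->|an0] := eqVneq a 0.
  by rewrite powRr0; case: (eqVneq c 0) => [->|cn0]; rewrite ?powRr0 ?powR0.
by rewrite !powR0// gt_eqF// (lt_le_trans _ ac)// lt_neqAle eq_sym an0.
Qed.

Lemma ultrafilter_cvg_itv (I : Type) (U : set_system I) (f : I -> R) :
  UltraFilter U -> (forall i, 0 <= f i <= 1) ->
  exists2 l : R, 0 <= l <= 1 & f @ U --> l.
Proof.
move=> UU f01.
have FU : ProperFilter (f @ U) by exact: fmap_proper_filter.
have := @segment_compact R 0 1 (f @ U) FU.
case=> [|l []]; first by apply: nearW => i; rewrite /= in_itv/= f01.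
rewrite /= in_itv/= => l01 cl; exists l => // B lB.
have [//|UB] := in_ultra_setVsetC (f @^-1` B) UU.
by have [x [/= xB]] := cl (~` B) B UB lB.
Qed.

(* Along an ultrafilter the approximating quantile functions converge everywhere,
   which replaces Helly's selection theorem. *)
Lemma quantile_laplace : exists phi : R -> R,
  [/\ {homo phi : u v / u <= v}, forall u, 0 <= phi u <= 1 &
    forall a, 0 < a ->
      (\int[mu]_(u in `[0%R, 1%R[) (phi u `^ a)%:E = (r a)%:E)%E].
Proof.
have [phi_ phiP] := choice approximating_quantile.
have phi_m m : {homo phi_ m : u v / u <= v} by have [] := phiP m.
have phi_01 m u : 0 <= phi_ m u <= 1 by have [_ + _] := phiP m.
have phi_e m j : (j <= m.+1 * m.+1)%N -> `|fine (\int[mu]_(u in `[0%R, 1%R[)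
    (phi_ m u `^ (j%:R / m.+1%:R))%:E)%E - r (j%:R / m.+1%:R)| <= m.+1%:R^-1.
  by have [_ _] := phiP m; exact.
pose I (phi : R -> R) (a : R) := fine (\int[mu]_(u in `[0%R, 1%R[) (phi u `^ a)%:E)%E.
have pow01 (y a : R) : 0 <= y <= 1 -> 0 <= a -> 0 <= y `^ a <= 1.
  by move=> y01 a0; have := ge0_ger_powR y01 (lexx 0) a0; rewrite powRr0 powR_ge0.
have mpow (phi : R -> R) (a : R) : {homo phi : u v / u <= v} ->
    measurable_fun (`[0%R, 1%R[ : set R) (fun u => (phi u `^ a)%:E).
  move=> hphi; apply/measurable_EFinP; apply: measurable_funTS.
  apply: (measurableT_comp (measurable_powR a)).
  exact: nondecreasing_measurable.
have Ifin (phi : R -> R) (a : R) : {homo phi : u v / u <= v} -> (forall u, 0 <= phi u <= 1) -> 0 <= a ->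
    (\int[mu]_(u in `[0%R, 1%R[) (phi u `^ a)%:E = (I phi a)%:E)%E.
  move=> hphi phi01 a0; rewrite /I fineK// ge0_fin_numE; last first.
    by apply: integral_ge0 => u _; rewrite lee_fin powR_ge0.
  apply: (@le_lt_trans _ _ (\int[mu]_(u in `[0%R, 1%R[) 1)%E); last first.
    by rewrite integral_cst//= lebesgue_measure_itv/= lte_fin ltr01 mul1e ltry.
  apply: ge0_le_integral => //.
  - by move=> u _; rewrite lee_fin powR_ge0.
  - exact: mpow.
  - by move=> u _; rewrite lee_fin; have /andP[] := pow01 _ a (phi01 u) a0.
have Imono (phi : R -> R) (a c : R) : {homo phi : u v / u <= v} -> (forall u, 0 <= phi u <= 1) -> 0 <= a ->
    a <= c -> I phi c <= I phi a.
  move=> hphi phi01 a0 ac; rewrite -lee_fin -!Ifin// ?(le_trans a0 ac)//.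
  apply: ge0_le_integral => //.
  - by move=> u _; rewrite lee_fin powR_ge0.
  - exact: mpow.
  - exact: mpow.
  - by move=> u _; rewrite lee_fin ge0_ger_powR.
have cr : continuous_on_halfline r by case: hr.
(* The integrals are controlled at multiples of [1 / m.+1] only; monotonicity in the exponent
   encloses [a] between two consecutive multiples, and continuity of [r] closes the gap. *)
have Icvg (a : R) : 0 < a -> I (phi_ m) a @[m --> \oo] --> r a.
  move=> a0.
  pose j m := Num.truncn (a * m.+1%:R).
  have am0 m : 0 <= a * m.+1%:R by rewrite mulr_ge0// ltW.
  have j1 m : (j m)%:R / m.+1%:R <= a.
    by rewrite ler_pdivrMr// truncn_le.
  have j2 m : a <= (j m).+1%:R / m.+1%:R.
    by rewrite ler_pdivlMr// ltW// truncnS_gt.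
  have cj2 : (j m).+1%:R / m.+1%:R @[m --> \oo] --> a.
    apply: (@squeeze_cvgr _ _ _ _ (cst a) (fun m => a + m.+1%:R^-1)).
    - apply: nearW => m; rewrite j2/= -natr1 mulrDl mul1r lerD2r; exact: j1.
    - exact: cvg_cst.
    - by rewrite -[X in _ --> X]addr0; apply: cvgD; [exact: cvg_cst|exact: cvg_harmonic].
  have cj1 : (j m)%:R / m.+1%:R @[m --> \oo] --> a.
    have -> : (fun m => (j m)%:R / m.+1%:R) =
        (fun m => (j m).+1%:R / m.+1%:R - m.+1%:R^-1) :> (nat -> R).
      by apply/funext => m; rewrite -[(j m).+1%:R]natr1 mulrDl mul1r addrK.
    rewrite -[X in _ --> X]subr0.
    by apply: cvgB cj2 _; exact: cvg_harmonic.
  have cvr u : (forall m : nat, 0 <= u m) -> u m @[m --> \oo] --> a -> r (u m) @[m --> \oo] --> r a.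
    move=> u0; apply: (within_continuous_cvg cr); first by rewrite /= in_itv/= andbT ltW.
    by move=> m; rewrite /= in_itv/= andbT.
  have jM : \forall m \near \oo, ((j m).+1 <= m.+1 * m.+1)%N.
    near=> m; rewrite -(ler_nat R) -natr1 natrM.
    apply: (@le_trans _ _ (a * m.+1%:R + m.+1%:R)).
      by rewrite lerD ?ler1n// truncn_le.
    rewrite -[X in _ + X]mul1r -mulrDl ler_wpM2r//.
    rewrite -[m.+1%:R]natr1 lerD2r.
    near: m; exact: nbhs_infty_ger.
  apply: (@squeeze_cvgr _ _ _ _ (fun m => r ((j m).+1%:R / m.+1%:R) - m.+1%:R^-1)
      (fun m => r ((j m)%:R / m.+1%:R) + m.+1%:R^-1)).
  - near=> m; have jm : ((j m).+1 <= m.+1 * m.+1)%N by near: m.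
    have := phi_e m _ jm; have := phi_e m _ (ltnW jm).
    rewrite -!/(I _ _) !ler_norml => /andP[_ h1] /andP[h2 _].
    apply/andP; split.
      apply: le_trans (Imono _ _ _ (phi_m m) (phi_01 m) (ltW a0) (j2 m)).
      by rewrite addrC -lerBrDr.
    have := Imono (phi_ m) _ _ (phi_m m) (phi_01 m) _ (j1 m).
    rewrite divr_ge0// => /(_ isT) h; rewrite (le_trans h)//.
    by rewrite addrC -lerBlDr.
  - rewrite -[X in _ --> X]subr0; apply: cvgB; last exact: cvg_harmonic.
    by apply: cvr => // m; rewrite divr_ge0.
  - rewrite -[X in _ --> X]addr0; apply: cvgD; last exact: cvg_harmonic.
    by apply: cvr => // m; rewrite divr_ge0.
have [U [UU oU]] := @ultraFilterLemma nat \oo _.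
have PU : ProperFilter U by case: UU.
have /choice[phi phiU] u : exists l : R, 0 <= l <= 1 /\ phi_ m u @[m --> U] --> l.
  by have [l] := ultrafilter_cvg_itv UU (phi_01^~ u); exists l.
have phi01 u : 0 <= phi u <= 1 by have [] := phiU u.
have phi_cvg u : phi_ m u @[m --> U] --> phi u by have [] := phiU u.
have phim : {homo phi : u v / u <= v}.
  move=> u v uv; apply: (ler_cvg_to (phi_cvg u) (phi_cvg v)).
  by apply: nearW => m; exact: phi_m.
exists phi; split => // a a0.
have cpow u : phi_ m u `^ a @[m --> U] --> phi u `^ a.
  apply: (within_continuous_cvg (powR_halfline_continuous a0)) => //.
    by rewrite /= in_itv/= andbT; have /andP[] := phi01 u.
  by move=> m; rewrite /= in_itv/= andbT; have /andP[] := phi_01 m u.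
rewrite Ifin ?(ltW a0)//; congr EFin; apply/eqP.
rewrite -subr_eq0 -normr_eq0 eq_le normr_ge0 andbT; apply/ler_addgt0Pr => e e0.
(* Four errors occur: the Riemann sums of [phi] and of [phi_ m], the convergence of these sums along
   [U], and the convergence of the integrals to [r a]. *)
rewrite add0r; have e4 : 0 < e / 4 by rewrite divr_gt0.
pose N := (Num.truncn (e / 4)^-1).+1.
have Ne : N%:R^-1 <= e / 4.
  rewrite -[leRHS]invrK lef_pV2 ?posrE ?invr_gt0// ltW//.
  exact: truncnS_gt.
pose S (g : R -> R) : R := N%:R^-1 * \sum_(i < N) g (i%:R / N%:R) `^ a.
have ISm (g : R -> R) : {homo g : u v / u <= v} -> (forall u, 0 <= g u <= 1) ->
    `|I g a - S g| <= e / 4.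
  move=> gm g01; apply: le_trans Ne.
  apply: (@quantile_riemann_sum _ (fun u => g u `^ a)) => //; last first.
    by move=> u; apply: pow01 => //; exact: ltW.
  move=> u v uv; apply: ge0_ler_powR; rewrite ?nnegrE ?(ltW a0) ?gm//.
    by have /andP[] := g01 u.
  by have /andP[] := g01 v.
have Scvg : S (phi_ m) @[m --> U] --> S phi.
  apply: cvgM; first exact: cvg_cst.
  by apply: cvg_big => [|i _]; [exact: add_continuous|exact: cpow].
have h1 : \forall m \near U, `|S phi - S (phi_ m)| <= e / 4.
  by move/cvgrPdist_le : Scvg; exact.
have h2 : \forall m \near U, `|r a - I (phi_ m) a| <= e / 4.
  by apply: oU; move/cvgrPdist_le : (Icvg a a0); exact.
have [m [m1 m2]] := filter_ex (filterI h1 h2).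
have := ISm _ phim phi01; have := ISm _ (phi_m m) (phi_01 m).
move: m1 m2.
generalize (I phi a) (S phi) (S (phi_ m)) (I (phi_ m) a) (r a) => v1 v2 v3 v4 v5.
move=> h12 h34 h24 h13; rewrite (_ : v1 - v5 = (v1 - v2) + (v2 - v3) - (v4 - v3) - (v5 - v4)); last by ring.
rewrite (_ : e = e / 4 + e / 4 + e / 4 + e / 4); last by field.
by do 2![rewrite (le_trans (ler_normB _ _))// lerD//]; rewrite (le_trans (ler_normD _ _))// lerD.
Unshelve. all: by end_near.
Qed.

(** [X] is [- ln phi] on the unit interval. The zeros of [phi], where [X] ought to be infinite, have
    measure at most [1 - r a] for every [a > 0], hence 0 by continuity of [r] at 0. *)
Lemma bernstein : exists X : R -> R,
  [/\ measurable_fun setT X, forall u, 0 <= X u &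
    forall a, 0 <= a ->
      (\int[uniform_prob (@ltr01 R)]_u (expR (- a * X u))%:E = (r a)%:E)%E].
Proof.
have [phi [phim phi01 phi_laplace]] := quantile_laplace.
have mphi : measurable_fun setT phi by exact: nondecreasing_measurable.
pose X u : R := - ln (phi u).
have mX : measurable_fun setT X.
  by apply: measurableT_comp => //; exact: (measurableT_comp (@measurable_ln R)).
exists X; split => //.
  by move=> u; rewrite oppr_ge0 ln_le0//; have /andP[] := phi01 u.
have mexp a : measurable_fun setT (fun u => (expR (- a * X u))%:E).
  by apply/measurable_EFinP; apply: measurableT_comp => //; exact: measurable_funM.
have [_ cr _ _] := hr.
pose Z : set R := `[0, 1[ `&` phi @^-1` [set 0].
have mZ : measurable Z.
  by apply: measurableI => //; rewrite -[X in measurable X]setTI; exact: mphi.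
have Z0 : mu Z = 0%E.
  have Zle a : 0 < a -> (mu Z <= (1 - r a)%:E)%E.
    move=> a0; rewrite EFinB leeBrDr// -(phi_laplace a a0).
    have -> : mu Z = (\int[mu]_(u in `[0%R, 1%R[) (\1_Z u)%:E)%E.
      by rewrite integral_indic//; congr (mu _); apply/seteqP; split => [u [[]]//|u [? ?]].
    rewrite -ge0_integralD//=.
    - apply: (@le_trans _ _ (\int[mu]_(u in `[0%R, 1%R[) 1)%E); last first.
        by rewrite integral_cst//= lebesgue_measure_itv/= lte_fin ltr01 mul1e oppr0 adde0.
      apply: ge0_le_integral => //.
      + by move=> u _; rewrite -EFinD lee_fin addr_ge0// powR_ge0.
      + apply: emeasurable_funD; first exact/measurable_EFinP/measurable_indic.
        apply/measurable_EFinP; apply: measurable_funTS.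
        exact: (measurableT_comp (measurable_powR a)).
      + move=> u _; rewrite -EFinD lee_fin indicE.
        case: (boolP (u \in Z)); last first.
          rewrite add0r => _; have := ge0_ger_powR (phi01 u) (lexx 0) (ltW a0).
          by rewrite powRr0.
        by rewrite inE => -[_ ->]; rewrite powR0 ?gt_eqF// addr0.
    - exact/measurable_EFinP/measurable_indic.
    - by move=> u _; rewrite lee_fin powR_ge0.
    - apply/measurable_EFinP; apply: measurable_funTS.
      exact: (measurableT_comp (measurable_powR a)).
  have cr0 : (1 - r n.+1%:R^-1) @[n --> \oo] --> (0 : R).
    rewrite -[X in _ --> X](subrr 1) -[X in _ --> _ - X]r0; apply: cvgB; first exact: cvg_cst.
    apply: (within_continuous_cvg cr); last exact: cvg_harmonic.
    - by rewrite /= in_itv/= lexx.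
    - by move=> n; rewrite /= in_itv/= andbT.
  have muZ : mu Z \is a fin_num.
    by rewrite ge0_fin_numE// (le_lt_trans (Zle 1 ltr01))// ltry.
  apply/eqP; rewrite eq_le measure_ge0 andbT -(fineK muZ) lee_fin.
  apply: (cvgr_to_ge cr0); apply: nearW => n.
  by rewrite -lee_fin fineK// Zle.
move=> a; rewrite le_eqVlt => /predU1P[<-|a0].
  rewrite (_ : (\int[_]_u _ = \int[uniform_prob (@ltr01 R)]_u 1)%E); last first.
    by apply: eq_integral => u _; rewrite oppr0 mul0r expR0.
  by rewrite integral_cst// [X in (_ * X)%E]probability_setT mule1 r0.
rewrite integral_uniform//; last exact: mexp.
rewrite -(phi_laplace a a0) subr0 invr1 mul1e.
rewrite -integral_itv_bndo_bndc; last exact: measurable_funTS.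
apply: ae_eq_integral => //.
- by apply: measurable_funTS; exact: mexp.
- apply/measurable_EFinP; apply: measurable_funTS.
  exact: (measurableT_comp (measurable_powR a)).
exists Z; split => // u /= /not_implyP[u01 ne]; split => //=.
apply: contrapT => /eqP pn0; apply: ne; congr EFin.
by rewrite /powR (negbTE pn0) mulNr mulrN opprK.
Qed.

End bernstein.

(** * Randomized starting point *)

Section density_identification.
Context (R : realType) (b f : R -> R).
Local Notation mu := (@lebesgue_measure R).
Hypotheses (cb : continuous_on_halfline b) (hf : probability_density f).
Hypothesis kernel_bounded : forall a : R, 0 < a ->
  exists C : R, forall t : R, 0 <= t -> hitting_kernel b a t <= C.
Hypothesis hz : kernel_complete b.
Variable nu : {finite_measure set (measurableTypeR R) -> \bar R}.
Hypothesis nu_mu : nu `<< mu.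

Let D : set (measurableTypeR R) := `[0, +oo[%classic.

Let mD : measurable D. Proof. exact: measurable_itv. Qed.

Lemma kernel_density_integrable (a : R) : 0 < a ->
  mu.-integrable `[0, +oo[ (fun t => (hitting_kernel b a t * f t)%:E).
Proof.
move=> a0; have [C kC] := kernel_bounded a0.
have [mf f0 _] := hf.
have Cf : mu.-integrable D (fun t => C%:E * (f t)%:E)%E.
  exact: (integrableZl mD C (probability_density_integrable hf)).
apply: (le_integrable mD _ _ Cf).
  by apply/measurable_EFinP; apply: measurable_funM => //; exact: measurable_hitting_kernel.
move=> t; rewrite /D /= in_itv/= andbT => t0; rewrite lee_fin.
have k0 : 0 <= hitting_kernel b a t by exact: expR_ge0.
rewrite !normrM ler_wpM2r// ger0_norm// (le_trans (kC t t0))//; exact: ler_norm.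
Qed.

(** Both [f] and the Radon-Nikodym derivative [g] of [nu] are integrable against the kernel, so
    their difference is an admissible [z] in [kernel_complete]. *)
Lemma kernel_complete_density :
  (forall a : R, 0 < a -> (\int[nu]_(t in `[0%R, +oo[) (hitting_kernel b a t)%:E =
     (hitting_transform b f a)%:E)%E) ->
  forall A : set R, measurable A ->
    nu (A `&` `[0, +oo[) = (\int[mu]_(t in A `&` `[0%R, +oo[) (f t)%:E)%E.
Proof.
move=> nu_laplace; have [mf f0 _] := hf.
pose g := Radon_Nikodym_SigmaFinite.f nu mu.
have g0 := Radon_Nikodym_SigmaFinite.f_ge0 nu_mu.
have gfin := Radon_Nikodym_SigmaFinite.f_fin_num nu_mu.
have gE := Radon_Nikodym_SigmaFinite.f_integral nu_mu.
have mg : measurable_fun setT g.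
  exact: measurable_int (Radon_Nikodym_SigmaFinite.f_integrable nu_mu).
have mgD : measurable_fun D (fine \o g).
  by apply: measurable_funTS; apply: measurableT_comp.
have mk a : measurable_fun D (hitting_kernel b a) := measurable_hitting_kernel cb a.
have kg a : 0 < a -> (\int[mu]_(t in D) (hitting_kernel b a t * fine (g t))%:E =
    (hitting_transform b f a)%:E)%E.
  move=> a0; rewrite -(nu_laplace a a0).
  rewrite -(@Radon_Nikodym_SigmaFinite.change_of_variables _ _ _ nu mu nu_mu
     (fun t => (hitting_kernel b a t)%:E)) => //.
  - by apply: eq_integral => t _; rewrite EFinM fineK//; exact: gfin.
  - by move=> t; rewrite lee_fin expR_ge0.
  - by apply/measurable_EFinP; exact: mk.
have kg_int a : 0 < a ->
    mu.-integrable D (fun t => (hitting_kernel b a t * fine (g t))%:E).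
  move=> a0; apply/integrableP; split.
    by apply/measurable_EFinP; exact: measurable_funM.
  suff -> : (\int[mu]_(t in D) `|(hitting_kernel b a t * fine (g t))%:E| =
      \int[mu]_(t in D) (hitting_kernel b a t * fine (g t))%:E)%E by rewrite kg// ltry.
  apply: eq_integral => t _ /=; rewrite ger0_norm// mulr_ge0 ?expR_ge0//.
  by apply: fine_ge0; exact: g0.
have zE a : (fun t : R => (hitting_kernel b a t * (fine (g t) - f t))%:E) =
    (fun t : R => (hitting_kernel b a t * fine (g t))%:E - (hitting_kernel b a t * f t)%:E)%E.
  by apply/funext => t; rewrite mulrBr EFinB.
have z0 := hz (z := fun t => fine (g t) - f t) _ _ _.
have {}z0 : {ae mu, forall t : R, 0 <= t -> fine (g t) - f t = 0}.
  apply: z0.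
  - exact: measurable_funB.
  - move=> a a0; rewrite zE.
    by apply: integrableB => //; [exact: kg_int|exact: kernel_density_integrable].
  - move=> a a0; rewrite zE.
    rewrite integralB//; [|exact: kg_int|exact: kernel_density_integrable].
    rewrite kg// /hitting_transform /Rintegral fineK ?subee//;
      exact: (integrable_fin_num mD (kernel_density_integrable a0)).
move=> A mA; have mAD : measurable (A `&` D) by exact: measurableI.
rewrite gE//; apply: ae_eq_integral => //.
- exact: measurable_funTS.
- by apply/measurable_EFinP; apply: measurable_funS mf => //; exact: measurable_itv.
case: z0 => N [mN N0 NE]; exists N; split => // t /= nt; apply: NE => /= h; apply: nt.
move=> [_]; rewrite /= in_itv/= andbT => t0.
by rewrite -(fineK (gfin t)); congr EFin; apply/eqP; rewrite -subr_eq0; apply/eqP; exact: h.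
Qed.

End density_identification.

(** * Product space carrying the starting point *)

Section product_space.
Context (R : realType) (d d' : measure_display) (T : measurableType d)
  (U : measurableType d') (P : probability T R) (Q : probability U R)
  (W : R -> T -> R) (Y : U -> R).
Hypotheses (hW : standard_brownian_motion P W) (mY : measurable_fun setT Y).

Let W' (t : R) (w : T * U) : R := W t w.1.
Let X (w : T * U) : R := Y w.2.

Let product_setX A B : measurable A -> measurable B ->
  (P \x Q)%E (A `*` B) = (P A * Q B)%E.
Proof. by move=> mA mB; exact: (product_measure1E P Q mA mB). Qed.

Lemma product_probability_extension : probability_extension P (P \x Q)%E fst.
Proof.
split; first exact: measurable_fst.
move=> A mA; have -> : fst @^-1` A = A `*` [set: U].
  by apply/seteqP; split => [w|w []].
by have := product_setX mA measurableT; rewrite probability_setT mule1.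
Qed.

(** Every event of [W'] is a cylinder over a measurable set of the first factor, because these
    cylinders form a sigma-algebra containing the generators. *)
Lemma product_independent_of_process : independent_of_process (P \x Q)%E X W'.
Proof.
have [mW _ _ _ _] := hW.
move=> A B sA mB.
have [A0 mA0 ->] : exists2 A0, measurable A0 & A = fst @^-1` A0.
  apply: (sA [set A | exists2 A0, measurable A0 & A = fst @^-1` A0]); split.
    split.
    - by exists set0; rewrite ?preimage_set0.
    - move=> _ [A0 mA0 ->]; exists (~` A0); first exact: measurableC.
      by rewrite setTD preimage_setC.
    - move=> F FP; have [A0 A0P] := choice (fun n => let: ex_intro2 A1 p q := FP n in
        ex_intro _ A1 (conj p q)).
      exists (\bigcup_n A0 n); first by apply: bigcup_measurable => n _; have [] := A0P n.
      by rewrite preimage_bigcup; apply: eq_bigcupr => n _; have [] := A0P n.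
  move=> _ [t [t0 [C [mC ->]]]]; exists (W t @^-1` C) => //.
  by rewrite -[X in measurable X]setTI; exact: mW.
have mYB : measurable (Y @^-1` B) by rewrite -[X in measurable X]setTI; exact: mY.
have -> : fst @^-1` A0 `&` X @^-1` B = A0 `*` (Y @^-1` B) by [].
have -> : X @^-1` B = [set: T] `*` (Y @^-1` B).
  by apply/seteqP; split => [w|w []].
have [_ ->//] := product_probability_extension.
have := product_setX mA0 mYB; have := product_setX measurableT mYB.
by rewrite probability_setT mul1e => /= -> ->.
Qed.

Lemma product_ge0_integral (h : R -> R) : measurable_fun setT h -> (forall x, 0 <= h x) ->
  (\int[P \x Q]_w (h (X w))%:E = \int[Q]_u (h (Y u))%:E)%E.
Proof.
move=> mh h0; have mhY : measurable_fun setT (fun u => (h (Y u))%:E).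
  by apply/measurable_EFinP; exact: measurableT_comp.
rewrite fubini_tonelli2//.
- apply: eq_integral => u _; rewrite /fubini_G /=.
  transitivity (\int[P]_x cst (h (Y u))%:E x)%E => //.
  by rewrite integral_cst// [X in (_ * X)%E]probability_setT mule1.
- by apply: (measurableT_comp mhY); exact: measurable_snd.
- by move=> w; rewrite lee_fin.
Qed.

Variable b : R -> R.
Hypotheses (cb : continuous_on_halfline b) (b0 : b 0 = 0).
Hypotheses (Y_ge0 : forall u, 0 <= Y u) (Y_neq0 : Q (Y @^-1` [set 0]) = 0%E).

Let tau := hitting_time b W' X.

Lemma measurable_product_hitting_time : measurable_fun setT tau.
Proof.
have [mW _ cW _ _] := hW.
pose gap (t : R) (w : T * U) := W t w.1 + Y w.2 - b t.
have -> : tau = (fun w => ereal_inf [set t%:E | t in [set t : R | 0 < t /\ gap t w <= 0]]).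
  apply/funext => w; congr ereal_inf; apply/seteqP; split => _ [t [t0 ht] <-].
    by exists t => //; split => //; rewrite subr_le0.
  by exists t => //; split => //; rewrite -subr_le0.
apply: measurable_hitting_time => [q q0|w].
  apply: measurable_funB => //; apply: measurable_funD.
    by apply: (measurableT_comp (mW q q0)); exact: measurable_fst.
  by apply: (measurableT_comp mY); exact: measurable_snd.
have /subspace_continuousP cWw := cW w.1; move/subspace_continuousP : (cb) => cb'.
apply/subspace_continuousP => q q0; apply: cvgB; last exact: cb'.
by apply: cvgD; [exact: cWw|exact: cvg_cst].
Qed.

(** Tonelli with the starting point frozen; the null sets [Y = 0] and [W 0 <> 0] are discarded on
    the way. [G] is general in order to serve both for indicators of null sets and for the
    kernel. *)
Lemma product_hitting_time_integral (G : \bar R -> \bar R) (h : R -> R) :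
  measurable_fun setT G -> (forall t, 0 <= G t)%E -> measurable_fun setT h ->
  (forall x, 0 < x -> (\int[P]_w G (increment_hitting_time W b x w) = (h x)%:E)%E) ->
  (\int[P \x Q]_w G (tau w) = \int[Q]_u (h (Y u))%:E)%E.
Proof.
move=> mG G0 mh Gh; have [_ W0 _ _ _] := hW.
have mGtau : measurable_fun setT (G \o tau).
  exact: measurableT_comp mG measurable_product_hitting_time.
transitivity (\int[Q]_u fubini_G P (G \o tau) u)%E.
  by apply: fubini_tonelli2 => // w; exact: G0.
apply: ae_eq_integral => //.
- by apply: measurable_fun_fubini_tonelli_G => // w; exact: G0.
- by apply/measurable_EFinP; exact: measurableT_comp.
exists (Y @^-1` [set 0]); split => //.
  by rewrite -[X in measurable X]setTI; exact: mY.
move=> u /= nu; apply: contrapT => Yu; apply: nu => _.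
have Yu0 : 0 < Y u by rewrite lt_neqAle eq_sym Y_ge0 andbT; apply/eqP.
have b0Y : b 0 < Y u by rewrite b0.
rewrite -(Gh _ Yu0) /fubini_G; apply: ae_eq_integral => //.
- exact: (measurableT_comp mGtau (pair2_measurable _)).
- by apply: (measurableT_comp mG); exact: (@measurable_increment_hitting_time R d T P W hW b (Y u) cb).
case: W0 => N [mN N0 NW]; exists N; split => // w /= nw; apply: NW => /= Ww.
apply: nw => _; congr G; congr ereal_inf.
by apply/seteqP; split => _ [t [t0 ht] <-]; exists t => //; split => //;
  move: ht; rewrite /brownian_gap /increment Ww subr0 subr_le0.
Qed.

End product_space.

Section finite_part.
Context (R : realType).

(* Sending +oo outside the half line keeps the event that the boundary is never
   hit apart from the hitting times; [fine] would turn it into mass at 0. *)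
Definition finite_part (t : \bar R) : R := if t is r%:E then r else -1.

Lemma measurable_finite_part : measurable_fun setT finite_part.
Proof.
have mF : measurable (EFin @` [set: R]) by apply: (@measurable_image_EFin R setT); exact: measurableT.
have -> : finite_part = (fun t => fine t + (\1_(EFin @` [set: R]) t - 1)).
  apply/funext => -[r| |] /=; rewrite indicE.
  - by rewrite mem_set ?subrr ?addr0//; exists r.
  - by rewrite memNset ?add0r// => -[].
  - by rewrite memNset ?add0r// => -[].
apply: measurable_funD; first exact: fine_measurable.
by apply: measurable_funB => //; exact: measurable_indic.
Qed.

End finite_part.

Arguments finite_part {R} t.

Lemma hitting_time_ge0 (R : realType) (d : measure_display) (T : measurableType d)
  (b : R -> R) (W : R -> T -> R) (X : T -> R) w : (0 <= hitting_time b W X w)%E.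
Proof. by apply: le_ereal_inf_tmp => _ [t [t0 _] <-]; rewrite lee_fin ltW. Qed.

Theorem theorem3p1 (R : realType) (d : measure_display) (T : measurableType d)
    (P : probability T R) (W : R -> T -> R)
    (hW : standard_brownian_motion P W)
    (b : R -> R) (hb0 : b 0 = 0)
    (hbC1 : continuously_differentiable_on_halfline b)
    (f : R -> R) (hf : probability_density f)
    (hb_cont : continuous_on_halfline b)
    (hb_lim : forall a : R, 0 < a ->
       exists l : \bar R,
         ((b t + a * t)%:E @[t --> +oo%R] --> l) /\ (-oo < l)%E)
    (hr : completely_monotone (hitting_transform b f))
    (hz : kernel_complete b) :
  exists (d' : measure_display) (T' : measurableType d')
    (P' : probability T' R) (pr : T' -> T) (X : T' -> R),
    let W' := fun t w => W t (pr w) in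
    [/\ probability_extension P P' pr,
        measurable_fun setT X /\ (forall w, 0 <= X w),
        independent_of_process P' X W',
        forall a : R, 0 <= a ->
          ('E_P'[fun w => expR (- a * X w)] = (hitting_transform b f a)%:E)%E &
        has_density P' (hitting_time b W' X) f].
Proof.
have r0 : hitting_transform b f 0 = 1.
  have [_ _ f1] := hf; rewrite /hitting_transform /Rintegral.
  under eq_integral => t _.
    rewrite /hitting_kernel oppr0 mul0r expr0n/= !mul0r subrr expR0 mul1r; over.
  by rewrite f1.
have [Y [mY Y0 Y_laplace]] := bernstein hr r0.
pose Q : probability (measurableTypeR R) R := uniform_prob (@ltr01 R).
have {}mY : measurable_fun [set: measurableTypeR R] Y.
  by move=> mT B mB; exact: (mY mT B mB).
have mYE a : measurable_fun setT (fun x : R => expR (- a * x)).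
  by apply: measurableT_comp => //; exact: measurable_funM.
pose Z : set (measurableTypeR R) := Y @^-1` [set 0].
have QY0 : Q Z = 0%E.
  have mZ : measurable Z.
    by rewrite -[X in measurable X]setTI; exact: mY.
  have Qle n : (Q Z <= (hitting_transform b f n%:R)%:E)%E.
    rewrite -Y_laplace// -[X in (X <= _)%E]mul1e.
    have -> : (1 * Q Z = \int[Q]_u (\1_Z u)%:E)%E.
      by rewrite integral_indic// setIT mul1e.
    apply: ge0_le_integral => //.
    - exact/measurable_EFinP/measurable_indic.
    - by apply/measurable_EFinP; exact: (measurableT_comp (mYE n%:R) mY).
    - move=> u _; rewrite lee_fin indicE.
      case: (boolP (u \in _)) => [|_]; last exact: expR_ge0.
      by rewrite inE /= => ->; rewrite mulr0 expR0.
  apply/eqP; rewrite eq_le measure_ge0 andbT.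
  have Qfin : Q Z \is a fin_num by exact: fin_num_measure.
  rewrite -(fineK Qfin) lee_fin.
  apply: (cvgr_to_ge (hitting_transform_cvg0 hb0 hbC1 hb_cont hb_lim hf)).
  apply: nearW => n; by rewrite -lee_fin fineK.
have kC a : 0 < a -> exists C : R, forall t : R, 0 <= t -> hitting_kernel b a t <= C.
  move=> a0; have [K K0 kK] := hitting_kernel_le hb_cont hb_lim a0.
  exists (expR K) => t t0; rewrite (le_trans (kK t t0))// ler_expR gerBl.
  by rewrite mulr_ge0// divr_ge0// sqr_ge0.
exists _, (T * measurableTypeR R)%type, (P \x Q)%E, fst, (fun w => Y w.2).
pose W' (t : R) (w : T * measurableTypeR R) : R := W t w.1.
pose X (w : T * measurableTypeR R) : R := Y w.2.
have mtau := measurable_product_hitting_time hW mY hb_cont.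
split.
- exact: product_probability_extension.
- split; last by move=> w; exact: Y0.
  by apply: (measurableT_comp mY); exact: measurable_snd.
- exact: product_independent_of_process hW mY.
- move=> a a0; rewrite unlock -Y_laplace//.
  exact: (product_ge0_integral P Q mY (h := fun x => expR (- a * x))).
split; first exact: mtau.
move=> A mA; pose D : set (measurableTypeR R) := `[0, +oo[%classic.
have mD : measurable D by exact: measurable_itv.
pose tau := hitting_time b W' X.
have mproj : measurable_fun setT (finite_part \o tau).
  exact: (measurableT_comp (@measurable_finite_part R) mtau).
have {}mproj : measurable_fun setT (finite_part \o tau : _ -> measurableTypeR R).
  by move=> mT B mB; exact: (mproj mT B mB).
(* A priori [nu] may have mass below 1: paths that never hit are sent to [-1] and lost in the
   restriction to [D]. *)
pose nu := mrestr (law (P \x Q)%E mproj) mD.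
have nuE (B : set R) : measurable B ->
    nu (B `&` D) = (P \x Q)%E (tau @^-1` (EFin @` (B `&` D))).
  move=> mB; rewrite /nu /mrestr /law /pushforward -setIA setIid; congr (_ _).
  apply/seteqP; split => w /=.
    have := hitting_time_ge0 b W' X w; rewrite -/(tau w).
    case: (tau w) => [t| |] //= t0; last first.
      by rewrite /D /= in_itv/= andbT => -[_]; rewrite lerNr oppr0 ler10.
    by move=> BDt; exists t.
  by move=> [t BDt <-].
have nu_mu : nu `<< @lebesgue_measure R.
  apply/null_content_dominatesP => N mN N0.
  have mND : measurable (N `&` D) by exact: measurableI.
  have ND0 : lebesgue_measure (N `&` D) = 0%E by apply: subset_measure0 N0.
  have -> : nu N = nu (N `&` D) by rewrite /nu /mrestr -setIA setIid.
  rewrite nuE//.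
  have mE : measurable (EFin @` (N `&` D)) by exact: measurable_image_EFin.
  have -> : (P \x Q)%E (tau @^-1` (EFin @` (N `&` D))) =
      (\int[P \x Q]_w (\1_(EFin @` (N `&` D)) (tau w))%:E)%E.
    rewrite (_ : (fun w => _) = (fun w => (\1_(tau @^-1` (EFin @` (N `&` D))) w)%:E))//.
    by rewrite integral_indic ?setIT// -[X in measurable X]setTI; exact: mtau.
  (* With [G] the indicator of the null set, the inner integral is 0 for each fixed start, whence
     [h = 0]. *)
  rewrite (product_hitting_time_integral hW mY hb_cont hb0 Y0 QY0
    (G := fun t => (\1_(EFin @` (N `&` D)) t)%:E) (h := cst 0))//.
  - by rewrite integral0.
  - exact/measurable_EFinP/measurable_indic.
  - move=> x x0.
    have b0x : b 0 < x by rewrite hb0.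
    have mi := measurable_increment_hitting_time hW x hb_cont.
    transitivity (P (increment_hitting_time W b x @^-1` (EFin @` (N `&` D)))).
      rewrite (_ : (fun w => _) = (fun w =>
        (\1_(increment_hitting_time W b x @^-1` (EFin @` (N `&` D))) w)%:E))//.
      by rewrite integral_indic ?setIT// -[X in measurable X]setTI; exact: mi.
    apply: (increment_hitting_time_dominated hW hb_cont b0x _ mND ND0) => M.
    have [L L0 bL] := boundary_lipschitz hbC1 hb_cont M; exists L => // s s' s0 ss' s'M.
    by rewrite (le_trans (ler_norm _))// bL.
have nu_laplace a : 0 < a -> (\int[nu]_(t in D) (hitting_kernel b a t)%:E =
    (hitting_transform b f a)%:E)%E.
  move=> a0; pose k := (fun t => (hitting_kernel b a t)%:E) \_ D.
  have mkD : measurable_fun D (fun t => (hitting_kernel b a t)%:E).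
    by apply/measurable_EFinP; exact: measurable_hitting_kernel hb_cont a.
  have mk : measurable_fun setT k by apply/(measurable_restrictT _ mD).
  have k0 t : (0 <= k t)%E by rewrite /k patchE; case: ifP => // _; rewrite lee_fin expR_ge0.
  transitivity (\int[law (P \x Q)%E mproj]_(t in D) (hitting_kernel b a t)%:E)%E.
    apply: eq_measure_integral => B mB BD.
    transitivity (law (P \x Q)%E mproj (B `&` D)); first by [].
    by rewrite (setIidl BD).
  rewrite integral_mkcond -/k ge0_integral_law//.
  transitivity (\int[Q]_u (expR (- a * Y u))%:E)%E; last by rewrite Y_laplace// ltW.
  apply: (product_hitting_time_integral hW mY hb_cont hb0 Y0 QY0
    (G := k \o finite_part) (h := fun x => expR (- a * x))) => //.
  - exact: (measurableT_comp mk (@measurable_finite_part R)).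
  - by move=> t; exact: k0.
  - move=> x x0; have b0x : b 0 < x by rewrite hb0.
    rewrite -(increment_hitting_time_laplace hW hb_cont b0x a0 (hitting_kernel_cvg0 hb_cont hb_lim a0)).
    apply: eq_integral => w _ /=.
    have : (0 <= increment_hitting_time W b x w)%E.
      by apply: le_ereal_inf_tmp => _ [t [t0 _] <-]; rewrite lee_fin ltW.
    rewrite /k patchE; case: (increment_hitting_time W b x w) => [t| |]//= t0.
      by rewrite mem_set// /D /= in_itv/= andbT.
    by rewrite memNset// /D /= in_itv/= andbT lerNr oppr0 ler10.
rewrite -(kernel_complete_density hb_cont hf kC hz nu_mu nu_laplace mA).
transitivity ((P \x Q)%E (tau @^-1` (EFin @` (A `&` D)))); last by rewrite -nuE.
congr ((P \x Q)%E _); apply/seteqP; split => w /= [t].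
- move=> At tE; exists t => //; split => //; rewrite /D /= in_itv/= andbT.
  by rewrite -lee_fin tE; exact: hitting_time_ge0.
- by move=> [At _] tE; exists t.
Qed.
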